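(* Fix an integer $d\ge 2$. For each $n$ let $\mathbf p=\mathbf p(n)=(p_1,\dots,p_d)\in(0,1]^d$, and suppose that $np_d(1-p_d)\to\infty$ as $n\to\infty$. Let $A_n$ and $A_n^+$ denote the unsigned and signed adjacency matrices of the multi-parameter upper model $Z_d(n,\mathbf p)$, respectively. Then both $$\mu_{\frac{A_n}{\sqrt{ndp_d(1-p_d)}}}\xrightarrow{\;w\;}\mu_{sc}\qquad\text{and}\qquad \mu_{\frac{A_n^+}{\sqrt{ndp_d(1-p_d)}}}\xrightarrow{\;w\;}\mu_{sc}$$ almost surely as $n\to\infty$.
   Context: Simplicial complexes: a simplicial complex $X$ on a finite vertex set $V$ is a collection of subsets of $V$ closed under taking subsets. A cell $\sigma\in X$ has dimension $|\sigma|-1$; a cell of dimension $j$ is a $j$-cell, and $X^j$ is the set of $j$-cells of $X$. The model $Z_d(n,\mathbf p)$ (multi-parameter upper model): let $\mathcal X(n,\mathbf p)$ be the random hypergraph on $[n]=\{1,\dots,n\}$ in which, for each $1\le j\le d$, each subset of $[n]$ of cardinality $j+1$ (a $j$-cell) is included independently with probability $p_j$. Then $Z_d(n,\mathbf p)$ is the smallest simplicial complex containing $\mathcal X(n,\mathbf p)$, i.e. $Z_d(n,\mathbf p)=\bigcup_{\sigma\in\mathcal X(n,\mathbf p)}\{\sigma':\sigma'\subseteq\sigma\}$. The complexes for all $n$ are defined on a common probability space, from a triangular family of independent Bernoulli variables $\chi_\tau^{(n)}$ (with parameter $p_{|\tau|-1}(n)$) indicating $\tau\in\mathcal X(n,\mathbf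 p)$. Orientation: an orientation of a $j$-cell ($j\ge1$) is an ordering $[x_0,\dots,x_j]$ of its vertices, two orderings being identified if they differ by an even permutation; thus each $j$-cell has exactly two orientations, and $\bar\sigma$ (also written $-\sigma$) denotes $\sigma$ with the opposite orientation. The positive orientation is the one given by the increasing order of the vertices; $X_+^{j}$ is the set of positively oriented $j$-cells, which is in natural bijection with $X^j$. An oriented $j$-cell $[\sigma^0,\dots,\sigma^j]$ induces on the $(j-1)$-cell obtained by deleting $\sigma^i$ the orientation $(-1)^i[\sigma^0,\dots,\sigma^{i-1},\sigma^{i+1},\dots,\sigma^j]$; the oriented boundary consists of these oriented cells. For oriented $(d-1)$-cells $\sigma,\sigma'$ write $\sigma\overset{X}{\sim}\sigma'$ if there is an oriented $d$-cell $\tau$ of $X$ such that both $\sigma$ and $\overline{\sigma'}$ belong to the oriented boundary of $\tau$. Adjacency matrices: the unsigned adjacency matrix $A$ of $X$ is indexed by $X^{d-1}\times X^{d-1}$, with $A_{\sigma,\sigma'}=1$ if $\sigma\cup\sigma'\in X^d$ and $0$ otherwise. The signed adjacency matrix $A^+$ is indexed by $X_+^{d-1}\times X_+^{d-1}$, has zero diagonal, and for $\sigma\ne\sigma'$ has $A^+_{\sigma,\sigma'}=1$ if $\sigma\overset{X}{\sim}\sigma'$, $-1$ if $\sigma\overset{X}{\sim}\overline{\sigma'}$, and $0$ otherwise. For the random complex these matrices have random dimension $|Z^{d-1}|$. Spectral measures: for an $N\times N$ real symmetric matrix $M$ with eigenvalues $\lambda_1,\dots,\lambda_N$, $\mu_M=\frac1N\sum_{i=1}^N\delta_{\lambda_i}$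 is its empirical spectral measure (if $N=0$, take $\mu_M=\delta_0$ by convention). $\mu_{sc}$ is the standard semicircle law, with density $\frac1{2\pi}\sqrt{4-s^2}\,\mathbf 1_{[-2,2]}(s)$. *)

(* Defs.v *)
From HB Require Import structures.
From mathcomp Require Import all_boot all_order all_algebra all_fingroup.

Set Implicit Arguments.
Unset Strict Implicit.
Unset Printing Implicit Defensive.

Import Order.TTheory GRing.Theory Num.Theory.

(* The vertex set [n] is 'I_n, that is {0, ..., n-1}. *)
Section SimplicialComplexes.
Variable n : nat.
Implicit Types (X H : {set {set 'I_n}}) (s t : {set 'I_n}).

Definition simplicial_complex X :=
  forall s t, t \in X -> s \subset t -> s \in X.

(* X^j *)
Definition cells X (j : nat) : {set {set 'I_n}} := [set s in X | #|s| == j.+1].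

Definition upper_complex H : {set {set 'I_n}} :=
  [set s : {set 'I_n} | [exists t in H, s \subset t]].

Lemma upper_complexP H : simplicial_complex (upper_complex H).
Proof.
move=> s t; rewrite !inE => /exists_inP[u Hu tu] st.
by apply/exists_inP; exists u => //; exact: subset_trans st tu.
Qed.

Lemma sub_upper_complex H : H \subset upper_complex H.
Proof.
by apply/subsetP => s Hs; rewrite inE; apply/exists_inP; exists s.
Qed.

Lemma upper_complex_min H X :
  simplicial_complex X -> H \subset X -> upper_complex H \subset X.
Proof.
move=> cX /subsetP HX; apply/subsetP => s; rewrite inE => /exists_inP[t Ht].
by apply: cX; exact: HX.
Qed.

(* the cells of dimension 1, ..., d *)
Definition hyperedges (d : nat) : {set {set 'I_n}} :=
  [set s : {set 'I_n} | 2 <= #|s| <= d.+1].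

Definition hypergraph (d : nat) (chi : pred {set 'I_n}) : {set {set 'I_n}} :=
  [set s in hyperedges d | chi s].

(* Z_d(n, p), as a function of the outcome chi of the Bernoulli variables *)
Definition upper_model (d : nat) (chi : pred {set 'I_n}) : {set {set 'I_n}} :=
  upper_complex (hypergraph d chi).

End SimplicialComplexes.

(* An oriented cell on k >= 2 vertices is a class of orderings of its vertices
   under even permutations, represented as the set of these orderings. *)
Section Orientation.
Variable n : nat.

Definition reorder k (x : k.-tuple 'I_n) (s : 'S_k) : k.-tuple 'I_n :=
  [tuple tnth x (s i) | i < k].

Definition orientation k (x : k.-tuple 'I_n) : {set k.-tuple 'I_n} :=
  [set reorder x s | s : 'S_k & ~~ odd_perm s].

Definition opposite k (c : {set k.-tuple 'I_n}) : {set k.-tuple 'I_n} :=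
  [set reorder x s | x in c, s in [set s : 'S_k | odd_perm s]].

Definition delete_vertex k (t : k.+1.-tuple 'I_n) (i : 'I_k.+1) :
    k.-tuple 'I_n :=
  [tuple tnth t (lift i j) | j < k].

(* The oriented cells (-1)^i [t_0, ..., t_(i-1), t_(i+1), ..., t_k]. *)
Definition oriented_boundary k (t : k.+1.-tuple 'I_n) :
    {set {set k.-tuple 'I_n}} :=
  [set (if odd i then opposite (orientation (delete_vertex t i))
        else orientation (delete_vertex t i)) | i : 'I_k.+1].

(* X_+^(k-1), the cells on k vertices with the orientation given by the
   increasing order *)
Definition positive_cells (X : {set {set 'I_n}}) (k : nat) :
    {set {set k.-tuple 'I_n}} :=
  [set orientation x | x : k.-tuple 'I_n &
     sorted ltn (map val x) && ([set v in x] \in X)].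

(* c ~ c' in X: the oriented d-cell is [t], for some ordering t of a d-cell. *)
Definition oriented_adjacent (X : {set {set 'I_n}}) d
    (c c' : {set d.-tuple 'I_n}) : bool :=
  [exists t : d.+1.-tuple 'I_n,
     [&& uniq t, [set v in t] \in cells X d,
         c \in oriented_boundary t & opposite c' \in oriented_boundary t]].

End Orientation.

Local Open Scope ring_scope.

Section AdjacencyMatrices.
Variables (R : pzRingType) (n : nat) (X : {set {set 'I_n}}) (d : nat).

Definition adjacency : 'M[R]_#|cells X d.-1| :=
  \matrix_(a, b) (enum_val a :|: enum_val b \in cells X d)%:R.

Definition signed_adjacency : 'M[R]_#|positive_cells X d| :=
  \matrix_(a, b)
    let c := enum_val a in let c' := enum_val b in
    if c == c' then 0
    else if oriented_adjacent X c c' then 1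
    else if oriented_adjacent X c (opposite c') then -1
    else 0.

End AdjacencyMatrices.

From mathcomp Require Import all_classical all_reals all_analysis.
From mathcomp Require Import measurable_realfun complex.
Import numFieldNormedType.Exports.

Section Eigenvalues.
Variable R : realType.
Local Open Scope classical_set_scope.

(* The eigenvalues with multiplicity, in some order; the sequence is
   determined up to permutation when the characteristic polynomial splits. *)
Definition eigenvalues N (M : 'M[R]_N) : seq R :=
  xget [::] [set s : seq R | char_poly M = \prod_(x <- s) ('X - x%:P)].

Lemma eigenvaluesP N (M : 'M[R]_N) : M^T = M ->
  char_poly M = \prod_(x <- eigenvalues M) ('X - x%:P).
Proof.
move=> symM; suff [s hs] : exists s : seq R,
    char_poly M = \prod_(x <- s) ('X - x%:P).
  by rewrite /eigenvalues; case: xgetP => [t -> //|/(_ s)]; case.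
pose f : {rmorphism R -> complex R} := real_complex R.
pose A := map_mx f M.
have Asym : A \is symmetricmx.
  by apply/is_hermitianmxP; rewrite expr0 scale1r map_mx_id// map_trmx symM.
have Areal : A \is a mxOver Num.real.
  by apply/mxOverP => i j; rewrite mxE; apply/complex_realP; exists (M i j).
have Aherm := realsym_hermsym Asym Areal.
have /mxOverP spR := hermitian_spectral_diag_real Aherm.
have /orthomx_spectralP Aeq := hermitian_normalmx Aherm.
have {spR}spR i : {x | spectral_diag A 0 i = f x}.
  by apply: cid; have /complex_realP[x ->] := spR 0 i; exists x.
exists [seq sval (spR i) | i <- enum 'I_N].
apply: (map_poly_inj f); rewrite map_char_poly -/A.
have -> : char_poly A = char_poly (diag_mx (spectral_diag A)).
  rewrite {1}Aeq /char_poly /char_poly_mx.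
  set D := diag_mx _; set P := spectralmx A.
  have PV : map_mx polyC (invmx P) *m map_mx polyC P = 1%:M.
    by rewrite -map_mxM mulVmx ?spectral_unit// map_mx1.
  have -> : 'X%:M - map_mx polyC (invmx P *m D *m P) =
      map_mx polyC (invmx P) *m ('X%:M - map_mx polyC D) *m map_mx polyC P.
    rewrite mulmxBr mulmxBl -!map_mxM; congr (_ - _).
    by rewrite scalar_mxC -mulmxA PV mulmx1.
  by rewrite !det_mulmx mulrAC -det_mulmx PV det1 mul1r.
rewrite char_poly_trig ?diag_mx_is_trig// rmorph_prod big_map big_enum/=.
apply: eq_bigr => i _; rewrite rmorphB/= map_polyX map_polyC/= !mxE eqxx.
by case: (spR i) => /= x <-.
Qed.

End Eigenvalues.

Section Measures.
Variable R : realType.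
Local Open Scope classical_set_scope.

Definition empirical_spectral_measure N (M : 'M[R]_N) :
    {measure set (measurableTypeR R) -> \bar R} :=
  if N == 0%N then [the measure _ _ of \d_(0 : measurableTypeR R)]
  else [the measure _ _ of mscale (N%:R^-1)%:nng
    (msum (fun k => \d_((eigenvalues M)`_k : measurableTypeR R)) N)].

Definition semicircle_pdf (x : R) : R :=
  (2 * pi)^-1 * Num.sqrt (4 - x ^+ 2) * \1_(`[-2, 2]) x.

Lemma semicircle_pdf_ge0 x : 0 <= semicircle_pdf x.
Proof. by rewrite /semicircle_pdf !mulr_ge0// invr_ge0 mulr_ge0// pi_ge0. Qed.

Lemma measurable_semicircle_pdf : measurable_fun setT semicircle_pdf.
Proof.
apply: measurable_funM; last by apply: measurable_indic.
apply: measurable_funM => //.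
apply: (measurableT_comp (f := @Num.sqrt R)).
  by apply: continuous_measurable_fun; exact: sqrt_continuous.
by apply: measurable_funB => //; exact: measurable_funX.
Qed.

Definition semicircle_law (A : set (measurableTypeR R)) : \bar R :=
  (\int[lebesgue_measure]_(x in A) (semicircle_pdf x)%:E)%E.

Let semicircle0 : semicircle_law set0 = 0%E.
Proof. by rewrite /semicircle_law integral_set0. Qed.

Let semicircle_ge0 A : (0 <= semicircle_law A)%E.
Proof.
by apply: integral_ge0 => x _; rewrite lee_fin semicircle_pdf_ge0.
Qed.

Let semicircle_sigma_additive : semi_sigma_additive semicircle_law.
Proof.
move=> /= A mA tA mUA; rewrite /semicircle_law ge0_integral_bigcup//=.
- apply: is_cvg_ereal_nneg_natsum_cond => n _ _; exact: semicircle_ge0.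
- apply/measurable_EFinP.
  exact: measurable_funTS measurable_semicircle_pdf.
- by move=> x _; rewrite lee_fin semicircle_pdf_ge0.
Qed.

HB.instance Definition _ := isMeasure.Build _ _ _ semicircle_law
  semicircle0 semicircle_ge0 semicircle_sigma_additive.

Definition weak_cvg (mu_ : {measure set (measurableTypeR R) -> \bar R}^nat)
    (mu : {measure set (measurableTypeR R) -> \bar R}) :=
  forall f : R -> R, continuous f -> (exists C, forall x, `|f x| <= C) ->
    (\int[mu_ n]_x (f x)%:E)%E @[n --> \oo] --> (\int[mu]_x (f x)%:E)%E.

End Measures.

Section Independence.
Context d d' (T : measurableType d) (T' : measurableType d') (R : realType).
Variable P : probability T R.
Local Open Scope classical_set_scope.

Definition mutually_independent (I : finType) (D : {set I})
    (X : I -> {mfun T >-> T'}) :=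
  forall J : {set I}, J \subset D ->
  forall B : I -> set T', (forall i, measurable (B i)) ->
    P (\bigcap_(i in [set` J]) (X i @^-1` B i)) =
    (\prod_(i in J) P (X i @^-1` B i))%E.

End Independence.

(* Main.v *)
Require Import Defs.
From HB Require Import structures.
From mathcomp Require Import all_boot all_order all_algebra all_fingroup.
From mathcomp Require Import all_classical all_reals all_analysis.
From mathcomp Require Import measurable_realfun complex.
From mathcomp Require Import ring lra zify.

(* Write [n] for the number of vertices, z = i eta with eta >= 3, and scale by
   h = (n d p_d (1 - p_d))^(-1/2).  Extended by zero to all the d-subsets of
   the vertices, either adjacency matrix is a sum over the (d+1)-subsets t of
   chi_t times a fixed block on the d + 1 faces of t.  The two sign patterns
   have the form W = -d I + sum_u w_u w_u^T, u ranging over the (d-1)-subsets,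
   so that the mean h p_d W is a multiple of the identity up to rank C(n, d-1),
   which is negligible with respect to N = C(n, d).  For the centred matrix the
   resolvent G satisfies, by the Stein identity for Bernoulli variables and
   resolvent perturbation, 1 + z g_a + g_a m_a = O(h) on average, where
   g_a = E G_aa and m_a is the mean of the g_b over the neighbours b of a; as
   eta >= 3 this relation is contractive, and g_a is close to the Stieltjes
   transform of the semicircle law at z.  The Efron-Stein inequality bounds the
   variance of N^-1 tr G by O(1/N) = O(n^-2), which is summable, whence almost
   sure convergence for the countably many z = i (3 + q), q >= 0 rational.
   By Weierstrass' theorem the functions x/(x^2+eta^2) and 1/(x^2+eta^2) for
   these eta determine weak convergence.  Finally the zeros added by the
   extension are few because the semicircle law has no atom at 0. *)

Set Implicit Arguments.
Unset Strict Implicit.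
Unset Printing Implicit Defensive.

Import Order.TTheory GRing.Theory Num.Theory.
Import numFieldNormedType.Exports.
Import Normc.
Local Open Scope classical_set_scope.
Local Open Scope ring_scope.

(** * Product Bernoulli expectations *)

(** The size of the adjacency matrices is random and depends on hyperedges of all dimensions, while
    the matrix on all d-subsets has a fixed size and is a function of the variables of dimension d
    alone; hence the extension by zero. It is not a Wigner matrix: the entries on the faces of one t
    share the variable chi_t. What replaces independence is that two distinct faces determine t, so
    that the blocks overlap only on the diagonal, where they vanish, and sums over t of products of
    entries of one row of G are controlled by the Ward identity. The leading Stein term contains the
    signs only through W_ab W_ba = 1, so one argument serves both matrices. With eta >= 3 all
    entries of G have modulus at most 1 and the averaged equation controls the deviation with a
    factor eta - 2 >= 1, without continuation in z; in return, kernels with eta >= 3 have to suffice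
    for weak convergence. Expectations are finite recursions over boolean functions, which turns the
    Stein and Efron-Stein statements into algebra; the probability space enters only through the law
    of the outcome. *)

Lemma sum_cst_seq (V : nmodType) (I : Type) (s : seq I) (x : V) :
  \sum_(i <- s) x = x *+ size s.
Proof. by rewrite big_const_seq count_predT iter_addr_0. Qed.

Section ProductBernoulli.
Variable Q : finType.
Implicit Types (S : {ffun Q -> bool}) (t s : Q) (l : seq Q).

Definition upd S t (b : bool) : {ffun Q -> bool} :=
  [ffun x => if x == t then b else S x].

Lemma updC S s t b c : s != t -> upd (upd S s b) t c = upd (upd S t c) s b.
Proof.
move=> st; apply/ffunP => x; rewrite !ffunE.
by case: (eqVneq x t) => // ->; rewrite eq_sym (negbTE st).
Qed.

Lemma updd S t b c : upd (upd S t b) t c = upd S t c.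
Proof. by apply/ffunP => x; rewrite !ffunE; case: eqP. Qed.

Section Ring.
Variables (K : comNzRingType) (p : K).
Implicit Types f g : {ffun Q -> bool} -> K.

(** Conditional expectation given all coordinates but [t]; the result no longer depends on [S t]. *)
Definition avg1 t f S : K := p * f (upd S t true) + (1 - p) * f (upd S t false).

Definition diff1 t f S : K := f (upd S t true) - f (upd S t false).

(* The expectation when the coordinates in [l] are independent Bernoulli(p)
   variables, the other coordinates being frozen. *)
Definition bexp l f : {ffun Q -> bool} -> K := foldr avg1 f l.

Lemma avg1C s t f : avg1 s (avg1 t f) = avg1 t (avg1 s f).
Proof.
case: (eqVneq s t) => [->//|st]; apply/funext => S; rewrite /avg1.
by rewrite !(updC _ _ _ st); ring.
Qed.

Lemma avg1_id t f : avg1 t (avg1 t f) = avg1 t f.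
Proof. by apply/funext => S; rewrite /avg1 !updd; ring. Qed.

Lemma diff1_avg1 s t f : s != t -> diff1 s (avg1 t f) = avg1 t (diff1 s f).
Proof.
move=> st; apply/funext => S; rewrite /diff1 /avg1.
by rewrite !(updC _ _ _ st); ring.
Qed.

Lemma bexp_avg1C l t f : bexp l (avg1 t f) = avg1 t (bexp l f).
Proof. by elim: l => //= s l ->; rewrite avg1C. Qed.

Lemma bexp_avg1 l t f : t \in l -> bexp l (avg1 t f) = bexp l f.
Proof.
elim: l => //= s l IH; rewrite inE => /predU1P[->|/IH -> //].
by rewrite bexp_avg1C avg1_id.
Qed.

Lemma diff1_bexp l t f : t \notin l -> diff1 t (bexp l f) = bexp l (diff1 t f).
Proof.
elim: l => //= s l IH; rewrite inE negb_or => /andP[ts tl].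
by rewrite diff1_avg1// IH.
Qed.

Lemma bexpD l f g S : bexp l (fun T => f T + g T) S = bexp l f S + bexp l g S.
Proof.
elim: l S => //= s l IH S; rewrite {1}/avg1 !IH /avg1.
by ring.
Qed.

Lemma bexpZ l c f S : bexp l (fun T => c * f T) S = c * bexp l f S.
Proof. by elim: l S => //= s l IH S; rewrite {1}/avg1 !IH /avg1; ring. Qed.

Lemma bexp_cst l c S : bexp l (fun=> c) S = c.
Proof. by elim: l S => //= s l IH S; rewrite /avg1 !IH; ring. Qed.

Lemma bexpN l f S : bexp l (fun T => - f T) S = - bexp l f S.
Proof.
rewrite -mulN1r -bexpZ; congr (bexp _ _ _); apply/funext => T.
by rewrite mulN1r.
Qed.

Lemma bexpB l f g S : bexp l (fun T => f T - g T) S = bexp l f S - bexp l g S.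
Proof. by rewrite -bexpN -bexpD. Qed.

Lemma bexp_sum l (I : Type) (r : seq I) (P : pred I) (F : I -> _ -> K) S :
  bexp l (fun T => \sum_(i <- r | P i) F i T) S =
  \sum_(i <- r | P i) bexp l (F i) S.
Proof.
elim: r => [|i r IH].
  rewrite big_nil -[RHS](bexp_cst l 0 S); congr (bexp _ _ _).
  by apply/funext => T; rewrite big_nil.
rewrite big_cons -IH; case: ifPn => Pi; last first.
  by congr (bexp _ _ _); apply/funext => T; rewrite big_cons (negbTE Pi).
by rewrite -bexpD; congr (bexp _ _ _); apply/funext => T; rewrite big_cons Pi.
Qed.

(** Average over the coordinate [t] first: a Bernoulli(p) variable X satisfies E[(X - p) f(X)] = p
    (1 - p) (f(1) - f(0)), an exact substitute for Gaussian integration by parts. *)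
Lemma bexp_stein l t f S : t \in l ->
  bexp l (fun T => ((T t)%:R - p) * f T) S = p * (1 - p) * bexp l (diff1 t f) S.
Proof.
move=> tl; rewrite -(bexp_avg1 _ tl) -bexpZ; congr (bexp _ _ _).
apply/funext => T; rewrite /avg1 /diff1 !ffunE eqxx mulr1n mulr0n; ring.
Qed.

End Ring.

Section Real.
Variables (R : realDomainType) (p : R).
Hypothesis p01 : 0 <= p <= 1.
Implicit Types f g : {ffun Q -> bool} -> R.

Lemma ler_bexp l f g S : (forall T, f T <= g T) -> bexp p l f S <= bexp p l g S.
Proof.
case/andP: p01 => p0 p1 fg; elim: l S => //= s l IH S.
by rewrite /avg1 lerD// ler_wpM2l// subr_ge0.
Qed.

Lemma bexp_ge0 l f S : (forall T, 0 <= f T) -> 0 <= bexp p l f S.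
Proof. by move=> f0; rewrite -[leLHS](bexp_cst p l 0 S); exact: ler_bexp. Qed.

Lemma normr_bexp l f S : `|bexp p l f S| <= bexp p l (fun T => `|f T|) S.
Proof.
rewrite ler_norml -bexpN; apply/andP; split; apply: ler_bexp => T.
  by rewrite lerNl ler_normr lexx orbT.
exact: ler_norm.
Qed.

Lemma variance_bexp l f S : bexp p l (fun T => (f T - bexp p l f S) ^+ 2) S =
  bexp p l (fun T => f T ^+ 2) S - bexp p l f S ^+ 2.
Proof.
set c := bexp p l f S.
under [X in bexp _ _ X _]funext => T.
  rewrite (_ : (f T - c) ^+ 2 = f T ^+ 2 + ((- 2 * c) * f T + c ^+ 2)).
    over.
  ring.
by rewrite !bexpD bexpZ bexp_cst -/c; ring.
Qed.

Lemma bexp_sqr_le l f S : bexp p l f S ^+ 2 <= bexp p l (fun T => f T ^+ 2) S.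
Proof.
rewrite -subr_ge0 -variance_bexp.
by apply: bexp_ge0 => T; exact: sqr_ge0.
Qed.

(** Induction on the coordinates: a function of one Bernoulli variable has variance p (1 - p) times
    the squared difference of its two values. *)
Lemma efron_stein l f S : uniq l ->
  bexp p l (fun T => f T ^+ 2) S - bexp p l f S ^+ 2 <=
  \sum_(t <- l) p * (1 - p) * bexp p l (fun T => diff1 t f T ^+ 2) S.
Proof.
case/andP: (p01) => p0 p1.
have pq0 : 0 <= p * (1 - p) by rewrite mulr_ge0// subr_ge0.
elim: l S => [|t l IH] S /=; first by rewrite big_nil subrr.
case/andP=> tl ul; rewrite big_cons.
set g := bexp p l f.
(* Total variance with respect to [t]: the variance of the conditional mean [g], plus the mean of
   the conditional variances. *)
have -> : avg1 p t (bexp p l (fun T => f T ^+ 2)) S - avg1 p t g S ^+ 2 =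
  p * (1 - p) * diff1 t g S ^+ 2 +
  avg1 p t (fun T => bexp p l (fun T => f T ^+ 2) T - g T ^+ 2) S.
  by rewrite /avg1 /diff1; ring.
apply: lerD.
  rewrite ler_wpM2l// /g diff1_bexp//.
  have /= <- := @bexp_avg1C _ p l t (fun T => diff1 t f T ^+ 2).
  (* The difference in [t] does not depend on the coordinate [t], so averaging over [t] may be
     dropped; Jensen's inequality remains. *)
  have -> : avg1 p t (fun T => diff1 t f T ^+ 2) = (fun T => diff1 t f T ^+ 2).
    by apply/funext => T; rewrite /avg1 /diff1 !updd; ring.
  exact: bexp_sqr_le.
apply: le_trans (_ : avg1 p t (fun T => \sum_(s <- l)
    p * (1 - p) * bexp p l (fun T => diff1 s f T ^+ 2) T) S <= _).
  by apply: (ler_bexp [:: t]) => T; exact: IH.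
rewrite -[leLHS]/(bexp p [:: t] _ S) bexp_sum ler_sum// => s _.
by rewrite bexpZ.
Qed.

End Real.
End ProductBernoulli.

(** * Resolvents *)

Section Modulus.
Variable R : rcfType.
Implicit Types x y : complex R.

Lemma normc_ge0 x : 0 <= normc x.
Proof. by case: x => a b; exact: sqrtr_ge0. Qed.

Lemma normc_sqr x : normc x ^+ 2 = complex.Re x ^+ 2 + complex.Im x ^+ 2.
Proof. by case: x => a b /=; rewrite sqr_sqrtr// addr_ge0// sqr_ge0. Qed.

Lemma normc_ReIm x : `|complex.Re x| <= normc x /\ `|complex.Im x| <= normc x.
Proof.
by split; rewrite -ler_sqr ?nnegrE ?normr_ge0 ?normc_ge0// normc_sqr real_normK
  ?num_real// ?lerDl ?lerDr sqr_ge0.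
Qed.

Lemma normc_real (a : R) : normc a%:C%C = `|a|.
Proof. by rewrite /= expr0n /= addr0 sqrtr_sqr. Qed.

Lemma le_normc_sum (I : Type) (r : seq I) (P : pred I) (F : I -> complex R) :
  normc (\sum_(i <- r | P i) F i) <= \sum_(i <- r | P i) normc (F i).
Proof.
elim/big_rec2: _ => [|i a b _ ab]; first by rewrite normc0.
by apply: le_trans (le_normcD _ _) _; rewrite lerD2l.
Qed.

Lemma le_normcB x y : normc (x - y) <= normc x + normc y.
Proof. by rewrite -(normcN y); exact: le_normcD. Qed.

Lemma mulcJ x : x * (x^*)%C = (normc x ^+ 2)%:C%C.
Proof.
rewrite normc_sqr; case: x => a b; apply/eqP; rewrite eq_complex /=.
by apply/andP; split; apply/eqP; ring.
Qed.

End Modulus.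

Section ComplexExpectation.
Variables (R : rcfType) (Q : finType) (p : R).
Hypothesis p01 : 0 <= p <= 1.
Implicit Types (f g : {ffun Q -> bool} -> complex R) (l : seq Q).
Local Notation EC := (bexp p%:C%C).
Local Notation ER := (bexp p).

Lemma Re_bexp l f S : complex.Re (EC l f S) = ER l (fun T => complex.Re (f T)) S.
Proof.
elim: l S => //= t l IH S; rewrite /avg1 -!IH.
by case: (EC l f _) => a b; case: (EC l f _) => a' b' /=; ring.
Qed.

Lemma Im_bexp l f S : complex.Im (EC l f S) = ER l (fun T => complex.Im (f T)) S.
Proof.
elim: l S => //= t l IH S; rewrite /avg1 -!IH.
by case: (EC l f _) => a b; case: (EC l f _) => a' b' /=; ring.
Qed.

Lemma normc_bexp l f S : normc (EC l f S) <= ER l (fun T => normc (f T)) S.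
Proof.
case/andP: (p01) => p0 p1.
elim: l S => //= t l IH S; rewrite /avg1.
apply: le_trans (le_normcD _ _) _; rewrite -[1]/(1%:C%C) -rmorphB !normcM.
rewrite !normc_real !ger0_norm ?subr_ge0//.
by rewrite lerD// ler_wpM2l// subr_ge0.
Qed.

Lemma variance_normc_bexp l f S :
  ER l (fun T => normc (f T - EC l f S) ^+ 2) S =
  (ER l (fun T => complex.Re (f T) ^+ 2) S - complex.Re (EC l f S) ^+ 2) +
  (ER l (fun T => complex.Im (f T) ^+ 2) S - complex.Im (EC l f S) ^+ 2).
Proof.
rewrite Re_bexp Im_bexp -!variance_bexp -bexpD -Re_bexp -Im_bexp.
congr (bexp _ _ _ _); apply/funext => T; rewrite normc_sqr.
by case: (f T) => a b; case: (EC l f S).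
Qed.

Lemma efron_stein_normc l f S : uniq l ->
  ER l (fun T => normc (f T - EC l f S) ^+ 2) S <=
  \sum_(t <- l) p * (1 - p) * ER l (fun T => normc (diff1 t f T) ^+ 2) S.
Proof.
move=> ul; rewrite variance_normc_bexp Re_bexp Im_bexp.
apply: le_trans (lerD (efron_stein p01 _ S ul) (efron_stein p01 _ S ul)) _.
rewrite -big_split /= ler_sum// => t _; rewrite -mulrDr -bexpD.
rewrite le_eqVlt; apply/orP; left; apply/eqP; congr (_ * bexp _ _ _ _).
apply/funext => T; rewrite normc_sqr /diff1.
by case: (f _) => a b; case: (f _).
Qed.

Lemma covariance_normc_bexp l f g S :
  normc (EC l (fun T => f T * g T) S - EC l f S * EC l g S) <=
  2^-1 * (ER l (fun T => normc (f T - EC l f S) ^+ 2) S +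
          ER l (fun T => normc (g T - EC l g S) ^+ 2) S).
Proof.
set a := EC l f S; set b := EC l g S.
have -> : EC l (fun T => f T * g T) S - a * b =
    EC l (fun T => (f T - a) * (g T - b)) S.
  rewrite (_ : (fun T => (f T - a) * (g T - b)) =
    (fun T => f T * g T + (- b * f T + (- a * g T + a * b)))).
    by rewrite !bexpD !bexpZ bexp_cst -/a -/b; ring.
  by apply/funext => T; ring.
apply: le_trans (normc_bexp _ _ _) _; rewrite -bexpD -bexpZ.
apply: ler_bexp => // T; rewrite normcM.
by have := sqr_ge0 (normc (f T - a) - normc (g T - b)); nra.
Qed.

End ComplexExpectation.

Section Resolvent.
Variables (R : rcfType) (N : nat).
Implicit Types (H : 'M[R]_N) (eta : R).

Definition shifted H eta : 'M[complex R]_N :=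
  map_mx (real_complex R) H - (eta *i%C)%:M.

Definition resolvent H eta : 'M[complex R]_N := invmx (shifted H eta).

Lemma shifted_tr H eta : H^T = H -> (shifted H eta)^T = shifted H eta.
Proof. by move=> sH; rewrite /shifted raddfB /= map_trmx sH tr_scalar_mx. Qed.

(** The quadratic form of a real symmetric [H] is real, so only the shift -i eta contributes to the
    imaginary part. Invertibility of [shifted], the Ward identity and the rank-one bound all rest on
    this. *)
Lemma Im_shifted_form H eta (v : 'rV[complex R]_N) : H^T = H ->
  complex.Im (\sum_b (v *m shifted H eta) 0 b * (v 0 b)^*%C) =
  - eta * \sum_b normc (v 0 b) ^+ 2.
Proof.
move=> sH.
have -> : \sum_b (v *m shifted H eta) 0 b * (v 0 b)^*%C =
    \sum_b \sum_a v 0 a * (H a b)%:C%C * (v 0 b)^*%C -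
    (eta *i%C) * \sum_b (v 0 b * (v 0 b)^*%C).
  rewrite mulr_sumr -sumrB; apply: eq_bigr => b _.
  rewrite mulmxBr mul_mx_scalar !mxE mulrBl mulr_suml; congr (_ - _).
    by apply: eq_bigr => a _; rewrite !mxE.
  by rewrite mulrA.
set s := \sum_b \sum_a _.
have sJ : (s^*)%C = s.
  rewrite [in LHS]/s exchange_big /= rmorph_sum; apply: eq_bigr => b _.
  rewrite rmorph_sum; apply: eq_bigr => a _; rewrite !rmorphM /= conjcK.
  have -> : H b a = H a b by rewrite -[in LHS]sH mxE.
  by rewrite oppr0 -[(H a b +i* 0)%C]/((H a b)%:C%C); ring.
have sI : complex.Im s = 0.
  by move: sJ; case: s => x y [] /=; lra.
under [X in _ - _ * X]eq_bigr do rewrite mulcJ.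
rewrite -rmorph_sum /=; case: s sI {sJ} => x y /= ->.
by ring.
Qed.

Variables (H : 'M[R]_N) (eta : R).
Hypotheses (sH : H^T = H) (eta0 : 0 < eta).
Local Notation G := (resolvent H eta).

Lemma shifted_unit : shifted H eta \in unitmx.
Proof.
rewrite -row_free_unit -kermx_eq0; apply/eqP/row_matrixP => i.
rewrite row0; set v := row i _.
have v0 : v *m shifted H eta = 0 by rewrite -row_mul mulmx_ker row0.
have := @Im_shifted_form H eta v sH.
rewrite v0 big1 => [|b _]; last by rewrite mxE mul0r.
move=> /esym/eqP; rewrite mulf_eq0 oppr_eq0 gt_eqF//= => /eqP /psumr_eq0P w0.
apply/rowP => b; rewrite [RHS]mxE; apply: eq0_normc; apply/eqP.
by rewrite -sqrf_eq0 w0// => ? _; exact: sqr_ge0.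
Qed.

Lemma mulVresolvent : shifted H eta *m G = 1%:M.
Proof. by rewrite mulmxV// shifted_unit. Qed.

Lemma mulresolventV : G *m shifted H eta = 1%:M.
Proof. by rewrite mulVmx// shifted_unit. Qed.

Lemma resolvent_tr : G^T = G.
Proof. by rewrite /resolvent trmx_inv shifted_tr. Qed.

Lemma resolvent_sym a b : G a b = G b a.
Proof. by rewrite -[in LHS]resolvent_tr mxE. Qed.

(** Take v = row [a] of G in [Im_shifted_form]: then v (H - z) is a unit vector and the form reduces
    to the conjugate of G_aa. *)
Lemma ward a : eta * \sum_b normc (G a b) ^+ 2 = complex.Im (G a a).
Proof.
have := @Im_shifted_form H eta (row a G) sH.
rewrite -row_mul mulresolventV (bigD1 a)//= big1 ?addr0; last first.
  by move=> b ba; rewrite !mxE eq_sym (negbTE ba) mul0r.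
rewrite !mxE eqxx mul1r.
under eq_bigr do rewrite mxE.
by case: (G a a) => x y /= /eqP; rewrite mulNr eqr_opp => /eqP.
Qed.

(** With s the sum, the Ward identity gives (eta s)^2 = (Im G_aa)^2 <= |G_aa|^2 <= s; divide by
    s. *)
Lemma sum_resolvent_sqr a : \sum_b normc (G a b) ^+ 2 <= eta ^- 2.
Proof.
set s := \sum_b _.
have s0 : 0 <= s by apply: sumr_ge0 => *; exact: sqr_ge0.
have : (eta * s) ^+ 2 <= s.
  rewrite ward; apply: le_trans (_ : normc (G a a) ^+ 2 <= _).
    by rewrite normc_sqr lerDr sqr_ge0.
  by rewrite /s (bigD1 a)//= lerDl sumr_ge0// => *; exact: sqr_ge0.
rewrite -[leRHS]mulr1; have [->|sn0] := eqVneq s 0.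
  by rewrite invr_ge0 sqr_ge0.
have sgt0 : 0 < s by rewrite lt_neqAle eq_sym sn0.
rewrite exprMn (_ : eta ^+ 2 * s ^+ 2 = s * (eta ^+ 2 * s)); last by ring.
by rewrite ler_pM2l// -ler_pdivlMl ?exprn_gt0// mulr1.
Qed.

Lemma normc_resolvent a b : normc (G a b) <= eta^-1.
Proof.
rewrite -ler_sqr ?nnegrE ?normc_ge0 ?invr_ge0 ?(ltW eta0)// exprVn.
apply: le_trans (sum_resolvent_sqr a).
by rewrite (bigD1 b)//= lerDl sumr_ge0// => *; exact: sqr_ge0.
Qed.

End Resolvent.

Lemma resolvent_sub (R : rcfType) N (H H' : 'M[R]_N) eta :
  H^T = H -> H'^T = H' -> 0 < eta ->
  resolvent H' eta - resolvent H eta =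
  resolvent H' eta *m map_mx (real_complex R) (H - H') *m resolvent H eta.
Proof.
move=> sH sH' eta0.
have -> : map_mx (real_complex R) (H - H') = shifted H eta - shifted H' eta.
  by rewrite map_mxB /shifted opprB addrA subrK.
by rewrite mulmxBr mulmxBl -mulmxA mulVresolvent// mulresolventV// mulmx1 mul1mx.
Qed.

(** * Random sums over a linear hypergraph *)

(** Weighted Cauchy-Schwarz by Lagrange's identity: the two sides differ by half of a nonnegative
    double sum over (x_i - x_j)^2. *)
Lemma sqr_sum_le (R : realFieldType) (I : finType) (x : I -> R) (w : I -> R) :
  (forall i, 0 <= w i) ->
  (\sum_i w i * x i) ^+ 2 <= (\sum_i w i) * \sum_i w i * x i ^+ 2.
Proof.
move=> w0.
suff : 0 <= \sum_i \sum_j w i * w j * (x i - x j) ^+ 2.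
  have -> : \sum_i \sum_j w i * w j * (x i - x j) ^+ 2 =
     2 * ((\sum_i w i) * (\sum_i w i * x i ^+ 2)) -
     2 * (\sum_i w i * x i) ^+ 2; last by lra.
  set X := (\sum_i w i) * _; set Y := (\sum_i w i * x i) ^+ 2.
  have E1 : \sum_i \sum_j w i * (w j * x j ^+ 2) = X by rewrite /X big_distrlr.
  have E2 : \sum_i \sum_j w j * (w i * x i ^+ 2) = X.
    by rewrite exchange_big E1.
  have E3 : \sum_i \sum_j w i * x i * (w j * x j) = Y.
    by rewrite /Y expr2 big_distrlr.
  transitivity (X + X - 2 * Y); last by ring.
  rewrite -{1}E1 -{1}E2 -E3 mulr_sumr -big_split -sumrB/=; apply: eq_bigr => i _.
  rewrite mulr_sumr -big_split -sumrB/=; apply: eq_bigr => j _; ring.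
by do 2![apply: sumr_ge0 => ? _]; rewrite mulr_ge0 ?sqr_ge0// mulr_ge0.
Qed.

Section Ensemble.
Variables (R : rcfType) (Q : finType) (l : seq Q) (N : nat).
Variables (F : Q -> {set 'I_N}) (W : 'M[R]_N) (k r : nat) (p h eta : R).
Implicit Types (S : {ffun Q -> bool}) (t u : Q) (a b x y : 'I_N).

Definition inc t (a b : 'I_N) : R := ((a != b) && (a \in F t) && (b \in F t))%:R.

Definition block t : 'M[R]_N := \matrix_(a, b) (inc t a b * W a b).

Definition ensemble (S : {ffun Q -> bool}) : 'M[R]_N :=
  h *: \sum_(t <- l) ((S t)%:R - p) *: block t.

Local Notation G S := (resolvent (ensemble S) eta).
Local Notation EC := (bexp p%:C%C l).
Local Notation ER := (bexp p l).
Local Notation K := (k%:R : R).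
Local Notation g S a b := (normc (G S a b)).

Hypothesis ul : uniq l.
Hypothesis symW : W^T = W.
Hypothesis W1 : forall t a b, t \in l -> a != b -> a \in F t -> b \in F t ->
  W a b ^+ 2 = 1.
Hypothesis cardF : forall t, t \in l -> #|F t| = k.
Hypothesis lineF : forall t u a b, t \in l -> u \in l -> a != b ->
  a \in F t -> b \in F t -> a \in F u -> b \in F u -> t = u.
Hypothesis degF : forall a, count (fun t => a \in F t) l = r.
Hypothesis k1 : (1 < k)%N.
Hypothesis p01 : 0 <= p <= 1.
Hypothesis h01 : 0 < h <= 1.
Hypothesis eta3 : 3 <= eta.
(** [c] is the variance of an entry lying in some block, and the left side of [theta1] is the sum of
    the variances along a row; in the application it equals 1 - d/n. *)
Local Notation c := (p * (1 - p) * h ^+ 2).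
Hypothesis theta1 : c * r%:R * (k.-1)%:R <= 1.

Let K1 : 1 <= K. Proof. by rewrite ler1n ltnW. Qed.
Let h0 : 0 <= h. Proof. by case/andP: h01 => /ltW. Qed.
Let eta0 : 0 < eta. Proof. by move: eta3; lra. Qed.
Let pq0 : 0 <= p * (1 - p).
Proof. by case/andP: p01 => p0 p1; rewrite mulr_ge0// subr_ge0. Qed.
Let c0 : 0 <= c. Proof. by rewrite mulr_ge0// sqr_ge0. Qed.
Let ch : c <= h ^+ 2.
Proof. by rewrite -[leRHS]mul1r ler_wpM2r ?sqr_ge0//; case/andP: p01; nra. Qed.
Let cr : c * r%:R <= 1.
Proof.
apply: le_trans theta1; rewrite ler_peMr//; first by rewrite mulr_ge0.
by rewrite ler1n; case: k k1 => // -[].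
Qed.

Lemma inc_ge0 t a b : 0 <= inc t a b. Proof. exact: ler0n. Qed.
Hint Resolve inc_ge0 : core.

Lemma inc_sym t a b : inc t a b = inc t b a.
Proof. by rewrite /inc eq_sym andbAC. Qed.

Lemma inc_le1 t a b : inc t a b <= (a \in F t)%:R * (b \in F t)%:R.
Proof. by rewrite /inc; do 2!case: (_ \in F t); case: (a != b); rewrite ?mulr1 ?mulr0 ?mul0r ?ler01. Qed.

Lemma block_tr t : (block t)^T = block t.
Proof.
apply/matrixP => a b; rewrite !mxE inc_sym; congr (_ * _).
by rewrite -[in LHS]symW mxE.
Qed.

Lemma ensemble_tr S : (ensemble S)^T = ensemble S.
Proof.
rewrite /ensemble linearZ /= linear_sum /=; congr (_ *: _).
by apply: eq_bigr => t _; rewrite linearZ /= block_tr.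
Qed.

Lemma normr_block t a b : t \in l -> `|block t a b| = inc t a b.
Proof.
move=> tl; rewrite mxE normrM ger0_norm//.
rewrite /inc; case: eqVneq => [|ab] /=; first by rewrite !mul0r.
case: (boolP (a \in F t)) => aF /=; last by rewrite mul0r.
case: (boolP (b \in F t)) => bF /=; last by rewrite mul0r.
apply/eqP; rewrite mul1r -(eqrXn2 (n := 2))// expr1n.
by rewrite real_normK ?num_real// (W1 tl ab).
Qed.

Lemma normc_g1 S a b : g S a b <= 1.
Proof.
apply: le_trans (normc_resolvent (ensemble_tr S) eta0 a b) _.
by rewrite invf_le1//; move: eta3; lra.
Qed.

Lemma sum_g1 S a : \sum_b g S a b ^+ 2 <= 1.
Proof.
apply: le_trans (sum_resolvent_sqr (ensemble_tr S) eta0 a) _.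
rewrite -exprVn exprn_ile1 ?invr_ge0 ?invf_le1//; move: eta3; lra.
Qed.

Lemma ensemble_agree t S S' : t \in l -> (forall u, u != t -> S' u = S u) ->
  ensemble S' - ensemble S = (h * ((S' t)%:R - (S t)%:R)) *: block t.
Proof.
move=> tl SS'; rewrite /ensemble -scalerBr -sumrB -scalerA; congr (_ *: _).
rewrite (bigD1_seq t)//= big1 ?addr0.
  by rewrite -scalerBl; congr (_ *: _); ring.
by move=> u ut; rewrite SS'// subrr.
Qed.

(** Second resolvent identity, the two matrices differing by a multiple of one block; one resolvent
    factor is taken at each configuration. *)
Lemma resolvent_agree t S S' a b : t \in l -> (forall u, u != t -> S' u = S u) ->
  g S' a b <= g S a b + normc (G S' a b - G S a b) /\
  normc (G S' a b - G S a b) <=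
  h * \sum_x \sum_y inc t x y * (g S a x * g S' y b).
Proof.
move=> tl SS'; split.
  by rewrite -{1}(subrK (G S a b) (G S' a b)) addrC; exact: le_normcD.
have -> : G S' a b - G S a b = (G S' - G S) a b by rewrite !mxE.
have -> : G S' - G S = - (G S *m map_mx (real_complex R)
    (ensemble S' - ensemble S) *m G S').
  by rewrite -resolvent_sub ?ensemble_tr// opprB.
rewrite (ensemble_agree tl SS') map_mxZ -scalemxAr -scalemxAl.
rewrite -scaleNr mxE normcM.
have hS : normc (- (h * ((S' t)%:R - (S t)%:R))%:C%C) <= h.
  rewrite normcN normc_real normrM ger0_norm// ler_piMr//.
  by case: (S' t); case: (S t); rewrite ?subrr ?normr0 ?subr0 ?normr1 ?sub0r ?normrN ?normr1.
apply: ler_pM hS _; rewrite ?normc_ge0//.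
rewrite mxE exchange_big /=; apply: le_trans (le_normc_sum _ _ _) _.
apply: ler_sum => y _; rewrite mxE mulr_suml.
apply: le_trans (le_normc_sum _ _ _) _; apply: ler_sum => x _.
by rewrite [map_mx _ _ _ _]mxE !normcM normc_real normr_block// mulrCA mulrA.
Qed.

Lemma sum_inF t : t \in l -> \sum_a (a \in F t)%:R = K.
Proof.
move=> tl; rewrite -(cardF tl) -sum1_card natr_sum [RHS]big_mkcond /=.
by apply: eq_bigr => a _; case: (a \in F t).
Qed.

Lemma sum_inc_le t (u v : 'I_N -> R) : t \in l ->
  (forall x, 0 <= u x) -> (forall x, 0 <= v x) ->
  \sum_x \sum_y inc t x y * (u x * v y) <=
  (\sum_x (x \in F t)%:R * u x) * (\sum_y (y \in F t)%:R * v y).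
Proof.
move=> tl u0 v0; rewrite big_distrlr /=; apply: ler_sum => x _.
apply: ler_sum => y _; rewrite mulrACA ler_wpM2r ?mulr_ge0//.
exact: inc_le1.
Qed.

Lemma sum_inF_le t (u : 'I_N -> R) (b : R) : t \in l ->
  (forall x, u x <= b) -> \sum_x (x \in F t)%:R * u x <= K * b.
Proof.
move=> tl ub; rewrite -(sum_inF tl) mulr_suml; apply: ler_sum => x _.
by rewrite ler_wpM2l.
Qed.

Lemma sum_inc t : t \in l -> \sum_x \sum_y inc t x y <= K ^+ 2.
Proof.
move=> tl; apply: le_trans (_ : \sum_x \sum_y inc t x y * (1 * 1) <= _).
  by under [leRHS]eq_bigr do under eq_bigr do rewrite mulr1 mulr1.
apply: le_trans (sum_inc_le tl _ _) _ => //.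
rewrite expr2; apply: ler_pM.
- by apply: sumr_ge0 => *; rewrite mulr1.
- by apply: sumr_ge0 => *; rewrite mulr1.
- by rewrite -[K]mulr1 sum_inF_le.
- by rewrite -[K]mulr1 sum_inF_le.
Qed.

Local Notation al t S a := (\sum_x (x \in F t)%:R * g S a x).

Lemma al_ge0 t S a : 0 <= al t S a.
Proof. by apply: sumr_ge0 => x _; rewrite mulr_ge0// normc_ge0. Qed.

(** The factor at [S'] is bounded by 1, while the l1 mass [al] of row [a] on the block is kept: its
    squares, weighted by [c], have a bounded sum over [t], which a uniform bound would lose. *)
Lemma resolvent_agree_al t S S' a b : t \in l ->
  (forall u, u != t -> S' u = S u) ->
  normc (G S' a b - G S a b) <= h * K * al t S a.
Proof.
move=> tl SS'; have [_ /le_trans->//] := resolvent_agree a b tl SS'.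
rewrite -mulrA ler_wpM2l//.
apply: le_trans (sum_inc_le (v := fun y => g S' y b) tl _ _) _.
- by move=> ?; exact: normc_ge0.
- by move=> ?; exact: normc_ge0.
rewrite mulrC ler_wpM2r ?al_ge0// -[K]mulr1 sum_inF_le// => x.
exact: normc_g1.
Qed.

Lemma al_le t S a : t \in l -> al t S a <= K.
Proof. by move=> tl; rewrite -[K]mulr1 sum_inF_le// => x; exact: normc_g1. Qed.

Lemma resolvent_agree_crude t S S' a b : t \in l ->
  (forall u, u != t -> S' u = S u) ->
  normc (G S' a b - G S a b) <= h * K ^+ 2.
Proof.
move=> tl SS'; apply: le_trans (resolvent_agree_al a b tl SS') _.
by rewrite expr2 mulrA ler_wpM2l ?mulr_ge0// al_le.
Qed.


Lemma agree_upd S t (e : bool) : forall u, u != t -> upd S t e u = S u.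
Proof. by move=> u ut; rewrite ffunE (negbTE ut). Qed.

Lemma agree_upd2 S t (e e' : bool) : forall u, u != t -> upd S t e u = upd S t e' u.
Proof. by move=> u ut; rewrite !ffunE (negbTE ut). Qed.

Lemma sum_gg1 S S' x y : \sum_a g S a x * g S' y a <= 1.
Proof.
have xs : \sum_a g S a x ^+ 2 <= 1.
  by under eq_bigr do rewrite resolvent_sym ?ensemble_tr//; exact: sum_g1.
have ys := sum_g1 S' y.
apply: le_trans (_ : \sum_a 2^-1 * (g S a x ^+ 2 + g S' y a ^+ 2) <= _).
  apply: ler_sum => a _.
  by have := sqr_ge0 (g S a x - g S' y a); nra.
by rewrite -mulr_sumr big_split /=; lra.
Qed.

(** Summing |G_ax| |G'_ya| over [a] gives at most 1 by the Ward bound, so flipping one variable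
    changes the trace by O(h), whatever [N] is. *)
Lemma diff1_trace S t : t \in l ->
  normc (diff1 t (fun T => \tr (G T)) S) <= h * K ^+ 2.
Proof.
move=> tl; rewrite /diff1 /mxtrace -sumrB.
apply: le_trans (le_normc_sum _ _ _) _.
set S1 := upd S t true; set S0 := upd S t false.
apply: le_trans (_ : \sum_a h * \sum_x \sum_y inc t x y *
   (g S0 a x * g S1 y a) <= _).
  apply: ler_sum => a _.
  by have [_] := resolvent_agree a a tl (agree_upd2 S true false).
rewrite -mulr_sumr ler_wpM2l// exchange_big /=.
apply: le_trans (sum_inc tl); apply: ler_sum => x _.
rewrite exchange_big /=; apply: ler_sum => y _.
rewrite -mulr_sumr -[leRHS]mulr1 ler_wpM2l//; exact: sum_gg1.
Qed.

Lemma sum_size_l : (size l)%:R * K = N%:R * r%:R :> R.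
Proof.
transitivity (\sum_(t <- l) \sum_a ((a \in F t)%:R : R)).
  rewrite (eq_big_seq (fun=> K)) => [|t tl]; last exact: sum_inF.
  by rewrite sum_cst_seq mulr_natl.
rewrite exchange_big /=.
transitivity (\sum_(a < N) (r%:R : R)); last first.
  by rewrite sumr_const card_ord mulr_natl.
apply: eq_bigr => a _; rewrite -(degF a) -sum1_count natr_sum [RHS]big_mkcond.
by apply: eq_bigr => t _; case: (_ \in _).
Qed.

Lemma c_size_l : c * (size l)%:R <= N%:R.
Proof.
apply: le_trans (_ : c * ((size l)%:R * K) <= _).
  by rewrite ler_wpM2l// ler_peMr.
by rewrite sum_size_l mulrCA ler_piMr.
Qed.

(** Efron-Stein: every coordinate contributes at most c K^4, and c times the number of coordinates
    is at most N. *)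
Lemma variance_trace S :
  ER (fun T => normc (\tr (G T) - EC (fun T => \tr (G T)) S) ^+ 2) S <=
  K ^+ 4 * N%:R.
Proof.
apply: le_trans (efron_stein_normc p01 _ S ul) _.
apply: le_trans (_ : \sum_(t <- l) c * K ^+ 4 <= _); last first.
  rewrite sum_cst_seq -[_ *+ size l]mulr_natr mulrAC [leLHS]mulrC ler_wpM2l//.
  exact: c_size_l.
rewrite !big_seq; apply: ler_sum => t tl; rewrite -[leRHS]mulrA ler_wpM2l//.
rewrite -[leRHS](bexp_cst p l _ S); apply: ler_bexp => // T.
rewrite (_ : h ^+ 2 * K ^+ 4 = (h * K ^+ 2) ^+ 2); last by ring.
rewrite lerXn2r ?nnegrE ?normc_ge0 ?mulr_ge0 ?sqr_ge0//.
exact: diff1_trace.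
Qed.

Lemma sum_inc_line a b : \sum_(t <- l) inc t a b <= 1.
Proof.
case: (boolP (has (fun t => (a != b) && (a \in F t) && (b \in F t)) l)).
  case/hasP => t tl /andP[/andP[ab aF] bF].
  rewrite (bigD1_seq t)//= big_seq_cond big1 ?addr0 /inc ?lern1 ?leq_b1// => u.
  case/andP => ul' ut; case: (boolP (_ && _)) => // /andP[/andP[_ aFu] bFu].
  by rewrite (lineF ul' tl ab) ?eqxx in ut.
move=> /hasPn nl; rewrite big_seq big1 ?ler01// => t tl.
by rewrite /inc (negbTE (nl t tl)).
Qed.

Lemma sum_deg a : \sum_(t <- l) (a \in F t)%:R = r%:R :> R.
Proof.
rewrite -(degF a) -sum1_count natr_sum [RHS]big_mkcond.
by apply: eq_bigr => t _; case: (_ \in _).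
Qed.

Lemma al_sqr t S a : t \in l ->
  al t S a ^+ 2 <= K * \sum_x (x \in F t)%:R * g S a x ^+ 2.
Proof.
by move=> tl; apply: le_trans (sqr_sum_le _ _) _; rewrite ?sum_inF.
Qed.

Lemma g_le_al t S a x : x \in F t -> g S a x <= al t S a.
Proof.
move=> xF; rewrite (bigD1 x)//= xF mul1r lerDl.
by apply: sumr_ge0 => *; rewrite mulr_ge0// normc_ge0.
Qed.

Let h1 : h <= 1. Proof. by case/andP: h01. Qed.

(** The first-order term is expressed through [S] itself instead of the two updated configurations,
    so that the bounds for different [t] can be summed against one row of G. Passing to [S] costs h
    K [al] per entry, which produces the term with the extra h^2. *)
Lemma diff1_diag S t a : t \in l ->
  normc (diff1 t (fun T => G T a a) S) ^+ 2 <=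
  h ^+ 2 * (2 * K ^+ 2 * (\sum_x \sum_y inc t x y * (g S a x ^+ 2 * g S a y ^+ 2))
            + 18 * K ^+ 10 * h ^+ 2 * \sum_x (x \in F t)%:R * g S a x ^+ 2).
Proof.
move=> tl; set X := \sum_x \sum_y _; set Y := \sum_x _.
set A := al t S a; have A0 : 0 <= A := al_ge0 t S a.
set S1 := upd S t true; set S0 := upd S t false.
have [_ D] := resolvent_agree a a tl (agree_upd2 S true false).
set U := \sum_x \sum_y inc t x y * (g S a x * g S a y).
have U0 : 0 <= U.
  by do 2!apply: sumr_ge0 => ? _; rewrite !mulr_ge0// normc_ge0.
have Y0 : 0 <= Y.
  by apply: sumr_ge0 => ? _; rewrite mulr_ge0// sqr_ge0.
have Y1 : Y <= 1.
  apply: le_trans (sum_g1 S a); apply: ler_sum => x _.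
  by rewrite ler_piMl ?sqr_ge0// lern1 leq_b1.
have AY : A ^+ 2 <= K * Y := al_sqr S a tl.
have near (e : bool) x : g (upd S t e) a x <= g S a x + h * K * A.
  have [/le_trans -> //] := resolvent_agree a x tl (@agree_upd S t e).
  by rewrite lerD2l; exact: resolvent_agree_al (@agree_upd S t e).
have D2 : normc (diff1 t (fun T => G T a a) S) <= h * (U + 3 * h * K ^+ 4 * A ^+ 2).
  apply: le_trans D _; rewrite ler_wpM2l//.
  (* The constant 3 collects 2 h K A^2 from the cross terms and (h K A)^2 from the product of the
     errors, by h <= 1 <= K. *)
  apply: le_trans (_ : U + \sum_x \sum_y inc t x y * (3 * h * K ^+ 2 * A ^+ 2) <= _).
    rewrite /U -big_split; apply: ler_sum => x _; rewrite -big_split /=.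
    apply: ler_sum => y _; rewrite -mulrDr.
    rewrite (resolvent_sym eta (ensemble_tr _) y a).
    have [->|] := eqVneq (inc t x y) 0; first by rewrite !mul0r.
    rewrite /inc; case: (boolP (_ && _)) => [/andP[/andP[_ xF] yF] _|]; last first.
      by rewrite eqxx.
    rewrite !mul1r.
    have gx := g_le_al S a xF; have gy := g_le_al S a yF.
    have nx := near false x; have ny := near true y.
    have gx0 : 0 <= g S a x := normc_ge0 _; have gy0 : 0 <= g S a y := normc_ge0 _.
    apply: le_trans (ler_pM (normc_ge0 _) (normc_ge0 _) nx ny) _.
    have hKA : 0 <= h * K * A by rewrite !mulr_ge0.
    have -> : (g S a x + h * K * A) * (g S a y + h * K * A) =
      g S a x * g S a y + h * K * A * (g S a x + g S a y) + h * (h * (K * A) ^+ 2).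
      by ring.
    rewrite -addrA lerD2l.
    have e1 : h * K * A * (g S a x + g S a y) <= h * K * A * (2 * A).
      by rewrite ler_wpM2l//; rewrite -/A in gx gy; lra.
    have e2 : h * (h * (K * A) ^+ 2) <= h * (K * A) ^+ 2.
      by rewrite ler_wpM2l// ler_piMl ?sqr_ge0.
    have e3 : h * K * A * (2 * A) <= 2 * h * K ^+ 2 * A ^+ 2.
      have -> : h * K * A * (2 * A) = 2 * h * A ^+ 2 * K by ring.
      have -> : 2 * h * K ^+ 2 * A ^+ 2 = 2 * h * A ^+ 2 * K ^+ 2 by ring.
      by rewrite ler_wpM2l ?mulr_ge0 ?sqr_ge0// expr2 ler_peMl// (le_trans _ K1).
    by move: e1 e2 e3; rewrite exprMn; lra.
  rewrite lerD2l; under eq_bigr do rewrite -mulr_suml; rewrite -mulr_suml.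
  have -> : 3 * h * K ^+ 4 * A ^+ 2 = K ^+ 2 * (3 * h * K ^+ 2 * A ^+ 2) by ring.
  by rewrite ler_wpM2r ?sum_inc// !mulr_ge0 ?sqr_ge0.
have UX : U ^+ 2 <= K ^+ 2 * X.
  rewrite /U /X pair_bigA /= [X in _ * X]pair_bigA /=.
  apply: le_trans (sqr_sum_le (w := fun z => inc t z.1 z.2) _ _) _ => //.
  rewrite -(pair_bigA _ (fun x y => inc t x y)) /=.
  under [X in _ * X]eq_bigr do rewrite exprMn.
  rewrite ler_wpM2r ?sum_inc// sumr_ge0// => z _.
  by rewrite mulr_ge0// mulr_ge0// sqr_ge0.
have A4 : A ^+ 4 <= K ^+ 2 * Y.
  have -> : A ^+ 4 = A ^+ 2 * A ^+ 2 by ring.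
  apply: le_trans (ler_pM (sqr_ge0 _) (sqr_ge0 _) AY AY) _.
  have -> : K * Y * (K * Y) = K ^+ 2 * (Y * Y) by ring.
  by rewrite ler_wpM2l ?sqr_ge0// ler_piMr.
apply: le_trans (_ : (h * (U + 3 * h * K ^+ 4 * A ^+ 2)) ^+ 2 <= _).
  by rewrite lerXn2r ?nnegrE ?normc_ge0 ?(mulr_ge0, addr_ge0, exprn_ge0).
rewrite exprMn ler_wpM2l ?sqr_ge0//.
(* (x + y)^2 <= 2 x^2 + 2 y^2, whence 18 = 2 * 3^2. *)
apply: le_trans (_ : 2 * U ^+ 2 + 2 * (3 * h * K ^+ 4 * A ^+ 2) ^+ 2 <= _).
  by have := sqr_ge0 (U - 3 * h * K ^+ 4 * A ^+ 2); nra.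
apply: lerD; first by rewrite -mulrA ler_wpM2l.
have -> : 2 * (3 * h * K ^+ 4 * A ^+ 2) ^+ 2 = 18 * h ^+ 2 * K ^+ 8 * A ^+ 4.
  by ring.
have -> : 18 * K ^+ 10 * h ^+ 2 * Y = 18 * h ^+ 2 * K ^+ 8 * (K ^+ 2 * Y).
  by ring.
by rewrite ler_wpM2l// !mulr_ge0 ?exprn_ge0 ?sqr_ge0.
Qed.

(** Sum [diff1_diag] over [t]. As a pair lies in at most one block, the sums of |G_ax|^2 |G_ay|^2
    add up to at most (sum_x |G_ax|^2)^2 <= 1, and c <= h^2; the remaining sums meet each x exactly
    r times, and c r <= 1. Hence 20 = 2 + 18. *)
Lemma variance_diag S a :
  ER (fun T => normc (G T a a - EC (fun T => G T a a) S) ^+ 2) S <=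
  20 * K ^+ 10 * h ^+ 2.
Proof.
apply: le_trans (efron_stein_normc p01 _ S ul) _.
have E : forall t, p * (1 - p) * ER (fun T => normc (diff1 t (fun T => G T a a) T) ^+ 2) S
   = ER (fun T => p * (1 - p) * normc (diff1 t (fun T => G T a a) T) ^+ 2) S.
  by move=> t; rewrite bexpZ.
under eq_bigr do rewrite E.
rewrite -bexp_sum -[leRHS](bexp_cst p l _ S); apply: ler_bexp => // T.
apply: le_trans (_ : \sum_(t <- l) c *
    (2 * K ^+ 2 * (\sum_x \sum_y inc t x y * (g T a x ^+ 2 * g T a y ^+ 2))
       + 18 * K ^+ 10 * h ^+ 2 * \sum_x (x \in F t)%:R * g T a x ^+ 2) <= _).
  rewrite !big_seq; apply: ler_sum => t tl; rewrite -[leRHS]mulrA ler_wpM2l//.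
  exact: diff1_diag.
rewrite -mulr_sumr big_split /= -!mulr_sumr.
have e1 : \sum_(t <- l) \sum_x \sum_y inc t x y * (g T a x ^+ 2 * g T a y ^+ 2) <= 1.
  rewrite exchange_big /=; apply: le_trans (_ : (\sum_x g T a x ^+ 2) ^+ 2 <= _).
    rewrite expr2 big_distrlr /=; apply: ler_sum => x _.
    rewrite exchange_big /=; apply: ler_sum => y _.
    rewrite -mulr_suml; apply: ler_piMl; last exact: sum_inc_line.
    by apply: mulr_ge0; exact: sqr_ge0.
  by rewrite exprn_ile1 ?sum_g1// sumr_ge0// => *; exact: sqr_ge0.
have e2 : c * \sum_(t <- l) \sum_x (x \in F t)%:R * g T a x ^+ 2 <= 1.
  rewrite exchange_big /=; under eq_bigr do rewrite -mulr_suml sum_deg.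
  rewrite -mulr_sumr mulrA; apply: le_trans (_ : 1 * 1 <= _); last by rewrite mulr1.
  apply: ler_pM (sum_g1 T a) => //; first exact: mulr_ge0.
  by apply: sumr_ge0 => *; exact: sqr_ge0.
rewrite mulrDr mulrCA [X in _ + X]mulrCA.
have K2 : K ^+ 2 <= K ^+ 10 by rewrite ler_weXn2l.
have K20 : 0 <= K ^+ 2 by exact: sqr_ge0.
have K10 : 0 <= 18 * K ^+ 10 * h ^+ 2 by rewrite !mulr_ge0 ?exprn_ge0.
have f1 : 2 * K ^+ 2 * (c * (\sum_(t <- l) \sum_x \sum_y
    inc t x y * (g T a x ^+ 2 * g T a y ^+ 2))) <= 2 * K ^+ 10 * h ^+ 2.
  apply: ler_pM.
  - exact: mulr_ge0.
  - apply: mulr_ge0 => //; do 3!apply: sumr_ge0 => ? _.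
    by apply: mulr_ge0 => //; apply: mulr_ge0; exact: sqr_ge0.
  - by rewrite ler_wpM2l.
  - by apply: le_trans ch; rewrite ler_piMr.
have f2 := ler_wpM2l K10 e2.
by move: f1 f2; rewrite mulr1; lra.
Qed.

(** * The self-consistent equation for the diagonal of the mean resolvent *)

Local Notation B t := (map_mx (real_complex R) (block t)).
Local Notation zz := (Complex 0 eta).
Local Notation dl := (h * K ^+ 2).

Let dl0 : 0 <= dl. Proof. by rewrite mulr_ge0// sqr_ge0. Qed.

Lemma resolvent_diag_eq S a : 1 + zz * G S a a =
  \sum_(t <- l) h%:C%C * (((S t)%:R - p%:C%C) * (B t *m G S) a a).
Proof.
have := congr1 (fun M : 'M[complex R]_N => M a a) (mulVresolvent (ensemble_tr S) eta0).
rewrite mulmxBl mul_scalar_mx !mxE eqxx => /eqP; rewrite subr_eq => /eqP <-.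
transitivity ((map_mx (real_complex R) (ensemble S) *m G S) a a).
  by rewrite mxE; apply: eq_bigr => b _; rewrite mxE.
rewrite map_mxZ -scalemxAl mxE map_mx_sum mulmx_suml summxE mulr_sumr.
apply: eq_bigr => t _; rewrite map_mxZ -scalemxAl [X in _ * X]mxE.
by rewrite rmorphB rmorph_nat.
Qed.

(** Apply [bexp_stein] to each term of [resolvent_diag_eq]; the discrete derivative of G is a
    resolvent product with the two updated configurations on its two sides. *)
Lemma stein_diag S a : 1 + zz * EC (fun T => G T a a) S =
  - c%:C%C * \sum_(t <- l) EC (fun T =>
      (B t *m (G (upd T t true) *m (B t *m G (upd T t false)))) a a) S.
Proof.
have -> : 1 + zz * EC (fun T => G T a a) S = EC (fun T => 1 + zz * G T a a) S.
  by rewrite bexpD bexp_cst bexpZ.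
rewrite (_ : (fun T => 1 + zz * G T a a) = (fun T => \sum_(t <- l) h%:C%C *
    (((T t)%:R - p%:C%C) * (B t *m G T) a a))); last first.
  by apply/funext => T; exact: resolvent_diag_eq.
rewrite bexp_sum mulr_sumr !big_seq; apply: eq_bigr => t tl.
rewrite bexpZ bexp_stein// mulNr -bexpZ -bexpZ -bexpZ -bexpN.
congr (bexp _ _ _ _); apply/funext => T.
rewrite /diff1 -[_ - (B t *m G (upd T t false)) a a]/((B t *m _) a a - _).
have -> : (B t *m G (upd T t true)) a a - (B t *m G (upd T t false)) a a =
    (B t *m (G (upd T t true) - G (upd T t false))) a a.
  by rewrite mulmxBr !mxE.
rewrite resolvent_sub ?ensemble_tr//.
rewrite (ensemble_agree tl (agree_upd2 T false true)) !ffunE eqxx.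
rewrite map_mxZ -!mulmxA -scalemxAl -!scalemxAr mxE mulr1n mulr0n sub0r mulrN1.
rewrite rmorphN !rmorphM rmorphB rmorph1 /=; ring.
Qed.

(** The part of the Stein term in which both inner indices return to the outer ones; the signs have
    cancelled through W_ab W_ba = 1. *)
Definition steinmain t S a : complex R :=
  \sum_b (inc t a b)%:C%C * (G S b b * G S a a).

Local Notation off t S := (\sum_x \sum_y inc t x y * g S x y).

(** Unless x = b and y = a, one of the two resolvent entries is off-diagonal, hence small on
    average, and the other is bounded by 1. [dl] pays for replacing the updated configurations by
    [S]. *)
Lemma stein_term S t a b x y : t \in l -> a != b -> a \in F t -> b \in F t ->
  normc ((block t a b)%:C%C * (G (upd S t true) b x *
           ((block t x y)%:C%C * G (upd S t false) y a)) -
         ((x == b) && (y == a))%:R * (G S b b * G S a a)) <=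
  inc t x y * ((x != b)%:R * (g S b x + dl) + (y != a)%:R * (g S y a + dl)) +
  ((x == b) && (y == a))%:R * (2 * dl).
Proof.
move=> tl ab aF bF.
have near (e : bool) i j : g (upd S t e) i j <= g S i j + dl.
  have [/le_trans -> //] := resolvent_agree i j tl (@agree_upd S t e).
  by rewrite lerD2l; exact: resolvent_agree_crude (@agree_upd S t e).
have inc1 : inc t a b = 1 by rewrite /inc ab aF bF.
have [/andP[/eqP -> /eqP ->]|nxy] := boolP (_ && _).
  rewrite !mul1r (_ : _ * (_ * (_ * _)) =
    ((block t a b) * (block t b a))%:C%C *
      (G (upd S t true) b b * G (upd S t false) a a)); last first.
    by rewrite rmorphM; ring.
  have -> : block t a b * block t b a = 1.
    have Wba : W b a = W a b by rewrite -[in LHS]symW mxE.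
    by rewrite !mxE [inc t b a]inc_sym inc1 Wba !mul1r -expr2 (W1 tl).
  rewrite rmorph1 mul1r !eqxx !mul0r addr0 mulr0 add0r.
  set x1 := G _ b b; set x0 := G _ a a.
  rewrite (_ : x1 * x0 - _ = (x1 - G S b b) * x0 + G S b b * (x0 - G S a a)); last by ring.
  apply: le_trans (le_normcD _ _) _; rewrite !normcM mulrDl !mul1r.
  have d1 := resolvent_agree_crude b b tl (@agree_upd S t true).
  have d0 := resolvent_agree_crude a a tl (@agree_upd S t false).
  apply: lerD.
    rewrite -[leRHS]mulr1; apply: ler_pM; rewrite ?normc_ge0//; exact: normc_g1.
  rewrite -[leRHS]mul1r; apply: ler_pM; rewrite ?normc_ge0//; exact: normc_g1.
rewrite !mul0r subr0 addr0 !normcM !normc_real !normr_block// inc1 mul1r mulrCA.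
rewrite ler_wpM2l//.
have g0 S' i j : 0 <= g S' i j := normc_ge0 _.
have X0 : 0 <= (x != b)%:R * (g S b x + dl) by rewrite mulr_ge0// addr_ge0.
have Y0 : 0 <= (y != a)%:R * (g S y a + dl) by rewrite mulr_ge0// addr_ge0.
move: nxy; rewrite negb_and => /orP[xb|ya].
  apply: le_trans (_ : (x != b)%:R * (g S b x + dl) <= _); last by rewrite lerDl.
  rewrite xb mul1r -[leRHS]mulr1; apply: ler_pM => //; exact: normc_g1.
apply: le_trans (_ : (y != a)%:R * (g S y a + dl) <= _); last by rewrite lerDr.
rewrite ya mul1r -[leRHS]mul1r; apply: ler_pM => //; exact: normc_g1.
Qed.

Lemma stein_error S t : t \in l ->
  \sum_a normc ((B t *m (G (upd S t true) *m (B t *m G (upd S t false)))) a a -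
      steinmain t S a) <= 2 * K ^+ 2 * off t S + 4 * h * K ^+ 6.
Proof.
move=> tl.
apply: le_trans (_ : \sum_a \sum_b inc t a b * (\sum_x \sum_y
    (inc t x y * ((x != b)%:R * (g S b x + dl) + (y != a)%:R * (g S y a + dl)))
    + 2 * dl) <= _).
  apply: ler_sum => a _; rewrite /steinmain mxE -sumrB.
  apply: le_trans (le_normc_sum _ _ _) _; apply: ler_sum => b _.
  have [i0|] := eqVneq (inc t a b) 0.
    by rewrite !mxE i0 !mul0r subrr normc0.
  rewrite /inc; case: (boolP (_ && _)) => [|_]; last by rewrite eqxx.
  move=> /andP[/andP[ab aF] bF] _; rewrite !mul1r.
  rewrite (_ : _ - _ = \sum_x \sum_y ((block t a b)%:C%C * (G (upd S t true) b x *
           ((block t x y)%:C%C * G (upd S t false) y a)) -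
         ((x == b) && (y == a))%:R * (G S b b * G S a a))); last first.
    under [RHS]eq_bigr do rewrite sumrB.
    rewrite sumrB [(map_mx _ _) a b]mxE [(G _ *m _) b a]mxE mulr_sumr; congr (_ - _).
      apply: eq_bigr => x _; rewrite [(B t *m _) x a]mxE !mulr_sumr.
      by apply: eq_bigr => y _; rewrite [(map_mx _ _) x y]mxE.
    rewrite (bigD1 b)//= [X in _ + X]big1 ?addr0 => [|x xb]; last first.
      by apply: big1 => y _; rewrite (negbTE xb) mul0r.
    rewrite (bigD1 a)//= big1 ?addr0 => [|y ya]; last first.
      by rewrite (negbTE ya) andbF mul0r.
    by rewrite !eqxx mul1r.
  apply: le_trans (le_normc_sum _ _ _) _.
  apply: le_trans (_ : \sum_x \sum_y (inc t x y * ((x != b)%:R * (g S b x + dl) +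
      (y != a)%:R * (g S y a + dl)) + ((x == b) && (y == a))%:R * (2 * dl)) <= _).
    apply: ler_sum => x _; apply: le_trans (le_normc_sum _ _ _) _.
    by apply: ler_sum => y _; exact: stein_term.
  under eq_bigr do rewrite big_split /=; rewrite big_split /= lerD2l.
  rewrite (bigD1 b)//= [X in _ + X]big1 ?addr0 => [|x xb]; last first.
    by apply: big1 => y _; rewrite (negbTE xb) mul0r.
  rewrite (bigD1 a)//= big1 ?addr0 => [|y ya]; last first.
    by rewrite (negbTE ya) andbF mul0r.
  by rewrite !eqxx mul1r.
have g0 i j : 0 <= g S i j := normc_ge0 _.
have gd0 i j : 0 <= g S i j + dl by rewrite addr_ge0.
pose f x : R := (x \in F t)%:R.
have f0 x : 0 <= f x by exact: ler0n.
(* Each product of incidences is dominated by the membership indicators of two indices times the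
   incidence of the two indices of the off-diagonal entry; each free index then sums to K. *)
apply: le_trans (_ : \sum_a \sum_b (\sum_x \sum_y
   (f a * ((inc t b x * (g S b x + dl)) * f y) +
    f b * ((inc t y a * (g S y a + dl)) * f x)) + inc t a b * (2 * dl)) <= _).
  apply: ler_sum => a _; apply: ler_sum => b _; rewrite mulrDr lerD2r.
  rewrite mulr_sumr; apply: ler_sum => x _; rewrite mulr_sumr.
  apply: ler_sum => y _; rewrite (mulrDr (inc t x y)) (mulrDr (inc t a b)).
  apply: lerD.
    rewrite (_ : _ * _ = inc t a b * inc t x y * (x != b)%:R * (g S b x + dl));
      last by ring.
    rewrite (_ : f a * _ = f a * f y * inc t b x * (g S b x + dl)); last by ring.
    rewrite ler_wpM2r// /inc /f (eq_sym b x).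
    by do 4!case: (_ \in F t); do 3!case: (_ != _); rewrite ?(mulr1,mulr0,mul0r,ler01).
  rewrite (_ : _ * _ = inc t a b * inc t x y * (y != a)%:R * (g S y a + dl));
    last by ring.
  rewrite (_ : f b * _ = f b * f x * inc t y a * (g S y a + dl)); last by ring.
  rewrite ler_wpM2r// /inc /f.
  by do 4!case: (_ \in F t); do 3!case: (_ != _); rewrite ?(mulr1,mulr0,mul0r,ler01).
have sK : \sum_x f x = K by exact: sum_inF.
have q1 : \sum_a \sum_b \sum_x \sum_y f a * ((inc t b x * (g S b x + dl)) * f y) =
    K ^+ 2 * \sum_b \sum_x inc t b x * (g S b x + dl).
  under eq_bigr do under eq_bigr do under eq_bigr do rewrite -mulr_sumr -mulr_sumr sK.
  under eq_bigr do under eq_bigr do rewrite -mulr_sumr -mulr_suml.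
  under eq_bigr do rewrite -mulr_sumr -mulr_suml.
  by rewrite -mulr_suml sK; ring.
have q2 : \sum_a \sum_b \sum_x \sum_y f b * ((inc t y a * (g S y a + dl)) * f x) =
    K ^+ 2 * \sum_b \sum_x inc t b x * (g S b x + dl).
  under eq_bigr do under eq_bigr do under eq_bigr do rewrite -mulr_sumr -mulr_suml.
  under eq_bigr do under eq_bigr do rewrite -mulr_sumr -mulr_sumr sK.
  under eq_bigr do rewrite -mulr_suml sK.
  by rewrite -mulr_sumr -mulr_suml [in LHS]exchange_big; ring.
under eq_bigr do rewrite big_split /=.
rewrite big_split /=.
under eq_bigr do under eq_bigr do under eq_bigr do rewrite big_split /=.
under eq_bigr do under eq_bigr do rewrite big_split /=.
under eq_bigr do rewrite big_split /=.
rewrite big_split /= q1 q2.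
have -> : \sum_b \sum_x inc t b x * (g S b x + dl) =
    off t S + (\sum_b \sum_x inc t b x) * dl.
  rewrite mulr_suml -big_split; apply: eq_bigr => x _ /=.
  by rewrite mulr_suml -big_split; apply: eq_bigr => y _ /=; rewrite mulrDr.
under [X in _ + X <= _]eq_bigr do rewrite -mulr_suml; rewrite -mulr_suml.
set I := \sum_b \sum_x inc t b x; have I2 : I <= K ^+ 2 := sum_inc tl.
have e1 : K ^+ 2 * (I * dl) <= K ^+ 2 * (K ^+ 2 * dl).
  by rewrite ler_wpM2l ?sqr_ge0// ler_wpM2r.
have e2 : I * dl <= K ^+ 4 * dl.
  rewrite ler_wpM2r// (le_trans I2)// ler_weXn2l//.
have -> : 4 * h * K ^+ 6 = 2 * (K ^+ 2 * (K ^+ 2 * dl)) + 2 * (K ^+ 4 * dl) by ring.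
by move: e1 e2; lra.
Qed.

(** Use g <= h/2 + g^2/(2h): the first part is summed with [c_size_l], the second with c <= h^2 and
    the Ward bound, and the weight h makes both of order h. *)
Lemma sum_off S : c * \sum_(t <- l) off t S <= N%:R * (h * K ^+ 2).
Proof.
case/andP: h01 => hgt0 _.
apply: le_trans (_ : c * \sum_(t <- l) \sum_x \sum_y
   (inc t x y * (h / 2) + inc t x y * (g S x y ^+ 2 / (2 * h))) <= _).
  rewrite ler_wpM2l//; apply: ler_sum => t _; apply: ler_sum => x _.
  apply: ler_sum => y _; rewrite -mulrDr ler_wpM2l//.
  rewrite -subr_ge0 (_ : _ - _ = (g S x y - h) ^+ 2 / (2 * h)).
    by rewrite divr_ge0 ?sqr_ge0// mulr_ge0.
  by field; rewrite gt_eqF.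
under eq_bigr do under eq_bigr do rewrite big_split /=.
under eq_bigr do rewrite big_split /=.
rewrite big_split /= mulrDr.
have e1 : c * \sum_(t <- l) \sum_x \sum_y inc t x y * (h / 2) <=
    N%:R * (K ^+ 2 * (h / 2)).
  apply: le_trans (_ : c * \sum_(t <- l) K ^+ 2 * (h / 2) <= _).
    rewrite ler_wpM2l// !big_seq; apply: ler_sum => t tl.
    under eq_bigr do rewrite -mulr_suml; rewrite -mulr_suml ler_wpM2r ?sum_inc//.
    by rewrite divr_ge0.
  rewrite sum_cst_seq -[_ *+ size l]mulr_natl mulrA ler_wpM2r ?c_size_l//.
  by rewrite mulr_ge0 ?sqr_ge0// divr_ge0.
have e2 : c * \sum_(t <- l) \sum_x \sum_y inc t x y * (g S x y ^+ 2 / (2 * h)) <=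
    N%:R * (h / 2).
  apply: le_trans (_ : h ^+ 2 * (N%:R / (2 * h)) <= _); last first.
    rewrite le_eqVlt; apply/orP; left; apply/eqP; field; by rewrite gt_eqF.
  apply: ler_pM => //.
    do 3!apply: sumr_ge0 => ? _; rewrite mulr_ge0// divr_ge0 ?sqr_ge0// mulr_ge0//.
  rewrite exchange_big /=; apply: le_trans (_ : \sum_(x < N) (2 * h)^-1 <= _); last first.
    by rewrite sumr_const card_ord -[leLHS]mulr_natl.
  apply: ler_sum => x _; rewrite exchange_big /=.
  apply: le_trans (_ : \sum_y g S x y ^+ 2 / (2 * h) <= _).
    apply: ler_sum => y _; rewrite -mulr_suml ler_piMl ?sum_inc_line//.
    by rewrite divr_ge0 ?sqr_ge0// mulr_ge0.
  rewrite -mulr_suml -[leRHS]mul1r ler_wpM2r ?sum_g1// invr_ge0 mulr_ge0//.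
have e3 : N%:R * (h / 2) <= N%:R * (K ^+ 2 * (h / 2)).
  rewrite ler_wpM2l// ler_peMl ?divr_ge0// exprn_ege1//.
move: e1 e2 e3; lra.
Qed.

Local Notation v a S := (EC (fun T => G T a a) S).

Definition adj a b : R := \sum_(t <- l) inc t a b.

Lemma adj_ge0 a b : 0 <= adj a b.
Proof. by apply: sumr_ge0. Qed.

Lemma sum_adj a : \sum_b adj a b = r%:R * (k.-1)%:R.
Proof.
rewrite exchange_big /= -(sum_deg a) mulr_suml !big_seq; apply: eq_bigr => t tl.
case: (boolP (a \in F t)) => aF; last first.
  by rewrite mul0r big1// => b _; rewrite /inc (negbTE aF) andbF.
rewrite mul1r -(cardF tl) (cardsD1 a) aF add1n /= -sum1_card natr_sum.
rewrite [RHS]big_mkcond; apply: eq_bigr => b _ /=.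
by rewrite /inc aF andbT !inE eq_sym; case: (_ && _).
Qed.

Lemma adj_sym a b : adj a b = adj b a.
Proof. by apply: eq_bigr => t _; exact: inc_sym. Qed.

Local Notation KK := (26 * K ^+ 10).

Lemma normc_v S a : normc (v a S) <= 1.
Proof.
apply: le_trans (normc_bexp p01 _ _ _) _; rewrite -[leRHS](bexp_cst p l _ S).
by apply: ler_bexp => // T; exact: normc_g1.
Qed.

(** Inside the modulus stand exactly the mean Stein errors and the covariances of the diagonal
    entries, multiplied by -c. The former contribute 6 K^6 h through [sum_off], the latter 20 K^10 h
    through [variance_diag]; hence the 26. *)
Lemma self_consistency S :
  \sum_a normc (1 + Complex 0 eta * v a S +
    v a S * (c%:C%C * \sum_b (adj a b)%:C%C * v b S)) <= N%:R * (KK * h).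
Proof.
pose D a T := \sum_(t <- l)
  ((B t *m (G (upd T t true) *m (B t *m G (upd T t false)))) a a - steinmain t T a).
pose cov a b := EC (fun T => G T b b * G T a a) S - v b S * v a S.
have -> : \sum_a normc (1 + Complex 0 eta * v a S +
    v a S * (c%:C%C * \sum_b (adj a b)%:C%C * v b S)) =
  \sum_a normc (- c%:C%C * EC (D a) S - c%:C%C * \sum_b (adj a b)%:C%C * cov a b).
  apply: eq_bigr => a _; congr normc.
  rewrite stein_diag /D bexp_sum.
  under [in RHS]eq_bigr do rewrite bexpB.
  rewrite sumrB.
  have hY : \sum_(t <- l) EC (steinmain t ^~ a) S =
      \sum_b (adj a b)%:C%C * EC (fun T => G T b b * G T a a) S.
    under [RHS]eq_bigr do rewrite rmorph_sum mulr_suml.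
    rewrite [RHS]exchange_big /=; apply: eq_bigr => t _.
    by rewrite /steinmain bexp_sum; apply: eq_bigr => b _; rewrite bexpZ.
  have hcov : \sum_b (adj a b)%:C%C * cov a b =
      \sum_(t <- l) EC (steinmain t ^~ a) S - (\sum_b (adj a b)%:C%C * v b S) * v a S.
    by rewrite hY mulr_suml -sumrB; apply: eq_bigr => b _; rewrite /cov mulrBr mulrA.
  by rewrite hcov; ring.
apply: le_trans (_ : c * \sum_a normc (EC (D a) S) +
    \sum_a c * \sum_b adj a b * normc (cov a b) <= _).
  rewrite mulr_sumr -big_split /=; apply: ler_sum => a _.
  apply: le_trans (le_normcB _ _) _.
  rewrite !normcM normcN normc_real ger0_norm// lerD2l ler_wpM2l//.
  apply: le_trans (le_normc_sum _ _ _) _; apply: ler_sum => b _.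
  by rewrite normcM normc_real ger0_norm// adj_ge0.
have e1 : c * \sum_a normc (EC (D a) S) <= N%:R * (6 * K ^+ 6 * h).
  have cE (x : R) : x = ER (fun=> x) S by rewrite bexp_cst.
  apply: le_trans (_ : ER (fun T => c * \sum_a normc (D a T)) S <= _).
    rewrite bexpZ ler_wpM2l// bexp_sum; apply: ler_sum => a _.
    exact: normc_bexp.
  rewrite [leRHS]cE; apply: ler_bexp => // T.
  apply: le_trans (_ : c * \sum_(t <- l) (2 * K ^+ 2 * off t T + 4 * h * K ^+ 6) <= _).
    rewrite ler_wpM2l//; apply: le_trans (_ : \sum_(t <- l) \sum_a normc
      ((B t *m (G (upd T t true) *m (B t *m G (upd T t false)))) a a -
      steinmain t T a) <= _); last first.
      by rewrite !big_seq; apply: ler_sum => t tl; exact: stein_error.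
    rewrite exchange_big /=; apply: ler_sum => a _; exact: le_normc_sum.
  rewrite big_split /= -mulr_sumr sum_cst_seq mulrDr.
  have f1 : c * (2 * K ^+ 2 * \sum_(t <- l) off t T) <=
     2 * K ^+ 2 * (N%:R * (h * K ^+ 2)).
    by rewrite mulrCA ler_wpM2l ?sum_off// mulr_ge0// sqr_ge0.
  have f2 : c * (4 * h * K ^+ 6 *+ size l) <= N%:R * (4 * h * K ^+ 6).
    rewrite -[_ *+ size l]mulr_natl mulrA ler_wpM2r ?c_size_l//.
    by rewrite !mulr_ge0// exprn_ge0.
  have f3 : 2 * K ^+ 2 * (N%:R * (h * K ^+ 2)) <= N%:R * (2 * h * K ^+ 6).
    have -> : 2 * K ^+ 2 * (N%:R * (h * K ^+ 2)) = N%:R * (2 * h * K ^+ 4) by ring.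
    by rewrite ler_wpM2l// ler_wpM2l ?mulr_ge0// ler_weXn2l.
  by move: f1 f2 f3; lra.
have e2 : \sum_a c * \sum_b adj a b * normc (cov a b) <= N%:R * (20 * K ^+ 10 * h).
  apply: le_trans (_ : \sum_(a < N) 20 * K ^+ 10 * h <= _); last first.
    by rewrite sumr_const card_ord -[leLHS]mulr_natl.
  apply: ler_sum => a _.
  apply: le_trans (_ : c * \sum_b adj a b * (20 * K ^+ 10 * h ^+ 2) <= _).
    rewrite ler_wpM2l//; apply: ler_sum => b _; rewrite ler_wpM2l ?adj_ge0//.
    apply: le_trans (covariance_normc_bexp p01 _ _ _ _) _.
    by have := variance_diag S a; have := variance_diag S b; lra.
  rewrite -mulr_suml sum_adj mulrA (mulrA c).
  apply: le_trans (_ : 1 * (20 * K ^+ 10 * h ^+ 2) <= _).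
    by rewrite ler_wpM2r// !mulr_ge0 ?exprn_ge0.
  by rewrite mul1r expr2 mulrA ler_piMr// !mulr_ge0 ?exprn_ge0.
have e3 : N%:R * (6 * K ^+ 6 * h) <= N%:R * (6 * K ^+ 10 * h).
  by rewrite ler_wpM2l// ler_wpM2r// ler_wpM2l// ler_weXn2l.
by move: e1 e2 e3; lra.
Qed.

(** Subtract the quadratic equation of [g0] from the approximate one. The factors s_a and g0 have
    modulus at most 1, and [adj] is symmetric with row sums at most 1 after multiplication by [c],
    so summing over [a] gives (eta - 1) X <= X + error, X being the sum of |v_a - g0|. As eta >= 3,
    X <= error. The constant is 26 + 1, the 1 accounting for the defect of the row variance. *)
Lemma mean_trace_resolvent S (g0 : complex R) : normc g0 <= 1 ->
  1 + Complex 0 eta * g0 + g0 ^+ 2 = 0 -> 1 - c * r%:R * (k.-1)%:R <= h ->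
  normc (EC (fun T => \tr (G T)) S - N%:R * g0) <= N%:R * (27 * K ^+ 10 * h).
Proof.
move=> g01 g0E theta_h.
pose x a := v a S - g0.
pose s a := c%:C%C * \sum_b (adj a b)%:C%C * v b S.
pose re a := 1 + Complex 0 eta * v a S + v a S * s a.
have hre : \sum_a normc (re a) <= N%:R * (KK * h) := self_consistency S.
have cadj a : c * \sum_b adj a b = c * r%:R * (k.-1)%:R.
  by rewrite sum_adj mulrA.
have key a : (eta - 1) * normc (x a) <=
    c * (\sum_b adj a b * normc (x b)) + h + normc (re a).
  have E : Complex 0 eta * x a = re a - x a * s a - g0 * (s a - g0).
    have : 0 = 1 + Complex 0 eta * g0 + g0 ^+ 2 by rewrite g0E.
    by rewrite /x /re => E; rewrite -[LHS]addr0 E; ring.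
  have s1 : normc (s a) <= 1.
    rewrite normcM normc_real ger0_norm//; apply: le_trans theta1.
    rewrite -(cadj a) ler_wpM2l//; apply: le_trans (le_normc_sum _ _ _) _.
    apply: ler_sum => b _; rewrite normcM normc_real ger0_norm ?adj_ge0//.
    by rewrite ler_piMr ?adj_ge0// normc_v.
  have sg : normc (s a - g0) <= c * (\sum_b adj a b * normc (x b)) + h.
    have -> : s a - g0 = c%:C%C * (\sum_b (adj a b)%:C%C * x b) -
        (1 - c * r%:R * (k.-1)%:R)%:C%C * g0.
      have -> : (1 - c * r%:R * (k.-1)%:R)%:C%C = 1 - c%:C%C * \sum_b (adj a b)%:C%C.
        rewrite -(cadj a) rmorphB rmorph1; congr (_ - _).
        by rewrite [LHS]rmorphM [X in _ * X]rmorph_sum.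
      rewrite /s /x.
      have -> : \sum_b (adj a b)%:C%C * (v b S - g0) =
          \sum_b (adj a b)%:C%C * v b S - (\sum_b (adj a b)%:C%C) * g0.
        by rewrite mulr_suml -sumrB; apply: eq_bigr => b _; rewrite mulrBr.
      by ring.
    apply: le_trans (le_normcB _ _) _; rewrite !normcM !normc_real ger0_norm//.
    apply: lerD.
      rewrite ler_wpM2l//; apply: le_trans (le_normc_sum _ _ _) _.
      by apply: ler_sum => b _; rewrite normcM normc_real ger0_norm ?adj_ge0.
    rewrite ger0_norm ?subr_ge0//; apply: le_trans theta_h.
    by rewrite ler_piMr// subr_ge0.
  have : normc (Complex 0 eta * x a) <=
      normc (re a) + normc (x a) * normc (s a) + normc g0 * normc (s a - g0).
    by rewrite E; do 2!(apply: le_trans (le_normcB _ _) _; rewrite normcM lerD2r//).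
  rewrite normcM (_ : normc (Complex 0 eta) = eta); last first.
    by rewrite /= expr0n /= add0r sqrtr_sqr ger0_norm// ltW.
  have x0 : 0 <= normc (x a) := normc_ge0 _.
  have m1 : normc (x a) * normc (s a) <= normc (x a) by rewrite ler_piMr.
  have m2 : normc g0 * normc (s a - g0) <= normc (s a - g0).
    by rewrite ler_piMl// normc_ge0.
  by move: m1 m2 sg; lra.
have sumkey : (eta - 1) * (\sum_a normc (x a)) <=
    \sum_a normc (x a) + N%:R * h + N%:R * (KK * h).
  rewrite mulr_sumr.
  apply: le_trans (_ : \sum_a (c * (\sum_b adj a b * normc (x b)) + h + normc (re a)) <= _).
    by apply: ler_sum => a _; exact: key.
  rewrite !big_split /= sumr_const card_ord -[h *+ _]mulr_natl.
  apply: lerD hre; rewrite lerD2r -mulr_sumr exchange_big /= mulr_sumr.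
  apply: ler_sum => b _; rewrite -mulr_suml mulrA ler_piMl ?normc_ge0//.
  by under eq_bigr do rewrite adj_sym; rewrite cadj.
have X0 : 0 <= \sum_a normc (x a) by apply: sumr_ge0 => *; exact: normc_ge0.
have -> : EC (fun T => \tr (G T)) S - N%:R * g0 = \sum_a x a.
  rewrite /x sumrB sumr_const card_ord -[g0 *+ _]mulr_natl; congr (_ - _).
  by rewrite /mxtrace bexp_sum.
apply: le_trans (le_normc_sum _ _ _) _.
have K10 : N%:R * h <= N%:R * (K ^+ 10 * h).
  by rewrite ler_wpM2l// ler_peMl// exprn_ege1.
have : 1 * (\sum_a normc (x a)) <= (eta - 2) * (\sum_a normc (x a)).
  by rewrite ler_wpM2r//; move: eta3; lra.
by move: sumkey K10; lra.
Qed.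

End Ensemble.

(** * Finite rank perturbations and eigenvalues *)

Section RankPerturbation.
Variables (R : rcfType) (N : nat) (eta : R).
Hypothesis eta0 : 0 < eta.
Implicit Types (H : 'M[R]_N) (u : 'cV[R]_N).
Local Notation toC := (map_mx (real_complex R)).
Local Notation G H := (resolvent H eta).

(* Sherman-Morrison: with y = G u and b = u^T y one gets
   tr G' - tr G = - t y^T y / (1 + t b), while Im b = eta |y|^2. *)
Lemma trace_resolvent_rank1 H u t : H^T = H ->
  normc (\tr (G (H + t *: (u *m u^T))) - \tr (G H)) <= eta^-1.
Proof.
move=> sH; set H' := H + _.
have sH' : H'^T = H' by rewrite /H' linearD linearZ /= trmx_mul trmxK sH.
pose y := G H *m toC u; pose b := ((toC u)^T *m y) 0 0.
pose b' := ((toC u)^T *m (G H' *m toC u)) 0 0.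
have uu1 : toC (H - H') = - (t%:C%C *: (toC u *m (toC u)^T)).
  by rewrite /H' opprD addrA subrr sub0r map_mxN map_mxZ map_mxM map_trmx.
have uu2 : toC (H' - H) = t%:C%C *: (toC u *m (toC u)^T).
  by rewrite -opprB map_mxN uu1 opprK.
have yE : G H' *m toC u = (1 - t%:C%C * b') *: y.
  have E := resolvent_sub sH' sH eta0.
  have -> : G H' = G H - (G H - G H') by rewrite opprB addrC subrK.
  rewrite E uu2 mulmxBl scalerBl scale1r; congr (_ - _).
  rewrite -scalemxAr -!scalemxAl -scalerA -!mulmxA; congr (_ *: _).
  rewrite [(toC u)^T *m _]mx11_scalar -/b' mul_mx_scalar -scalemxAr.
  by [].
have bE : (1 - t%:C%C * b') * (1 + t%:C%C * b) = 1.
  have : b' = (1 - t%:C%C * b') * b by rewrite {1}/b' yE -scalemxAr mxE.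
  by move=> e; rewrite mulrDr mulr1 [X in _ + X]mulrCA -e; ring.
have trE : \tr (G H') - \tr (G H) =
    - (t%:C%C * (1 - t%:C%C * b') * \sum_a y a 0 ^+ 2).
  rewrite -raddfB /= resolvent_sub// uu1 mulmxN mulNmx raddfN /=; congr (- _).
  rewrite -scalemxAr -scalemxAl mxtraceZ -mulrA; congr (_ * _).
  rewrite (_ : _ *m _ *m _ = (G H' *m toC u) *m ((toC u)^T *m G H));
    last by rewrite !mulmxA.
  rewrite mxtrace_mulC yE -scalemxAr mxtraceZ; congr (_ * _).
  rewrite /mxtrace big_ord1 mxE; apply: eq_bigr => a _; rewrite expr2; congr (_ * _).
  have -> : (toC u)^T *m G H = y^T by rewrite /y trmx_mul resolvent_tr.
  by rewrite mxE.
pose q := \sum_a normc (y a 0) ^+ 2.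
have q0 : 0 <= q by apply: sumr_ge0 => *; exact: sqr_ge0.
have Imb : complex.Im b = eta * q.
  have := @Im_shifted_form _ N H eta y^T sH.
  have -> : y^T *m shifted H eta = (toC u)^T.
    by rewrite /y trmx_mul resolvent_tr// -mulmxA mulresolventV// mulmx1.
  rewrite (_ : \sum_b _ = (b^*)%C); last first.
    rewrite /b mxE rmorph_sum; apply: eq_bigr => a _.
    by rewrite rmorphM !mxE /= oppr0.
  under eq_bigr do rewrite mxE.
  rewrite -/q; case: (b) => x x' /= /eqP.
  by rewrite mulNr eqr_opp => /eqP.
have yq : normc (\sum_a y a 0 ^+ 2) <= q.
  apply: le_trans (le_normc_sum _ _ _) _; apply: ler_sum => a _.
  by rewrite expr2 normcM expr2.
rewrite trE normcN !normcM normc_real.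
set n1 := normc (1 - _); set n2 := normc (\sum_a _) in yq *.
have n10 : 0 <= n1 := normc_ge0 _.
have n1E : n1 * normc (1 + t%:C%C * b) = 1 by rewrite -normcM bE normc1.
have n3 : `|t| * (eta * q) <= normc (1 + t%:C%C * b).
  apply: le_trans (normc_ReIm _).2.
  rewrite (_ : complex.Im _ = t * complex.Im b); last by case: (b) => x x' /=; ring.
  by rewrite normrM Imb (ger0_norm (mulr_ge0 (ltW eta0) q0)).
rewrite -[leRHS]mulr1 -ler_pdivrMl ?invr_gt0// invrK.
apply: le_trans (_ : eta * (`|t| * n1 * q) <= _).
  by rewrite ler_wpM2l ?(ltW eta0)// ler_wpM2l// mulr_ge0.
rewrite (_ : eta * _ = n1 * (`|t| * (eta * q))); last by ring.
by rewrite -n1E ler_wpM2l.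
Qed.

Lemma trace_resolvent_shift H e : H^T = H ->
  normc (\tr (G (H + e%:M)) - \tr (G H)) <= N%:R * (`|e| * eta ^- 2).
Proof.
move=> sH; set H' := H + _.
have sH' : H'^T = H' by rewrite /H' linearD /= tr_scalar_mx sH.
rewrite -raddfB /= resolvent_sub// /H' opprD addrA subrr sub0r map_mxN.
rewrite map_scalar_mx mulmxN mulNmx mul_mx_scalar -scalemxAl raddfN /= mxtraceZ.
rewrite normcN normcM normc_real mulrCA ler_wpM2l//.
apply: le_trans (le_normc_sum _ _ _) _.
rewrite -[N in leRHS]card_ord mulr_natl -sumr_const; apply: ler_sum => a _.
rewrite mxE; apply: le_trans (le_normc_sum _ _ _) _.
have s1 := sum_resolvent_sqr sH eta0 a; have s2 := sum_resolvent_sqr sH' eta0 a.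
apply: le_trans (_ : \sum_b 2^-1 * (normc (G H' a b) ^+ 2 + normc (G H a b) ^+ 2) <= _).
  apply: ler_sum => b _; rewrite normcM (resolvent_sym eta sH b a).
  by have := sqr_ge0 (normc (G H' a b) - normc (G H a b)); nra.
by rewrite -mulr_sumr big_split /=; lra.
Qed.

(** Telescoping over [s]: each rank-one term costs 1/eta, whatever the size of [t] and of the
    vector. *)
Lemma trace_resolvent_perturb H (s : seq 'cV[R]_N) t e : H^T = H ->
  normc (\tr (G (H + t *: (\sum_(u <- s) u *m u^T) + e%:M)) - \tr (G H)) <=
  (size s)%:R / eta + N%:R * (`|e| * eta ^- 2).
Proof.
move=> sH; pose K (s : seq 'cV[R]_N) : 'M[R]_N := H + t *: (\sum_(u <- s) u *m u^T).
have sK s' : (K s')^T = K s'.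
  rewrite /K linearD linearZ /= sH linear_sum /=.
  by under eq_bigr do rewrite trmx_mul trmxK.
rewrite -/(K s) -[_ - _](subrKA (\tr (G (K s)))) addrC.
apply: le_trans (le_normcD _ _) _; apply: lerD (trace_resolvent_shift e (sK s)).
elim: s => [|u s IH].
  by rewrite /K big_nil scaler0 addr0 subrr normc0 mul0r.
rewrite -[_ - _](subrKA (\tr (G (K s)))); apply: le_trans (le_normcD _ _) _.
rewrite /= -natr1 mulrDl mul1r addrC; apply: lerD IH _.
rewrite /K big_cons scalerDr [_ + t *: \sum_(_ <- _) _]addrC addrA.
by apply: trace_resolvent_rank1; exact: sK.
Qed.

End RankPerturbation.

Lemma char_poly_conj (K : fieldType) N (P D : 'M[K]_N) : P \in unitmx ->
  char_poly (invmx P *m D *m P) = char_poly D.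
Proof.
move=> uP; rewrite /char_poly /char_poly_mx.
have PV : map_mx polyC (invmx P) *m map_mx polyC P = 1%:M.
  by rewrite -map_mxM mulVmx// map_mx1.
have -> : 'X%:M - map_mx polyC (invmx P *m D *m P) =
    map_mx polyC (invmx P) *m ('X%:M - map_mx polyC D) *m map_mx polyC P.
  rewrite mulmxBr mulmxBl -!map_mxM; congr (_ - _).
  by rewrite scalar_mxC -mulmxA PV mulmx1.
by rewrite !det_mulmx mulrAC -det_mulmx PV det1 mul1r.
Qed.

Lemma invmx_uniq (K : fieldType) N (A B : 'M[K]_N) :
  A *m B = 1%:M -> invmx A = B.
Proof.
by move=> AB; have [uA _] := mulmx1_unit AB; rewrite -[RHS](mulKmx uA) AB mulmx1.
Qed.

Lemma conj_diag_inverse (K : fieldType) N (P A : 'M[K]_N) (D : 'rV[K]_N) (z : K) :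
  P \in unitmx -> A = invmx P *m diag_mx D *m P -> (forall i, D 0 i != z) ->
  invmx (A - z%:M) = invmx P *m diag_mx (\row_i (D 0 i - z)^-1) *m P.
Proof.
move=> uP -> Dz; apply: invmx_uniq.
have -> : invmx P *m diag_mx D *m P - z%:M =
    invmx P *m (diag_mx (\row_i (D 0 i - z))) *m P.
  have -> : diag_mx (\row_i (D 0 i - z)) = diag_mx D - z%:M.
    by apply/matrixP => i j; rewrite !mxE -mulrnBl.
  rewrite mulmxBr mulmxBl; congr (_ - _).
  by rewrite -mulmxA mul_scalar_mx -scalemxAr mulVmx// scalemx1.
rewrite !mulmxA mulmxK// -[invmx P *m _ *m _]mulmxA mulmx_diag.
rewrite (_ : diag_mx _ = 1%:M) ?mulmx1 ?mulVmx//.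
by apply/matrixP => i j; rewrite !mxE mulfV// subr_eq0.
Qed.

(** E = 1 - U Q is the idempotent complementary to U Q; the matrix acts as S on the image of U and
    as -z on that of E, and is inverted on the two parts separately. *)
Lemma embed_inverse (K : fieldType) n N (Q : 'M[K]_(n, N)) (U : 'M[K]_(N, n))
    (S G : 'M[K]_n) (z : K) : Q *m U = 1%:M -> S *m G = 1%:M -> z != 0 ->
  (U *m S *m Q - z *: (1%:M - U *m Q)) *m
  (U *m G *m Q - z^-1 *: (1%:M - U *m Q)) = 1%:M.
Proof.
move=> QU SG z0; set E := 1%:M - U *m Q.
have QE : Q *m E = 0 by rewrite mulmxBr mulmx1 mulmxA QU mul1mx subrr.
have EU : E *m U = 0 by rewrite mulmxBl mul1mx -mulmxA QU mulmx1 subrr.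
have EE : E *m E = E by rewrite {1}/E mulmxBl mul1mx -mulmxA QE mulmx0 subr0.
have T1 : U *m S *m Q *m (U *m G *m Q) = U *m Q.
  rewrite !mulmxA -(mulmxA (U *m S)) QU mulmx1 -(mulmxA U) SG mulmx1.
  by [].
have T2 : U *m S *m Q *m E = 0 by rewrite -mulmxA QE mulmx0.
have T3 : E *m (U *m G *m Q) = 0 by rewrite !mulmxA EU !mul0mx.
rewrite mulmxBl !mulmxBr T1 -scalemxAr T2 scaler0 subr0.
rewrite -scalemxAl T3 scaler0 -scalemxAr -scalemxAl EE scalerA mulVf// scale1r.
by rewrite sub0r opprK /E addrC subrK.
Qed.

(** * Resolvent traces as sums over eigenvalues *)

Section Spectrum.
Variables (R : realType) (eta : R).
Hypothesis eta0 : 0 < eta.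

Lemma size_eigenvalues N (M : 'M[R]_N) : M^T = M -> size (eigenvalues M) = N.
Proof.
move=> /eigenvaluesP /(congr1 (fun q : {poly R} => size q)).
by rewrite size_char_poly size_prod_XsubC => -[].
Qed.

(** [eigenvalues] is known only through the characteristic polynomial, so the diagonal given by the
    spectral theorem is matched with it, up to a permutation, by unique factorisation into linear
    factors. *)
Lemma trace_resolvent_eigenvalues N (M : 'M[R]_N) : M^T = M ->
  \tr (resolvent M eta) =
  \sum_(x <- eigenvalues M) (x%:C%C - Complex 0 eta)^-1.
Proof.
move=> sM; pose A := map_mx (real_complex R) M.
have Asym : A \is symmetricmx.
  by apply/is_hermitianmxP; rewrite expr0 scale1r map_mx_id// map_trmx sM.
have Areal : A \is a mxOver Num.real.
  by apply/mxOverP => i j; rewrite mxE; apply/complex_realP; exists (M i j).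
have /orthomx_spectralP := hermitian_normalmx (realsym_hermsym Asym Areal).
set P := spectralmx A; set D := spectral_diag A => AE.
have uP : P \in unitmx := spectral_unit A.
have eqD : perm_eq [seq D 0 i | i <- enum 'I_N]
    [seq x%:C%C | x <- eigenvalues M].
  apply: prod_XsubC_eq.
  have := congr1 (map_poly (real_complex R)) (eigenvaluesP sM).
  rewrite map_char_poly -/A {1}AE char_poly_conj// char_poly_trig ?diag_mx_is_trig//.
  rewrite rmorph_prod !big_map -enumT big_enum /=.
  under eq_bigr do rewrite !mxE eqxx mulr1n.
  by move=> ->; apply: eq_bigr => x _; rewrite rmorphB /= map_polyX map_polyC.
have Dz i : D 0 i != Complex 0 eta.
  have : D 0 i \in [seq x%:C%C | x <- eigenvalues M].
    by rewrite -(perm_mem eqD); apply: map_f; rewrite mem_enum.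
  case/mapP => x _ ->; apply/eqP => -[_ /esym/eqP].
  by rewrite gt_eqF.
rewrite /resolvent /shifted (conj_diag_inverse uP AE Dz).
rewrite -mulmxA mxtrace_mulC -mulmxA mulmxV// mulmx1 mxtrace_diag.
rewrite -(big_map (fun x : R => x%:C%C) xpredT (fun c => (c - Complex 0 eta)^-1)).
rewrite -(perm_big _ eqD) big_map big_enum /=.
by apply: eq_bigr => i _; rewrite mxE.
Qed.

(** The embedded matrix vanishes on the orthogonal complement of the rows of [P], of dimension N -
    n, where its resolvent is -1/z. *)
Lemma trace_resolvent_embed n N (M : 'M[R]_n) (P : 'M[R]_(n, N)) :
  M^T = M -> P *m P^T = 1%:M ->
  \tr (resolvent (P^T *m M *m P) eta) =
  \tr (resolvent M eta) - (N%:R - n%:R) * (Complex 0 eta)^-1.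
Proof.
move=> sM PP; set z := Complex 0 eta.
have zn0 : z != 0 by apply/eqP => -[/eqP]; rewrite gt_eqF.
have sPMP : (P^T *m M *m P)^T = P^T *m M *m P.
  by rewrite !trmx_mul trmxK sM mulmxA.
pose Q := map_mx (real_complex R) P.
have QQ : Q *m Q^T = 1%:M by rewrite map_trmx -map_mxM PP map_mx1.
have sE : shifted (P^T *m M *m P) eta =
   Q^T *m shifted M eta *m Q - z *: (1%:M - Q^T *m Q).
  rewrite /shifted !map_mxM map_trmx -/Q mulmxBr mulmxBl -!addrA; congr (_ + _).
  rewrite mul_mx_scalar -scalemxAl scalerBr opprB addKr.
  by rewrite scalemx1.
have -> : resolvent (P^T *m M *m P) eta =
   Q^T *m resolvent M eta *m Q - z^-1 *: (1%:M - Q^T *m Q).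
  by apply: invmx_uniq; rewrite sE; exact: embed_inverse QQ (mulVresolvent sM eta0) zn0.
rewrite raddfB /= mxtraceZ raddfB /= mxtrace1.
rewrite mxtrace_mulC mulmxA QQ mul1mx (mxtrace_mulC Q^T) QQ mxtrace1.
by rewrite [in RHS]mulrC.
Qed.

End Spectrum.

(** * Integrals of the semicircle density *)

Section SemicircleCalculus.
Variable R : realType.
Implicit Types x y : R.
Local Notation mu := (@lebesgue_measure R).

Lemma FTC2_continuous (f F : R -> R) (a b : R) : a < b ->
  continuous f -> continuous F ->
  (forall x, a < x < b -> is_derive x 1 F (f x)) ->
  (\int[mu]_(x in `[a, b]) (f x)%:E = (F b - F a)%:E)%E.
Proof.
move=> ab cf cF dF; rewrite EFinB; apply: continuous_FTC2 => //.
- exact: continuous_subspaceT.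
- split.
  + by move=> x; rewrite in_itv /= => /dF[].
  + by apply: cvg_at_right_filter; exact: cF.
  + by apply: cvg_at_left_filter; exact: cF.
- by move=> x; rewrite in_itv /= => /dF d; rewrite derive1E derive_val.
Qed.

(* The arcsine, written so that continuity at the endpoints is immediate. *)
Definition arcsine y : R := 2 * atan (y / (1 + Num.sqrt (1 - y ^+ 2))).

Let sqrt1_gt0 y : 0 < 1 + Num.sqrt (1 - y ^+ 2).
Proof. by rewrite ltr_pwDl// sqrtr_ge0. Qed.

Lemma continuous_sqrt_comp (f : R -> R) : continuous f ->
  continuous (fun x => Num.sqrt (f x)).
Proof.
move=> cf x; apply: (@continuous_comp _ _ _ f Num.sqrt); first exact: cf.
exact: sqrt_continuous.
Qed.

Lemma continuous_arcsine : continuous arcsine.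
Proof.
move=> y; rewrite /arcsine; apply: cvgM; first exact: cvg_cst.
apply: (@continuous_comp _ _ _ (fun y => y / (1 + Num.sqrt (1 - y ^+ 2))) atan);
  last exact: continuous_atan.
apply: cvgM; first exact: cvg_id.
apply: cvgV; first by rewrite gt_eqF.
apply: cvgD; first exact: cvg_cst.
have cs : continuous (fun z : R => Num.sqrt (1 - z ^+ 2)).
  apply: continuous_sqrt_comp => z; apply: cvgB; first exact: cvg_cst.
  exact: exprn_continuous.
exact: cs.
Qed.


Section derive_rules.
Variables (f g : R -> R) (x a b : R).
Hypotheses (df : is_derive x 1 f a) (dg : is_derive x 1 g b).

Lemma is_derive1D : is_derive x 1 (fun x => f x + g x) (a + b).
Proof. exact: is_deriveD. Qed.

Lemma is_derive1B : is_derive x 1 (fun x => f x - g x) (a - b).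
Proof. exact: is_deriveB. Qed.

Lemma is_derive1M : is_derive x 1 (fun x => f x * g x) (a * g x + f x * b).
Proof.
apply: (is_derive_eq (is_deriveM df dg)).
by rewrite addrC [a * _]mulrC.
Qed.

Lemma is_derive1V : f x != 0 -> is_derive x 1 (fun x => (f x)^-1) (- a / f x ^+ 2).
Proof.
move=> fx0; apply: (is_derive_eq (is_deriveV fx0 df)).
by rewrite /GRing.scale /= !mulNr mulrC.
Qed.

Lemma is_derive1_Rsqrt : 0 < f x ->
  is_derive x 1 (fun x => Num.sqrt (f x)) (a / (2 * Num.sqrt (f x))).
Proof.
move=> fx0; apply: is_derive_eq.
  by apply: (is_derive1_comp (f := Num.sqrt)); exact: is_derive1_sqrt.
by rewrite mulrC.
Qed.

End derive_rules.

Lemma is_derive1_sqr x : is_derive x 1 (fun x : R => x ^+ 2) (2 * x).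
Proof.
have -> : (fun x : R => x ^+ 2) = (fun x => x * x) by apply/funext => z; rewrite expr2.
have d := is_derive_id x (1 : R).
by apply: (is_derive_eq (is_derive1M d d)) => /=; ring.
Qed.

(** With y = sin a and s = cos a one has y / (1 + s) = tan(a/2); in the computation s is kept as a
    variable subject to s^2 = 1 - y^2. *)
Lemma is_derive_arcsine y : -1 < y < 1 ->
  is_derive y 1 arcsine (Num.sqrt (1 - y ^+ 2))^-1.
Proof.
move=> /andP[y1 y2]; have s2 : 0 < 1 - y ^+ 2 by nra.
set s := Num.sqrt (1 - y ^+ 2); have s0 : 0 < s by rewrite sqrtr_gt0.
have sE : s ^+ 2 = 1 - y ^+ 2 by rewrite sqr_sqrtr// ltW.
have ds := is_derive1_Rsqrt
  (is_derive1B (is_derive_cst (1 : R) y 1) (is_derive1_sqr y)) s2.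
have n0 : 1 + Num.sqrt (1 - y ^+ 2) != 0 by rewrite gt_eqF.
have dq := is_derive1M (is_derive_id y (1 : R))
  (is_derive1V (is_derive1D (is_derive_cst (1 : R) y 1) ds) n0).
have da := is_derive1_comp (is_derive1_atan _) dq.
apply: (is_derive_eq (is_derive1M (is_derive_cst (2 : R) y (1 : R)) da)).
rewrite /= -/s.
have s10 : 1 + s != 0 by rewrite gt_eqF// addr_gt0.
have D0 : (1 + s) ^+ 2 + y ^+ 2 != 0.
  by rewrite gt_eqF// ltr_wpDr ?sqr_ge0// exprn_gt0// addr_gt0.
have sn0 : s != 0 by rewrite gt_eqF.
have yE : y ^+ 2 = 1 - s ^+ 2 by rewrite sE; ring.
have E1 : (1 + (y / (1 + s)) ^+ 2)^-1 = (1 + s) / 2.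
  rewrite expr_div_n yE.
  have -> : 1 + (1 - s ^+ 2) / (1 + s) ^+ 2 = 2 / (1 + s) by field.
  by rewrite invf_div.
rewrite E1; apply: (mulfI (x := s)) => //; rewrite mulfV//.
have -> : s * (0 * atan (y / (1 + s)) +
   2 * ((1 + s) / 2 * (1 / (1 + s) + y * (- (0 + (0 - 2 * y) / (2 * s)) / (1 + s) ^+ 2)))) =
  s + y ^+ 2 / (1 + s).
  by field; rewrite ?sn0 ?s10.
by rewrite yE; field.
Qed.

Lemma arcsine1 : arcsine 1 = pi / 2.
Proof. by rewrite /arcsine expr1n subrr sqrtr0 addr0 divr1 atan1; field. Qed.

Lemma arcsineN y : arcsine (- y) = - arcsine y.
Proof. by rewrite /arcsine sqrrN mulNr atanN mulrN. Qed.

Definition semicircle_weight x : R := (2 * pi)^-1 * Num.sqrt (4 - x ^+ 2).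

Lemma continuous_semicircle_weight : continuous semicircle_weight.
Proof.
have cs : continuous (fun z : R => Num.sqrt (4 - z ^+ 2)).
  apply: continuous_sqrt_comp => z; apply: cvgB; first exact: cvg_cst.
  exact: exprn_continuous.
by move=> x; apply: cvgM; [exact: cvg_cst|exact: cs].
Qed.

Let pi_neq0 : pi != 0 :> R. Proof. by rewrite gt_eqF// pi_gt0. Qed.

Lemma integral_semicircle_weight :
  (\int[mu]_(x in `[(-2)%R, 2%R]) (semicircle_weight x)%:E = 1)%E.
Proof.
pose F x : R := (2 * pi)^-1 * (x * Num.sqrt (4 - x ^+ 2) * 2^-1 + 2 * arcsine (x * 2^-1)).
have cs : continuous (fun z : R => Num.sqrt (4 - z ^+ 2)).
  apply: continuous_sqrt_comp => z; apply: cvgB; first exact: cvg_cst.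
  exact: exprn_continuous.
have ch : continuous (fun z : R => z * 2^-1).
  by move=> z; apply: cvgM; [exact: cvg_id|exact: cvg_cst].
have cF : continuous F.
  move=> x; apply: cvgM; first exact: cvg_cst.
  apply: cvgD.
    by apply: cvgM; [apply: cvgM; [exact: cvg_id|exact: cs]|exact: cvg_cst].
  apply: cvgM; first exact: cvg_cst.
  apply: (@continuous_comp _ _ _ (fun z : R => z * 2^-1) arcsine); first exact: ch.
  exact: continuous_arcsine.
transitivity (F 2 - F (-2))%:E%E.
  apply: FTC2_continuous continuous_semicircle_weight cF _; first by lra.
  move=> x /andP[x1 x2]; have s2 : 0 < 4 - x ^+ 2 by nra.
  set s := Num.sqrt (4 - x ^+ 2); have s0 : 0 < s by rewrite sqrtr_gt0.
  have sE : s ^+ 2 = 4 - x ^+ 2 by rewrite sqr_sqrtr// ltW.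
  have xE : x ^+ 2 = 4 - s ^+ 2 by rewrite sE; ring.
  have ds := is_derive1_Rsqrt
    (is_derive1B (is_derive_cst (4 : R) x (1 : R)) (is_derive1_sqr x)) s2.
  have dh := is_derive1M (is_derive_id x (1 : R)) (is_derive_cst (2^-1 : R) x (1 : R)).
  have x2' : -1 < x * 2^-1 < 1 by apply/andP; split; lra.
  have da := is_derive1_comp (g := fun z : R => z * 2^-1) (is_derive_arcsine x2') dh.
  have d1 := is_derive1M (is_derive1M (is_derive_id x (1 : R)) ds)
    (is_derive_cst (2^-1 : R) x (1 : R)).
  have d2 := is_derive1M (is_derive_cst (2 : R) x (1 : R)) da.
  have d3 := is_derive1M (is_derive_cst ((2 * pi)^-1 : R) x (1 : R)) (is_derive1D d1 d2).
  apply: (is_derive_eq d3); rewrite /= /semicircle_weight -/s.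
  have -> : Num.sqrt (1 - (x * 2^-1) ^+ 2) = s / 2.
    have -> : 1 - (x * 2^-1) ^+ 2 = (s / 2) ^+ 2 by rewrite !exprMn sE; field.
    by rewrite sqrtr_sqr ger0_norm// divr_ge0// ltW.
  rewrite mul0r add0r; congr (_ * _).
  have sn0 : s != 0 by rewrite gt_eqF.
  apply: (mulfI (x := s)) => //.
  transitivity (s ^+ 2 / 2 - x ^+ 2 / 2 + 2); first by field.
  by rewrite xE; field.
have E1 : 2 * 2^-1 = 1 :> R by rewrite mulfV.
rewrite /F sqrrN !mulNr E1 !arcsineN arcsine1.
rewrite (_ : 4 - 2 ^+ 2 = 0 :> R); last by ring.
by rewrite sqrtr0; congr EFin; move: pi_neq0; generalize (pi : R) => w w0; field.
Qed.

Lemma integral_semicircle_even (eta : R) : 0 < eta ->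
  (\int[mu]_(x in `[(-2)%R, 2%R])
     (semicircle_weight x * (x ^+ 2 + eta ^+ 2)^-1)%:E =
   ((Num.sqrt (eta ^+ 2 + 4) - eta) / (2 * eta))%:E)%E.
Proof.
move=> eta0; set K := Num.sqrt (eta ^+ 2 + 4).
have K0 : 0 < K by rewrite sqrtr_gt0 ltr_wpDl// sqr_ge0.
have KE : K ^+ 2 = eta ^+ 2 + 4 by rewrite sqr_sqrtr// addr_ge0// sqr_ge0.
have q20 (x : R) : 0 < x ^+ 2 + eta ^+ 2 by rewrite ltr_wpDl ?sqr_ge0// exprn_gt0.
pose q x : R := Num.sqrt (x ^+ 2 + eta ^+ 2).
have q0 (x : R) : 0 < q x by rewrite sqrtr_gt0.
have qE (x : R) : q x ^+ 2 = x ^+ 2 + eta ^+ 2 by rewrite sqr_sqrtr// ltW.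
(* The natural antiderivative contains arctan(K x / (eta sqrt(4 - x^2))); rewriting it as the
   arcsine of [ph x] removes the singularities at the endpoints, where [ph] is 1 or -1. *)
pose ph x : R := x * (K / 2) * (q x)^-1.
pose F x : R := (2 * pi)^-1 * (K / eta * arcsine (ph x) - arcsine (x * 2^-1)).
have c2 : continuous (fun z : R => z ^+ 2 + eta ^+ 2).
  by move=> z; apply: cvgD; [exact: exprn_continuous|exact: cvg_cst].
have cq : continuous q by exact: continuous_sqrt_comp.
have ch : continuous (fun z : R => z * 2^-1).
  by move=> z; apply: cvgM; [exact: cvg_id|exact: cvg_cst].
have cph : continuous ph.
  move=> z; apply: cvgM; first by apply: cvgM; [exact: cvg_id|exact: cvg_cst].
  by apply: cvgV; [rewrite gt_eqF|exact: cq].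
have cF : continuous F.
  move=> x; apply: cvgM; first exact: cvg_cst.
  apply: cvgB.
    apply: cvgM; first exact: cvg_cst.
    apply: (@continuous_comp _ _ _ ph arcsine); first exact: cph.
    exact: continuous_arcsine.
  apply: (@continuous_comp _ _ _ (fun z : R => z * 2^-1) arcsine); first exact: ch.
  exact: continuous_arcsine.
have cf : continuous (fun x => semicircle_weight x * (x ^+ 2 + eta ^+ 2)^-1).
  move=> x; apply: cvgM; first exact: continuous_semicircle_weight.
  by apply: cvgV; [rewrite gt_eqF|exact: c2].
transitivity (F 2 - F (-2))%:E%E.
  apply: FTC2_continuous cf cF _; first by lra.
  move=> x /andP[x1 x2]; have s2 : 0 < 4 - x ^+ 2 by nra.
  set s := Num.sqrt (4 - x ^+ 2); have s0 : 0 < s by rewrite sqrtr_gt0.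
  have sE : s ^+ 2 = 4 - x ^+ 2 by rewrite sqr_sqrtr// ltW.
  have xE : x ^+ 2 = 4 - s ^+ 2 by rewrite sE; ring.
  have dh := is_derive1M (is_derive_id x (1 : R)) (is_derive_cst (2^-1 : R) x (1 : R)).
  have x2' : -1 < x * 2^-1 < 1 by apply/andP; split; lra.
  have da := is_derive1_comp (g := fun z : R => z * 2^-1) (is_derive_arcsine x2') dh.
  have dq := is_derive1_Rsqrt
    (is_derive1D (is_derive1_sqr x) (is_derive_cst (eta ^+ 2 : R) x (1 : R))) (q20 x).
  have qn0 : q x != 0 by rewrite gt_eqF.
  have dph := is_derive1M (is_derive1M (is_derive_id x (1 : R))
    (is_derive_cst (K / 2 : R) x (1 : R))) (is_derive1V dq qn0).
  have rE : 1 - ph x ^+ 2 = (eta * s / (2 * q x)) ^+ 2.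
    by rewrite /ph !(exprMn, exprVn) qE sE KE; field; rewrite gt_eqF.
  have r0 : 0 < eta * s / (2 * q x) by rewrite divr_gt0// mulr_gt0.
  have ph1 : -1 < ph x < 1.
    have : 0 < 1 - ph x ^+ 2 by rewrite rE exprn_gt0.
    by move=> h; apply/andP; split; nra.
  have dp := is_derive1_comp (g := ph) (is_derive_arcsine ph1) dph.
  have d2 := is_derive1M (is_derive_cst (K / eta : R) x (1 : R)) dp.
  have d3 := is_derive1M (is_derive_cst ((2 * pi)^-1 : R) x (1 : R)) (is_derive1B d2 da).
  apply: (is_derive_eq d3); rewrite /= /semicircle_weight -/s.
  rewrite -/(q x) -/(ph x) rE sqrtr_sqr ger0_norm ?(ltW r0)//.
  have -> : Num.sqrt (1 - (x * 2^-1) ^+ 2) = s / 2.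
    have -> : 1 - (x * 2^-1) ^+ 2 = (s / 2) ^+ 2 by rewrite !exprMn sE; field.
    by rewrite sqrtr_sqr ger0_norm// divr_ge0// ltW.
  rewrite mul0r add0r -[RHS]mulrA; congr (_ * _).
  have sn0 : s != 0 by rewrite gt_eqF.
  have en0 : eta != 0 by rewrite gt_eqF.
  rewrite -qE; apply: (mulfI (x := s)) => //; apply: (mulfI (x := q x ^+ 2)).
    by rewrite expf_neq0.
  transitivity (K ^+ 2 / eta ^+ 2 * (q x ^+ 2 - x ^+ 2) - q x ^+ 2).
    by field; rewrite sn0 en0 qn0.
  rewrite qE KE; transitivity (4 - x ^+ 2); first by field.
  by rewrite -sE -qE; field.
have E1 : 2 * 2^-1 = 1 :> R by rewrite mulfV.
have qq : q 2 = K by rewrite /q /K; congr Num.sqrt; ring.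
have qn : q (-2) = K by rewrite /q sqrrN; exact: qq.
have p2 : ph 2 = 1 by rewrite /ph qq; field; rewrite gt_eqF.
have pn : ph (-2) = -1 by rewrite /ph qn; field; rewrite gt_eqF.
rewrite /F p2 pn !mulNr E1 !arcsineN arcsine1.
congr EFin; move: pi_neq0; generalize (pi : R) => w w0; field.
by rewrite w0 gt_eqF.
Qed.

Lemma integral_semicircle_odd (eta : R) : 0 < eta ->
  (\int[mu]_(x in `[(-2)%R, 2%R])
     (semicircle_weight x * (x * (x ^+ 2 + eta ^+ 2)^-1))%:E = 0)%E.
Proof.
move=> eta0.
have q20 (x : R) : 0 < x ^+ 2 + eta ^+ 2 by rewrite ltr_wpDl ?sqr_ge0// exprn_gt0.
have cf : continuous (fun x => semicircle_weight x * (x * (x ^+ 2 + eta ^+ 2)^-1)).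
  move=> x; apply: cvgM; first exact: continuous_semicircle_weight.
  apply: cvgM; first exact: cvg_id.
  apply: cvgV; first by rewrite gt_eqF.
  by apply: cvgD; [exact: exprn_continuous|exact: cvg_cst].
pose f0 x := semicircle_weight x * (x * (x ^+ 2 + eta ^+ 2)^-1).
have fN x : f0 (- x) = - f0 x.
  by rewrite /f0 /semicircle_weight sqrrN; ring.
have fint : mu.-integrable `[(-2)%R, 2%R] (EFin \o f0).
  apply: continuous_compact_integrable; first exact: segment_compact.
  exact: continuous_subspaceT.
set I := (\int[mu]_(x in _) _)%E.
have IE : I = (\int[mu]_(x in `[(-2)%R, 2%R]) (- (f0 x)%:E))%E.
  have := @integration_by_substitution_oppr R f0 (-2) 2.
  rewrite opprK => h; rewrite -[LHS]/(\int[mu]_(x in `[(-2)%R, 2%R]) (f0 x)%:E)%E.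
  rewrite h; [|lra|exact: continuous_subspaceT].
  by apply: eq_integral => x _; rewrite /= fN EFinN.
(* Finiteness is what allows I = - I to be solved. *)
have Ifin : I \is a fin_num by apply: integrable_fin_num.
have : I = (- I)%E.
  rewrite {1}IE integralN//.
  exact: integrable_add_def.
move: Ifin; clear IE; case: I => // r _ [] rr; congr EFin; lra.
Qed.

End SemicircleCalculus.

(** * The semicircle law as a probability measure *)

Section SemicircleLaw.
Variable R : realType.
Local Notation mu := (@lebesgue_measure R).

Lemma semicircle_pdf_patch (x : R) :
  semicircle_pdf x = ((@semicircle_weight R) \_ `[(-2), 2]) x.
Proof.
rewrite /semicircle_pdf patchE indicE /semicircle_weight.
by case: (x \in _); rewrite ?mulr1 ?mulr0.
Qed.

Lemma semicircle_law_setT : semicircle_law [set: measurableTypeR R] = 1%E.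
Proof.
rewrite /semicircle_law -(integral_semicircle_weight R) [RHS]integral_mkcond.
apply: eq_integral => x _; rewrite semicircle_pdf_patch !patchE.
by case: (x \in _).
Qed.

HB.instance Definition _ :=
  Measure_isProbability.Build _ _ R (@semicircle_law R) semicircle_law_setT.

Lemma semicircle_law_dominated : @semicircle_law R `<< mu.
Proof.
apply/null_content_dominatesP => A mA muA0.
by rewrite /semicircle_law null_set_integral//; apply/measurable_EFinP;
  apply: measurable_funTS; exact: measurable_semicircle_pdf.
Qed.

Definition bounded_continuous (f : R -> R) :=
  continuous f /\ exists C, forall x, `|f x| <= C.

Lemma bounded_continuous_integrable (m : probability (measurableTypeR R) R)
    (f : R -> R) : bounded_continuous f -> m.-integrable setT (EFin \o f).
Proof.
move=> [cf [C fC]].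
have mf : measurable_fun [set: measurableTypeR R] f.
  exact: continuous_measurable_fun.
apply: measurable_bounded_integrable => //.
- by apply: (le_lt_trans (probability_le1 m measurableT)); exact: ltry.
- exists C; split; first by rewrite num_real.
  by move=> y Cy x _; apply: le_trans (fC x) (ltW Cy).
Qed.

(** The law is given by its values on sets; integrals against it are transferred through its
    Radon-Nikodym derivative, which agrees almost everywhere with the density. *)
Lemma integral_semicircle_law (f : R -> R) : bounded_continuous f ->
  (\int[@semicircle_law R]_x (f x)%:E =
   \int[mu]_(x in `[(-2)%R, 2%R]) (semicircle_weight x * f x)%:E)%E.
Proof.
move=> bf; have fi := bounded_continuous_integrable (@semicircle_law R) bf.
have mf : measurable_fun [set: measurableTypeR R] (EFin \o f).
  exact: measurable_int fi.
have mpdf : measurable_fun [set: measurableTypeR R] (EFin \o (@semicircle_pdf R)).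
  by apply/measurable_EFinP; exact: measurable_semicircle_pdf.
transitivity (\int[mu]_x ((f x)%:E * (semicircle_pdf x)%:E))%E; last first.
  rewrite [RHS]integral_mkcond; apply: eq_integral => x _.
  rewrite semicircle_pdf_patch !patchE; case: (x \in _).
    by rewrite mulrC.
  by rewrite mule0.
rewrite -(Radon_Nikodym_change_of_variables semicircle_law_dominated)//.
apply: ae_eq_integral => //.
- apply: emeasurable_funM => //; apply: (measurable_int mu).
  by apply: Radon_Nikodym_integrable; exact: semicircle_law_dominated.
- exact: emeasurable_funM.
- apply: ae_eqe_mul2l => /=.
  rewrite Radon_NikodymE//=; first exact: semicircle_law_dominated.
  move=> dom; case: cid => /= h [h1 h2 h3].
  apply: integral_ae_eq => //=.
  by move=> E _ mE; rewrite -h3.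
Qed.

Definition semicircle_mean (f : R -> R) : R :=
  (\int[@semicircle_law R]_x f x)%R.

Lemma semicircle_meanE (f : R -> R) : bounded_continuous f ->
  (\int[@semicircle_law R]_x (f x)%:E = (semicircle_mean f)%:E)%E.
Proof.
move=> bf; rewrite /semicircle_mean /Rintegral fineK//.
exact: integrable_fin_num (bounded_continuous_integrable _ bf).
Qed.

Lemma semicircle_meanD (f g : R -> R) :
  bounded_continuous f -> bounded_continuous g ->
  semicircle_mean (fun x => f x + g x) = semicircle_mean f + semicircle_mean g.
Proof.
by move=> bf bg; rewrite /semicircle_mean RintegralD//;
  exact: bounded_continuous_integrable.
Qed.

Lemma semicircle_meanZ (f : R -> R) c : bounded_continuous f ->
  semicircle_mean (fun x => c * f x) = c * semicircle_mean f.
Proof.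
by move=> bf; rewrite /semicircle_mean RintegralZl//;
  exact: bounded_continuous_integrable.
Qed.

Lemma le_semicircle_mean (f g : R -> R) :
  bounded_continuous f -> bounded_continuous g -> (forall x, f x <= g x) ->
  semicircle_mean f <= semicircle_mean g.
Proof.
move=> bf bg fg; apply: le_Rintegral => //; exact: bounded_continuous_integrable.
Qed.

Lemma semicircle_mean_cst (c : R) : semicircle_mean (fun=> c) = c.
Proof.
have bc : bounded_continuous (fun=> c).
  by split; [exact: cst_continuous|exists `|c|].
apply: EFin_inj; rewrite -semicircle_meanE// integral_cst//.
by rewrite -[RHS]mule1; congr (_ * _)%E; exact: semicircle_law_setT.
Qed.

Lemma semicircle_mean_support (f g : R -> R) :
  bounded_continuous f -> bounded_continuous g ->
  (forall x, -2 <= x <= 2 -> f x = g x) -> semicircle_mean f = semicircle_mean g.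
Proof.
move=> bf bg fg; apply: EFin_inj; rewrite -!semicircle_meanE//.
rewrite !integral_semicircle_law//; apply: eq_integral => x.
by rewrite inE /= in_itv /= => xI; rewrite fg.
Qed.

End SemicircleLaw.

(** * Weak convergence from Cauchy kernels *)

Section Weierstrass.
Variable R : realType.

(** Compactness in near-covering form, the radii being filtered along 0+. Only [x] ranges over the
    interval; [y] is arbitrary. *)
Lemma heine_cantor_unit (F : R -> R) (e : R) : continuous F -> 0 < e ->
  exists2 de : R, 0 < de & forall x y, 0 <= x <= 1 -> `|x - y| < de ->
    `|F x - F y| < e.
Proof.
move=> cF e0.
have e20 : 0 < e / 2 by rewrite divr_gt0.
have /compact_near_coveringP := @segment_compact R 0 1.
move=> /(_ _ (0 : R)^'+ (fun de x => forall y, `|x - y| < de -> `|F x - F y| < e) _).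
case.
  move=> x _; have /cvgrPdist_lt /(_ _ e20) := cF x.
  move=> -[r /= r0 rF].
  exists ([set y | `|x - y| < r / 2], [set de | de < r / 2]) => /=.
    split; first by exists (r / 2) => //=; rewrite divr_gt0.
    by apply: nbhs_right_lt; rewrite divr_gt0.
  move=> [y de] /= [xy de2] z yz.
  have xz : `|x - z| < r.
    rewrite -(subrKA y); apply: le_lt_trans (ler_normD _ _) _.
    by rewrite [r]splitr ltrD// (lt_trans yz).
  have h1 := rF z xz.
  have h2 : `|F x - F y| < e / 2 by apply: rF; apply: lt_trans xy _; rewrite ltr_pdivrMr// ltr_pMr// ltr1n.
  rewrite -(subrKA (F x)); apply: le_lt_trans (ler_normD _ _) _.
  by rewrite [e]splitr ltrD// distrC.
move=> de /= de0 H.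
exists (de / 2); first by rewrite divr_gt0.
move=> x y x01 xy; apply: (H (de / 2)) => //=; last by rewrite divr_gt0.
rewrite sub0r normrN ger0_norm ?divr_ge0 ?(ltW de0)//.
by rewrite ltr_pdivrMr// ltr_pMr// ltr1n.
Qed.

(** The source of the approximating polynomials: for a function of the sample mean, these are
    Bernstein polynomials in the Bernoulli parameter. *)
Lemma bexp_poly (Q : finType) (l : seq Q) (f : {ffun Q -> bool} -> R) S :
  exists q : {poly R}, forall t, bexp t l f S = q.[t].
Proof.
elim: l S => [|s l IH] S /=; first by exists (f S)%:P => t; rewrite hornerC.
have [q1 h1] := IH (upd S s true); have [q0 h0] := IH (upd S s false).
by exists ('X * q1 + (1 - 'X) * q0) => t; rewrite /avg1 h1 h0 !hornerE.
Qed.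

Lemma bexp_coord (Q : finType) (l : seq Q) (t : R) s S : s \in l ->
  bexp t l (fun T => (T s)%:R) S = t.
Proof.
move=> sl; have := @bexp_stein Q R t l s (fun=> 1) S sl.
rewrite (_ : diff1 s _ = fun=> 0); last by apply/funext => T; rewrite /diff1 subrr.
rewrite bexp_cst mulr0.
have -> : (fun T : {ffun Q -> bool} => ((T s)%:R - t) * 1) = (fun T => (T s)%:R - t).
  by apply/funext => T; rewrite mulr1.
by rewrite bexpB bexp_cst => /eqP; rewrite subr_eq0 => /eqP.
Qed.

(** Bernstein's proof: q(t) is the expectation of F(mean) under the Bernoulli(t) product law, and
    the mean of n + 1 variables has variance at most 1/(n + 1) around t, again by Efron-Stein. *)
Lemma weierstrass_unit (F : R -> R) (K e : R) : continuous F ->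
  (forall x, `|F x| <= K) -> 0 < e ->
  exists q : {poly R}, forall t, 0 <= t <= 1 -> `|F t - q.[t]| <= e.
Proof.
move=> cF FK e0.
have K0 : 0 <= K by apply: le_trans (FK 0).
have e20 : 0 < e / 2 by rewrite divr_gt0.
have [de de0 Fde] := heine_cantor_unit cF e20.
have [n nE] : exists n, 2 * K / de ^+ 2 / n.+1%:R <= e / 2.
  exists (Num.truncn (2 * K / de ^+ 2 / (e / 2))).
  rewrite ler_pdivrMr// [leRHS]mulrC -ler_pdivrMr//.
  by apply: ltW; apply: truncnS_gt.
pose l := enum 'I_n.+1.
pose mean (S : {ffun 'I_n.+1 -> bool}) : R := n.+1%:R^-1 * \sum_i (S i)%:R.
have [q qE] := bexp_poly l (F \o mean) [ffun=> false].
exists q => t t01; rewrite -qE.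
have meanE : bexp t l mean [ffun=> false] = t.
  rewrite bexpZ bexp_sum (eq_bigr (fun=> t)); last first.
    by move=> i _; rewrite bexp_coord// mem_enum.
  by rewrite sumr_const card_ord -[t *+ _]mulr_natl mulKf// pnatr_eq0.
have varE : bexp t l (fun S => (mean S - t) ^+ 2) [ffun=> false] <= n.+1%:R^-1.
  rewrite -{2}meanE variance_bexp.
  apply: le_trans (efron_stein t01 _ _ (enum_uniq _)) _.
  apply: le_trans (_ : \sum_(i <- l) n.+1%:R^-1 ^+ 2 <= _); last first.
    rewrite sum_cst_seq size_enum_ord -[_ *+ _]mulr_natl expr2 mulrA.
    by rewrite mulfV ?mul1r// pnatr_eq0.
  rewrite !big_seq; apply: ler_sum => i il.
  rewrite (_ : (fun T => diff1 i mean T ^+ 2) = (fun=> n.+1%:R^-1 ^+ 2)).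
    rewrite bexp_cst ler_piMl ?sqr_ge0//.
    by case/andP: t01 => t0 t1; nra.
  apply/funext => T; congr (_ ^+ 2); rewrite /diff1 /mean -mulrBr -sumrB.
  rewrite (bigD1 i)//= big1 => [|j ji]; last by rewrite !ffunE (negbTE ji) subrr.
  by rewrite !ffunE eqxx addr0 subr0 mulr1.
have -> : F t - bexp t l (F \o mean) [ffun=> false] =
    bexp t l (fun S => F t - F (mean S)) [ffun=> false].
  by rewrite bexpB bexp_cst.
(* Chebyshev's inequality in pointwise form: for |mean - t| >= de the second term is at least the
   trivial bound 2 K. *)
have bnd S : `|F t - F (mean S)| <= e / 2 + 2 * K / de ^+ 2 * (mean S - t) ^+ 2.
  have X0 : 0 <= 2 * K / de ^+ 2 * (mean S - t) ^+ 2.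
    apply: mulr_ge0; last exact: sqr_ge0.
    by apply: divr_ge0; [exact: mulr_ge0|exact: sqr_ge0].
  have [tS|tS] := ltrP (`|t - mean S|) de.
    by apply: ler_wpDr => //; apply: ltW; apply: Fde.
  apply: le_trans (_ : 2 * K <= _).
    by apply: le_trans (ler_normB _ _) _; have := FK t; have := FK (mean S); lra.
  apply: ler_wpDl; first exact: ltW.
  rewrite -[leLHS]mulr1 -[leRHS]mulrA ler_wpM2l ?mulr_ge0//.
  rewrite ler_pdivlMl ?exprn_gt0// mulr1.
  rewrite -[leRHS]real_normK ?num_real// distrC lerXn2r// nnegrE ltW//.
have -> : e = bexp t l (fun=> e / 2) [ffun=> false] + e / 2.
  by rewrite bexp_cst -splitr.
apply: le_trans (_ : bexp t l (fun S => `|F t - F (mean S)|) [ffun=> false] <= _).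
  exact: normr_bexp.
apply: le_trans (ler_bexp t01 _ _ bnd) _.
rewrite bexpD lerD2l; apply: le_trans nE.
by rewrite bexpZ ler_wpM2l//; apply: divr_ge0; [exact: mulr_ge0|exact: sqr_ge0].
Qed.

End Weierstrass.

Section BoundedContinuous.
Variable R : realType.
Implicit Types f g : R -> R.

Lemma bounded_continuous_cst (c : R) : bounded_continuous (fun=> c).
Proof. by split; [exact: cst_continuous|exists `|c|]. Qed.

Lemma bounded_continuousD f g : bounded_continuous f -> bounded_continuous g ->
  bounded_continuous (fun x => f x + g x).
Proof.
move=> [cf [C fC]] [cg [D gD]]; split; first by move=> x; apply: cvgD; [exact: cf|exact: cg].
by exists (C + D) => x; apply: le_trans (ler_normD _ _) _; exact: lerD.
Qed.

Lemma bounded_continuousM f g : bounded_continuous f -> bounded_continuous g ->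
  bounded_continuous (fun x => f x * g x).
Proof.
move=> [cf [C fC]] [cg [D gD]]; split; first by move=> x; apply: cvgM; [exact: cf|exact: cg].
by exists (C * D) => x; rewrite normrM ler_pM.
Qed.

Lemma bounded_continuousZ c f : bounded_continuous f ->
  bounded_continuous (fun x => c * f x).
Proof. exact: bounded_continuousM (bounded_continuous_cst c). Qed.

Lemma semicircle_mean_close f g (e : R) : bounded_continuous f ->
  bounded_continuous g -> (forall x, `|f x - g x| <= e) ->
  `|semicircle_mean f - semicircle_mean g| <= e.
Proof.
move=> bf bg fg; have be := bounded_continuous_cst e.
have h1 : semicircle_mean f <= semicircle_mean g + e.
  rewrite -[X in _ + X]semicircle_mean_cst -semicircle_meanD//.
  apply: le_semicircle_mean => //; first exact: bounded_continuousD.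
  by move=> x; have := fg x; rewrite ler_norml => /andP[_]; lra.
have h2 : semicircle_mean g <= semicircle_mean f + e.
  rewrite -[X in _ + X]semicircle_mean_cst -semicircle_meanD//.
  apply: le_semicircle_mean => //; first exact: bounded_continuousD.
  by move=> x; have := fg x; rewrite ler_norml => /andP[+ _]; lra.
by rewrite ler_norml; apply/andP; split; lra.
Qed.

Definition list_mean (s : seq R) f : R := (size s)%:R^-1 * \sum_(x <- s) f x.

Lemma list_meanD s f g :
  list_mean s (fun x => f x + g x) = list_mean s f + list_mean s g.
Proof. by rewrite /list_mean big_split mulrDr. Qed.

Lemma list_meanZ s f c : list_mean s (fun x => c * f x) = c * list_mean s f.
Proof. by rewrite /list_mean -mulr_sumr mulrCA. Qed.

Lemma list_mean_cst s (c : R) : (0 < size s)%N -> list_mean s (fun=> c) = c.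
Proof.
move=> s0; rewrite /list_mean sum_cst_seq -[c *+ _]mulr_natl mulKf//.
by rewrite pnatr_eq0 -lt0n.
Qed.

Lemma ler_list_mean s f g : (forall x, f x <= g x) -> list_mean s f <= list_mean s g.
Proof.
by move=> fg; rewrite /list_mean ler_wpM2l ?invr_ge0//; apply: ler_sum => x _.
Qed.

Lemma list_mean_close s f g (e : R) : (forall x, `|f x - g x| <= e) ->
  `|list_mean s f - list_mean s g| <= e.
Proof.
move=> fg; have e0 : 0 <= e by apply: le_trans (fg 0).
rewrite /list_mean -mulrBr -sumrB normrM ger0_norm ?invr_ge0//.
have [->|s0] := eqVneq (size s) 0%N; first by rewrite invr0 mul0r.
rewrite ler_pdivrMl ?ltr0n ?lt0n//.
apply: le_trans (ler_norm_sum _ _ _) _.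
rewrite mulr_natl -sum_cst_seq; exact: ler_sum.
Qed.

End BoundedContinuous.

Section WeakConvergence.
Variables (R : realType) (L : nat -> seq R).
Implicit Types f g : R -> R.

Definition mean_cvg f := bounded_continuous f /\
  list_mean (L n) f @[n --> \oo] --> semicircle_mean f.

Lemma mean_cvg_lin f g a b : mean_cvg f -> mean_cvg g ->
  mean_cvg (fun x => a * f x + b * g x).
Proof.
move=> [bf cf] [bg cg]; split.
  by apply: bounded_continuousD; exact: bounded_continuousZ.
rewrite semicircle_meanD ?semicircle_meanZ//; try exact: bounded_continuousZ.
under eq_fun do rewrite list_meanD !list_meanZ.
by apply: cvgD; apply: cvgM => //; exact: cvg_cst.
Qed.

Lemma mean_cvg_approx f : bounded_continuous f ->
  (forall e, 0 < e -> exists2 g, mean_cvg g & forall x, `|f x - g x| <= e) ->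
  mean_cvg f.
Proof.
move=> bf fg; split=> //; apply/cvgrPdist_le => e e0.
have e30 : 0 < e / 3 by rewrite divr_gt0.
have [g [bg cg] fge] := fg _ e30.
have /cvgrPdist_le /(_ _ e30) := cg; apply: filterS => n hn.
have h1 := semicircle_mean_close bf bg fge.
have h2 := list_mean_close (L n) fge.
rewrite -(subrKA (semicircle_mean g)); apply: le_trans (ler_normD _ _) _.
rewrite -[semicircle_mean g - _](subrKA (list_mean (L n) g)).
have := ler_normD (semicircle_mean g - list_mean (L n) g)
  (list_mean (L n) g - list_mean (L n) f).
by rewrite [X in _ <= _ + X -> _]distrC; lra.
Qed.

(** Since 1/(x - i eta) = (x + i eta)/(x^2 + eta^2), this is the real part for [true], and the
    imaginary part divided by eta for [false]. *)
Definition cauchy_fun (b : bool) (eta x : R) : R :=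
  (if b then x else 1) * (x ^+ 2 + eta ^+ 2)^-1.

Hypothesis L0 : \forall n \near \oo, (0 < size (L n))%N.
Hypothesis Lcauchy : forall b (q : rat), 0 <= q -> mean_cvg (cauchy_fun b (3 + ratr q)).

Lemma mean_cvg_cst c : mean_cvg (fun=> c).
Proof.
split; first exact: bounded_continuous_cst.
rewrite semicircle_mean_cst; apply: (cvg_trans _ (@cvg_cst _ c _ \oo _)).
apply: near_eq_cvg; apply: filterS L0 => n n0.
by rewrite list_mean_cst.
Qed.

Definition cauchy_prod (l : seq (bool * rat)) (x : R) : R :=
  \prod_(i <- l) cauchy_fun i.1 (3 + ratr i.2) x.

Let eta_ge3 (q : rat) : 0 <= q -> 3 <= 3 + ratr q :> R.
Proof. by move=> q0; rewrite lerDl ler0q. Qed.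

Lemma cauchy_den_gt0 (eta x : R) : 3 <= eta -> 0 < x ^+ 2 + eta ^+ 2.
Proof. by move=> e3; rewrite ltr_wpDl ?sqr_ge0// exprn_gt0//; lra. Qed.

Lemma normr_cauchy_fun b (eta x : R) : 3 <= eta -> `|cauchy_fun b eta x| <= 1.
Proof.
move=> e3; have D0 := cauchy_den_gt0 x e3.
rewrite /cauchy_fun normrM [X in _ * X]ger0_norm ?invr_ge0 ?(ltW D0)//.
have eta9 : 9 <= eta ^+ 2 by nra.
rewrite ler_pdivrMr// mul1r; case: b; last first.
  by rewrite normr1; have := sqr_ge0 x; lra.
have h1 := sqr_ge0 (x - 1); have h2 := sqr_ge0 (x + 1); rewrite !expr2 in h1 h2 eta9 *.
by have [x0|x0] := ger0P x; nra.
Qed.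

Lemma cauchy_fun_lipschitz b (eta de x : R) : 3 <= eta -> 0 <= de ->
  `|cauchy_fun b eta x - cauchy_fun b (eta + de) x| <= de.
Proof.
move=> e3 de0; have e3' : 3 <= eta + de by lra.
have D0 := cauchy_den_gt0 x e3; have D0' := cauchy_den_gt0 x e3'.
have -> : cauchy_fun b eta x - cauchy_fun b (eta + de) x =
    de * (cauchy_fun b eta x * ((eta + (eta + de)) / (x ^+ 2 + (eta + de) ^+ 2))).
  by rewrite /cauchy_fun; case: b; field; rewrite !gt_eqF.
rewrite normrM ger0_norm// ler_piMr// normrM.
rewrite -[leRHS]mulr1 ler_pM ?normr_cauchy_fun//.
rewrite ger0_norm; last by rewrite divr_ge0 ?(ltW D0')//; lra.
by rewrite ler_pdivrMr// mul1r; nra.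
Qed.

Lemma bounded_continuous_cauchy_prod l :
  all (fun i => 0 <= i.2) l -> bounded_continuous (cauchy_prod l).
Proof.
elim: l => [_|[b q] l IH /= /andP[q0 al]].
  rewrite (_ : cauchy_prod _ = fun=> 1); first exact: bounded_continuous_cst.
  by apply/funext => x; rewrite /cauchy_prod big_nil.
rewrite (_ : cauchy_prod _ = fun x => cauchy_fun b (3 + ratr q) x * cauchy_prod l x).
  by apply: bounded_continuousM; [have [] := Lcauchy b q0|exact: IH].
by apply/funext => x; rewrite /cauchy_prod big_cons.
Qed.

(** Partial fractions turn a product of two kernels with different eta into a combination of single
    ones and so shorten the list. Equal parameters are first separated by a small rational shift
    upwards, which stays in the family and changes the product by at most the shift. *)
Lemma mean_cvg_cauchy_prod l : all (fun i => 0 <= i.2) l -> mean_cvg (cauchy_prod l).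
Proof.
have [m] := ubnP (size l); elim: m l => // m IH [|[b1 q1] [|[b2 q2] l]] /=.
- move=> _ _; rewrite (_ : cauchy_prod [::] = fun=> 1); first exact: mean_cvg_cst.
  by apply/funext => x; rewrite /cauchy_prod big_nil.
- move=> _ /andP[q10 _]; rewrite (_ : cauchy_prod _ = cauchy_fun b1 (3 + ratr q1)).
    exact: Lcauchy.
  by apply/funext => x; rewrite /cauchy_prod big_cons big_nil mulr1.
rewrite ltnS => sl /and3P[q10 q20 al].
have distinct (q : rat) : 0 <= q -> q != q2 ->
    mean_cvg (cauchy_prod ((b1, q) :: (b2, q2) :: l)).
  move=> q0 qq2.
  set e1 := 3 + ratr q : R; set e2 := 3 + ratr q2 : R.
  have e13 : 3 <= e1 := eta_ge3 q0; have e23 : 3 <= e2 := eta_ge3 q20.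
  have e12 : e2 ^+ 2 - e1 ^+ 2 != 0.
    rewrite subr_eq0 eqrXn2 //; try by lra.
    by rewrite eq_sym; apply: contra qq2 => /eqP /addrI /(fmorph_inj (ratr : {rmorphism _ -> R})) ->.
  (* b and b' are the kinds of the two resulting kernels: like kinds multiply to even kernels,
     unlike kinds to odd ones. *)
  have h (b b' : bool) a1 a2 : (forall x, cauchy_fun b1 e1 x * cauchy_fun b2 e2 x =
      a1 * cauchy_fun b e1 x + a2 * cauchy_fun b' e2 x) ->
      mean_cvg (cauchy_prod ((b1, q) :: (b2, q2) :: l)).
    move=> E; rewrite (_ : cauchy_prod _ = fun x =>
       a1 * cauchy_prod ((b, q) :: l) x + a2 * cauchy_prod ((b', q2) :: l) x).
      by apply: mean_cvg_lin; apply: IH; rewrite //= ?q0 ?q20.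
    by apply/funext => x; rewrite /cauchy_prod !big_cons /= mulrA E; ring.
  have den x := cauchy_den_gt0 x e13; have den' x := cauchy_den_gt0 x e23.
  have g1 x : x ^+ 2 + e1 ^+ 2 != 0 by rewrite gt_eqF.
  have g2 x : x ^+ 2 + e2 ^+ 2 != 0 by rewrite gt_eqF.
  case: b1 b2 h => [] [] h.
  - apply: (h false false (- e1 ^+ 2 / (e2 ^+ 2 - e1 ^+ 2)) (e2 ^+ 2 / (e2 ^+ 2 - e1 ^+ 2))).
    by move=> x; rewrite /cauchy_fun; field; rewrite g1 g2 e12.
  - apply: (h true true (e2 ^+ 2 - e1 ^+ 2)^-1 (- (e2 ^+ 2 - e1 ^+ 2)^-1)).
    by move=> x; rewrite /cauchy_fun; field; rewrite g1 g2 e12.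
  - apply: (h true true (e2 ^+ 2 - e1 ^+ 2)^-1 (- (e2 ^+ 2 - e1 ^+ 2)^-1)).
    by move=> x; rewrite /cauchy_fun; field; rewrite g1 g2 e12.
  - apply: (h false false (e2 ^+ 2 - e1 ^+ 2)^-1 (- (e2 ^+ 2 - e1 ^+ 2)^-1)).
    by move=> x; rewrite /cauchy_fun; field; rewrite g1 g2 e12.
have [q12|] := eqVneq q1 q2; last exact: distinct.
apply: mean_cvg_approx.
  by apply: bounded_continuous_cauchy_prod; rewrite /= q10 q20.
move=> e e0.
have [de de0 dee] : exists2 de : rat, 0 < de & ratr de <= e :> R.
  exists ((Num.truncn e^-1).+1%:R)^-1; first by rewrite invr_gt0 ltr0n.
  rewrite fmorphV rmorph_nat -[leRHS]invrK lef_pV2 ?posrE ?invr_gt0 ?ltr0n//.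
  by apply: ltW; exact: truncnS_gt.
exists (cauchy_prod ((b1, q1 + de) :: (b2, q2) :: l)).
  apply: distinct; first by rewrite addr_ge0// ltW.
  by rewrite q12 -subr_eq0 addrC addKr gt_eqF.
move=> x; rewrite /cauchy_prod !big_cons /= -mulrBl normrM.
rewrite -[leRHS]mulr1; apply: ler_pM => //.
  apply: le_trans dee; rewrite rmorphD addrA /=.
  by apply: cauchy_fun_lipschitz; [exact: eta_ge3|rewrite ler0q ltW].
rewrite normrM -[leRHS]mulr1; apply: ler_pM => //.
  by apply: normr_cauchy_fun; exact: eta_ge3.
elim: l al {sl distinct} => [|[b q] l' IHl] /=; first by rewrite big_nil normr1.
case/andP => q0 /IHl {}IHl; rewrite big_cons normrM -[leRHS]mulr1.
by apply: ler_pM => //; apply: normr_cauchy_fun; exact: eta_ge3.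
Qed.


(** Asking for all products with kernels makes the property stable under multiplication by a kernel,
    hence by polynomials in a kernel; the empty list returns convergence for [f] itself. *)
Definition multiplier f :=
  forall l, all (fun i => 0 <= i.2) l -> mean_cvg (fun x => f x * cauchy_prod l x).

Lemma multiplier1 : multiplier (fun=> 1).
Proof.
move=> l al; rewrite (_ : (fun x => _) = cauchy_prod l); first exact: mean_cvg_cauchy_prod.
by apply/funext => x; rewrite mul1r.
Qed.

Lemma multiplier_lin f g a b : multiplier f -> multiplier g ->
  multiplier (fun x => a * f x + b * g x).
Proof.
move=> mf mg l al.
rewrite (_ : (fun x => _) = fun x => a * (f x * cauchy_prod l x) + b * (g x * cauchy_prod l x)).
  by apply: mean_cvg_lin; [exact: mf|exact: mg].
by apply/funext => x; ring.
Qed.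

Lemma multiplier_cauchy b (q : rat) f : 0 <= q -> multiplier f ->
  multiplier (fun x => cauchy_fun b (3 + ratr q) x * f x).
Proof.
move=> q0 mf l al.
rewrite (_ : (fun x => _) = fun x => f x * cauchy_prod ((b, q) :: l) x).
  by apply: mf; rewrite /= q0.
by apply/funext => x; rewrite /cauchy_prod big_cons; ring.
Qed.

Lemma multiplier_poly b (al be : R) f (q : {poly R}) : multiplier f ->
  multiplier (fun x => q.[al * cauchy_fun b 3 x + be] * f x).
Proof.
move=> mf; elim/poly_ind: q => [|q c IH].
  rewrite (_ : (fun x => _) = fun x => 0 * f x + 0 * f x).
    exact: multiplier_lin.
  by apply/funext => x; rewrite horner0; ring.
have h := multiplier_cauchy b (lexx 0) IH; rewrite rmorph0 addr0 in h.
rewrite (_ : (fun x => _) = fun x => 1 * (al * (cauchy_fun b 3 x *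
    (q.[al * cauchy_fun b 3 x + be] * f x)) + be * (q.[al * cauchy_fun b 3 x + be] * f x))
    + c * f x).
  exact: (multiplier_lin 1 c (multiplier_lin al be h IH) mf).
by apply/funext => x; rewrite hornerMXaddC; ring.
Qed.

(* The two coordinates below take values in [0, 1]; on |x| <= 3 the first one
   determines x, and the second one is used to cut off |x| >= 3. *)
Let odd_coord x : R := 3 * cauchy_fun true 3 x + 2^-1.
Let even_coord x : R := 9 * cauchy_fun false 3 x + 0.

Let den9E x : x ^+ 2 + 3 ^+ 2 = x ^+ 2 + 9 :> R. Proof. by ring. Qed.

Let den9 x : 0 < x ^+ 2 + 9 :> R.
Proof. by rewrite -den9E; exact: cauchy_den_gt0. Qed.

Let odd_coord01 x : 0 <= odd_coord x <= 1.
Proof.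
have D := den9 x; rewrite /odd_coord /cauchy_fun den9E.
have -> : 3 * (x * (x ^+ 2 + 9)^-1) + 2^-1 =
   (x + 3) ^+ 2 / (2 * (x ^+ 2 + 9)) by field; rewrite gt_eqF.
apply/andP; split; first by rewrite divr_ge0 ?sqr_ge0// mulr_ge0// ltW.
rewrite ler_pdivrMr ?mul1r ?mulr_gt0//.
by have := sqr_ge0 (x - 3); rewrite !expr2; lra.
Qed.

Let even_coord01 x : 0 <= even_coord x <= 1.
Proof.
have D := den9 x; rewrite /even_coord /cauchy_fun den9E mul1r addr0.
apply/andP; split; first by rewrite divr_ge0// ltW.
by rewrite ler_pdivrMr// mul1r; have := sqr_ge0 x; rewrite !expr2; lra.
Qed.

(** Weierstrass approximation in each coordinate separately; the polynomial for [F] is chosen first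
    because its bound K + e1 enters the accuracy demanded of the other. *)
Lemma mean_cvg_separated (F g : R -> R) : bounded_continuous F -> bounded_continuous g ->
  mean_cvg (fun x => F (odd_coord x) * g (even_coord x)).
Proof.
move=> bF bg; have [cF [K FK]] := bF; have [cg [K' gK]] := bg.
have K0 : 0 <= K by apply: le_trans (FK 0).
have K0' : 0 <= K' by apply: le_trans (gK 0).
have bcauchy b : bounded_continuous (cauchy_fun b 3).
  by have [] := Lcauchy b (lexx 0); rewrite rmorph0 addr0.
have bcoord b (al be : R) h : bounded_continuous h ->
    bounded_continuous (fun x => h (al * cauchy_fun b 3 x + be)).
  move=> [ch [C hC]]; split; last by exists C.
  move=> x; apply: (@continuous_comp _ _ _ (fun x => al * cauchy_fun b 3 x + be) h).
    have [cc _] : bounded_continuous (fun x => al * cauchy_fun b 3 x + be).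
      apply: bounded_continuousD; last exact: bounded_continuous_cst.
      exact: bounded_continuousZ.
    exact: cc.
  exact: ch.
apply: mean_cvg_approx; first by apply: bounded_continuousM; exact: bcoord.
move=> e e0.
pose e1 := e / (2 * (K' + 1)); have e10 : 0 < e1 by rewrite divr_gt0//; lra.
have [q1 h1] := weierstrass_unit cF FK e10.
pose e2 := e / (2 * (K + e1 + 1)); have e20 : 0 < e2 by rewrite divr_gt0//; lra.
have [q2 h2] := weierstrass_unit cg gK e20.
exists (fun x => q1.[odd_coord x] * (q2.[even_coord x] * 1)).
  have m := multiplier_poly true 3 2^-1 q1 (multiplier_poly false 9 0 q2 multiplier1).
  have := m [::] isT.
  rewrite (_ : (fun x => _) = fun x => q1.[odd_coord x] * (q2.[even_coord x] * 1))//.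
  by apply/funext => x; rewrite /cauchy_prod big_nil mulr1.
move=> x; rewrite mulr1.
have {}h1 := h1 _ (odd_coord01 x); have {}h2 := h2 _ (even_coord01 x).
set a := F _ in h1 *; set b := g _ in h2 *; set a' := q1.[_] in h1 *; set b' := q2.[_] in h2 *.
have aK : `|a| <= K by exact: FK.
have bK : `|b| <= K' by exact: gK.
have -> : a * b - a' * b' = (a - a') * b + a' * (b - b') by ring.
apply: le_trans (ler_normD _ _) _; rewrite !normrM.
have a'K : `|a'| <= K + e1.
  have -> : a' = a - (a - a') by ring.
  by apply: le_trans (ler_normB _ _) _; exact: lerD.
have m1 : `|a - a'| * `|b| <= e1 * K' by apply: ler_pM.
have m2 : `|a'| * `|b - b'| <= (K + e1) * e2 by apply: ler_pM.
have E1 : e1 * K' <= e / 2.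
  have -> : e / 2 = e1 * (K' + 1) by rewrite /e1; field; rewrite gt_eqF//; lra.
  by rewrite ler_wpM2l ?(ltW e10)//; lra.
have E2 : (K + e1) * e2 <= e / 2.
  have -> : e / 2 = (K + e1 + 1) * e2 by rewrite /e2; field; rewrite gt_eqF//; lra.
  by rewrite ler_wpM2r ?(ltW e20)//; lra.
by lra.
Qed.

(** 9/(x^2 + 9) equals 1/2 at |x| = 3 and 9/13 at |x| = 2, and 9/13 - 1/2 = 5/26; so the ramp
    composed with [even_coord] is 1 on |x| <= 2 and 0 on |x| >= 3. *)
Let cutoff (y : R) : R := Num.min 1 (Num.max 0 (26 / 5 * (y - 2^-1))).

Let cutoff01 y : 0 <= cutoff y <= 1.
Proof. by rewrite /cutoff le_min ler01 le_max lexx /= ge_min lexx. Qed.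

Let bounded_continuous_cutoff : bounded_continuous cutoff.
Proof.
split; last by exists 1 => x; have /andP[c0 c1] := cutoff01 x; rewrite ger0_norm.
have c1 : continuous (fun y : R => 26 / 5 * (y - 2^-1)).
  move=> y; apply: cvgM; first exact: cvg_cst.
  by apply: cvgB; [exact: cvg_id|exact: cvg_cst].
have c2 : continuous (fun y : R => Num.max 0 (26 / 5 * (y - 2^-1))).
  move=> y; exact: (@continuous_max R R (fun=> 0 : R) (fun y : R => 26 / 5 * (y - 2^-1)) y
    (@cst_continuous _ _ _ _) (c1 y)).
move=> y; exact: (@continuous_min R R (fun=> 1 : R)
  (fun y : R => Num.max 0 (26 / 5 * (y - 2^-1))) y (@cst_continuous _ _ _ _) (c2 y)).
Qed.

Let cutoff_in x : -2 <= x <= 2 -> cutoff (even_coord x) = 1.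
Proof.
move=> /andP[x1 x2]; apply: min_l; rewrite le_max; apply/orP; right.
rewrite /even_coord /cauchy_fun den9E mul1r addr0.
have D := den9 x; rewrite -ler_pdivrMl// lerBrDr ler_pdivlMr//.
by rewrite !expr2 in D *; nra.
Qed.

Let cutoff_out x : 9 <= x ^+ 2 -> cutoff (even_coord x) = 0.
Proof.
move=> x9; rewrite /cutoff max_l ?min_r//.
rewrite /even_coord /cauchy_fun den9E mul1r addr0 pmulr_rle0// subr_le0.
have D := den9 x; rewrite ler_pdivrMr//.
by rewrite !expr2 in x9 D *; lra.
Qed.

(** The cutoff [psi] is 1 on the support of the semicircle law, so its empirical means tend to 1 and
    the mass outside |x| < 3 is asymptotically negligible; this supplies tightness. The product f
    psi is a function of the two coordinates. *)
Lemma mean_cvg_bounded_continuous f : bounded_continuous f -> mean_cvg f.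
Proof.
move=> bf; have [cf [K fK]] := bf.
have K0 : 0 <= K by apply: le_trans (fK 0).
(* For b = x/(x^2 + 9) the equation b x^2 - x + 9 b = 0 has the root 18 b/(1 + sqrt(1 - 36 b^2)) of
   modulus at most 3; this rationalised form is continuous at b = 0. *)
pose inv3 t : R := let b := (t - 2^-1) / 3 in
  18 * b * (1 + Num.sqrt (1 - 36 * b ^+ 2))^-1.
have cinv : continuous inv3.
  have cb : continuous (fun t : R => (t - 2^-1) / 3).
    move=> t; apply: cvgM; last exact: cvg_cst.
    by apply: cvgB; [exact: cvg_id|exact: cvg_cst].
  have cs : continuous (fun t : R => Num.sqrt (1 - 36 * ((t - 2^-1) / 3) ^+ 2)).
    apply: continuous_sqrt_comp => t; apply: cvgB; first exact: cvg_cst.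
    apply: cvgM; first exact: cvg_cst.
    by apply: (@continuous_comp _ _ _ (fun t : R => (t - 2^-1) / 3) (fun y => y ^+ 2));
      [exact: cb|exact: exprn_continuous].
  move=> t; apply: cvgM.
    by apply: cvgM; [exact: cvg_cst|exact: cb].
  apply: cvgV; first by rewrite gt_eqF// ltr_pwDl// sqrtr_ge0.
  by apply: cvgD; [exact: cvg_cst|exact: cs].
have bF : bounded_continuous (f \o inv3).
  split; last by exists K => x; exact: fK.
  move=> t; apply: continuous_comp; [exact: cinv|exact: cf].
have inv3K x : x ^+ 2 < 9 -> inv3 (odd_coord x) = x.
  move=> x9; have D := den9 x; rewrite /inv3 /odd_coord /cauchy_fun den9E addrK.
  have -> : 3 * (x * (x ^+ 2 + 9)^-1) / 3 = x / (x ^+ 2 + 9).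
    by field; rewrite gt_eqF.
  have -> : 1 - 36 * (x / (x ^+ 2 + 9)) ^+ 2 =
      ((9 - x ^+ 2) / (x ^+ 2 + 9)) ^+ 2 by field; rewrite gt_eqF.
  rewrite sqrtr_sqr ger0_norm; last by rewrite divr_ge0 ?(ltW D)//; lra.
  have D18 : x ^+ 2 + 9 + (9 - x ^+ 2) != 0.
    have -> : x ^+ 2 + 9 + (9 - x ^+ 2) = 18 by ring.
    by rewrite pnatr_eq0.
  by field; rewrite gt_eqF//= ?D18.
pose psi x := cutoff (even_coord x).
have fpsi : mean_cvg (fun x => f x * psi x).
  have := mean_cvg_separated bF bounded_continuous_cutoff.
  rewrite (_ : (fun x => _) = fun x => f x * psi x)//.
  apply/funext => x; rewrite /psi /=.
  by have [x9|x9] := ltrP (x ^+ 2) 9; [rewrite inv3K|rewrite cutoff_out// !mulr0].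
have cpsi : mean_cvg psi.
  have := mean_cvg_separated (bounded_continuous_cst 1) bounded_continuous_cutoff.
  by rewrite (_ : (fun x => _) = psi)//; apply/funext => x; rewrite mul1r.
have psi1 : semicircle_mean psi = 1.
  rewrite -(@semicircle_mean_cst R 1); apply: semicircle_mean_support.
  - exact: cpsi.1.
  - exact: bounded_continuous_cst.
  - exact: cutoff_in.
have fpsiE : semicircle_mean (fun x => f x * psi x) = semicircle_mean f.
  apply: semicircle_mean_support => //; first exact: fpsi.1.
  by move=> x xI; rewrite /psi cutoff_in// mulr1.
split=> //; apply/cvgrPdist_le => e e0.
have e20 : 0 < e / 2 by rewrite divr_gt0.
have eK : 0 < e / (2 * (K + 1)) by rewrite divr_gt0//; lra.
have /cvgrPdist_le /(_ _ e20) h1 := fpsi.2.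
have /cvgrPdist_le /(_ _ eK) h2 := cpsi.2.
near=> n.
have n1 : `|semicircle_mean f - list_mean (L n) (fun x => f x * psi x)| <= e / 2.
  by rewrite -fpsiE; near: n.
have n2 : `|1 - list_mean (L n) psi| <= e / (2 * (K + 1)).
  by rewrite -{1}psi1; near: n.
have n0 : (0 < size (L n))%N by near: n.
set u := list_mean (L n) (fun x => f x * psi x) in n1 *.
have du : `|u - list_mean (L n) f| <= K * (1 - list_mean (L n) psi).
  have -> : u - list_mean (L n) f = list_mean (L n) (fun x => f x * psi x + (-1) * f x).
    by rewrite list_meanD list_meanZ mulN1r.
  have -> : K * (1 - list_mean (L n) psi) = list_mean (L n) (fun x => K * (1 + (-1) * psi x)).
    by rewrite list_meanZ list_meanD list_mean_cst// list_meanZ mulN1r.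
  have b01 x : 0 <= 1 + (-1) * psi x.
    by have /andP[_] := cutoff01 (even_coord x); rewrite -/(psi x); lra.
  have fb x : `|f x * (1 + (-1) * psi x)| <= K * (1 + (-1) * psi x).
    by rewrite normrM (ger0_norm (b01 x)) ler_wpM2r.
  rewrite ler_norml; apply/andP; split.
    rewrite -[leLHS]mulN1r -list_meanZ; apply: ler_list_mean => x.
    by have := fb x; rewrite ler_norml => /andP[]; lra.
  apply: ler_list_mean => x.
  by have := fb x; rewrite ler_norml => /andP[]; lra.
have Ke : K * (1 - list_mean (L n) psi) <= e / 2.
  apply: le_trans (_ : K * (e / (2 * (K + 1))) <= _).
    by rewrite ler_wpM2l// (le_trans (ler_norm _) n2).
  have -> : e / 2 = (K + 1) * (e / (2 * (K + 1))) by field; rewrite gt_eqF//; lra.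
  by rewrite ler_wpM2r ?(ltW eK)//; lra.
rewrite -(subrKA u); apply: le_trans (ler_normD _ _) _.
by have := lerD n1 (le_trans du Ke); lra.
Unshelve. all: by end_near. Qed.

End WeakConvergence.

(** * Laws of Bernoulli families and almost sure convergence *)

Section ProductLaw.
Variables (R : realType) (Q : finType) (disp : measure_display).
Variables (T : measurableType disp) (P : probability T R).
Variables (D : {set Q}) (chi : Q -> {mfun T >-> bool}) (p : R).
Hypothesis p01 : 0 <= p <= 1.
Hypothesis chi_bernoulli : forall s, s \in D ->
  distribution P (chi s) = bernoulli_prob p.
Hypothesis chi_indep : mutually_independent P D chi.
Implicit Types S : {ffun Q -> bool}.

Definition outcome (w : T) : {ffun Q -> bool} := [ffun s => (s \in D) && chi s w].

Local Notation wt b := (if b then p else 1 - p).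

Lemma bexp_indic (l : seq Q) S S0 : uniq l ->
  bexp p l (fun S' => (S' == S)%:R) S0 =
  if [forall s, (s \in l) || (S0 s == S s)] then \prod_(s <- l) wt (S s) else 0.
Proof.
elim: l S0 => [|t l IH] S0 /=.
  move=> _; rewrite big_nil; case: ifPn => [/forallP h|].
    by rewrite (_ : S0 = S) ?eqxx//; apply/ffunP => s; apply/eqP; exact: (h s).
  apply: contraNeq; case: (S0 =P S) => [-> _|_]; last by rewrite eqxx.
  by apply/forallP => s.
move=> /andP[tl ul]; rewrite /avg1 !IH// big_cons.
have E b : [forall s, (s \in l) || (upd S0 t b s == S s)] =
    (b == S t) && [forall s, (s \in t :: l) || (S0 s == S s)].
  apply/forallP/andP => [h|[/eqP bt /forallP h] s].
    split; first by have := h t; rewrite ffunE eqxx (negbTE tl).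
    apply/forallP => s; have := h s; rewrite ffunE inE.
    by case: (eqVneq s t).
  rewrite ffunE; case: (eqVneq s t) => [->|st]; first by rewrite bt eqxx orbT.
  by have := h s; rewrite inE (negbTE st).
rewrite !E; case: (S t) => /=; case: ifP => _; rewrite ?mulr0 ?addr0 ?add0r//.
Qed.

Lemma bexp_sum_indic (l : seq Q) (f : {ffun Q -> bool} -> R) S0 :
  bexp p l f S0 = \sum_S f S * bexp p l (fun S' => (S' == S)%:R) S0.
Proof.
under eq_bigr do rewrite -bexpZ.
rewrite -bexp_sum; congr (bexp _ _ _ _); apply/funext => S.
rewrite (bigD1 S)//= eqxx mulr1 big1 ?addr0// => S' S'S.
by rewrite eq_sym (negbTE S'S) mulr0.
Qed.

Lemma outcome_preimage S : (forall s, s \notin D -> S s = false) ->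
  outcome @^-1` [set S] = \bigcap_(i in [set` D]) (chi i @^-1` [set S i]).
Proof.
move=> S0; apply/seteqP; split => w /=.
  by move=> <- s /= sD; rewrite ffunE sD.
move=> h; apply/ffunP => s; rewrite ffunE.
have [sD|sD] := boolP (s \in D); first by rewrite (h s sD).
by rewrite S0.
Qed.

Lemma outcome_preimage0 S s : s \notin D -> S s -> outcome @^-1` [set S] = set0.
Proof.
move=> sD Ss; apply/seteqP; split => w //= wS.
by move: Ss; rewrite -wS ffunE (negbTE sD).
Qed.

Lemma measurable_outcome S : measurable (outcome @^-1` [set S]).
Proof.
have [h|] := pselect (forall s, s \notin D -> S s = false).
  rewrite outcome_preimage//; apply: fin_bigcap_measurable; first exact: finite_finset.
  by move=> i _; rewrite -[X in measurable X]setTI; exact: measurable_funP.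
move=> /existsNP[s /not_implyP[sD /eqP]]; rewrite eqbF_neg negbK => Ss.
by rewrite (outcome_preimage0 sD)//; exact: measurable0.
Qed.

(** The link between the probability space and [bexp]: for configurations vanishing off [D]
    independence gives the product of the weights, and any other configuration has mass zero on both
    sides. *)
Lemma law_outcome S : P (outcome @^-1` [set S]) =
  (bexp p (enum D) (fun S' => (S' == S)%:R) [ffun=> false])%:E.
Proof.
rewrite bexp_indic ?enum_uniq//.
have [h|] := pselect (forall s, s \notin D -> S s = false).
  rewrite outcome_preimage// chi_indep// ifT; last first.
    apply/forallP => s; rewrite mem_enum ffunE.
    by have [//|sD] := boolP (s \in D); rewrite /= h.
  rewrite big_enum /= -prodEFin; apply: eq_bigr => s sD.
  have -> : P (chi s @^-1` [set S s]) = distribution P (chi s) [set S s] by [].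
  rewrite chi_bernoulli// bernoulli_probE//.
  have dE (b b' : bool) : (\d_b [set b'] = ((b == b')%:R)%:E :> \bar R)%E.
    rewrite diracE; case: eqVneq => [->|bb]; first by rewrite mem_set.
    by rewrite memNset//= => /eqP; rewrite (negbTE bb).
  by rewrite !dE; case: (S s); rewrite /= ?mule1 ?mule0 ?adde0 ?add0e.
move=> /existsNP[s /not_implyP[sD /eqP]]; rewrite eqbF_neg negbK => Ss.
rewrite (outcome_preimage0 sD)// measure0 ifF//.
by apply/negP => /forallP/(_ s); rewrite mem_enum (negbTE sD) ffunE Ss.
Qed.

Lemma indicator_sum (f : {ffun Q -> bool} -> R) w :
  (f (outcome w))%:E = (\sum_S (f S)%:E * (\1_(outcome @^-1` [set S]) w)%:E)%E.
Proof.
rewrite (bigD1 (outcome w))//= indicE mem_set// mule1 big1 ?adde0// => S Sw.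
by rewrite indicE memNset ?mule0//= => /esym/eqP; rewrite (negbTE Sw).
Qed.

Lemma integral_outcome (f : {ffun Q -> bool} -> R) : (forall S, 0 <= f S) ->
  (\int[P]_w (f (outcome w))%:E)%E = (bexp p (enum D) f [ffun=> false])%:E.
Proof.
move=> f0; under eq_integral do rewrite indicator_sum.
rewrite ge0_integral_sum//; last 2 first.
- move=> S; apply: emeasurable_funM => //.
  by apply/measurable_EFinP; apply: measurable_indic; exact: measurable_outcome.
- by move=> S w _; rewrite mule_ge0 ?lee_fin.
rewrite bexp_sum_indic -sumEFin; apply: eq_bigr => S _.
have mS := measurable_outcome S.
rewrite ge0_integralZl_EFin//; last first.
  by apply/measurable_EFinP; exact: measurable_indic.
by rewrite integral_indic// setIT EFinM; congr (_ * _)%E; exact: law_outcome.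
Qed.

Lemma measurable_fun_outcome (f : {ffun Q -> bool} -> R) :
  measurable_fun setT (fun w => f (outcome w)).
Proof.
rewrite (_ : (fun w => _) =
    (fun w => \sum_S f S * \1_(outcome @^-1` [set S]) w)).
  apply: measurable_sum => S; apply: measurable_funM => //.
  by apply: measurable_indic; exact: measurable_outcome.
apply/funext => w; apply: EFin_inj; rewrite indicator_sum -sumEFin.
by apply: eq_bigr => S _; rewrite EFinM.
Qed.

End ProductLaw.

(** The sum of the [X n] has finite expectation, hence is almost surely finite, and so its terms
    tend to 0; only bounds for each [X n] separately enter. *)
Lemma ae_cvg0_of_summable (R : realType) (disp : measure_display)
    (T : measurableType disp) (P : probability T R)
    (X : nat -> T -> R) (c : nat -> R) :
  (forall n w, 0 <= X n w) -> (forall n, measurable_fun setT (X n)) ->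
  (forall n, (\int[P]_w (X n w)%:E <= (c n)%:E)%E) ->
  (\sum_(n <oo) (c n)%:E < +oo)%E ->
  {ae P, forall w, X n w @[n --> \oo] --> 0}.
Proof.
move=> X0 mX Xc c_fin.
pose Y w := (\sum_(n <oo) (X n w)%:E)%E.
have mXE n : measurable_fun setT (fun w => (X n w)%:E).
  exact/measurable_EFinP.
have Y0 w : (0 <= Y w)%E by apply: nneseries_ge0 => n _ _; rewrite lee_fin.
have mY : measurable_fun setT Y.
  by apply: ge0_emeasurable_sum => n *; [rewrite lee_fin|].
have iY : P.-integrable setT Y.
  apply/integrableP; split => //.
  under eq_integral do rewrite gee0_abs//.
  rewrite integral_nneseries//; last by move=> n w _; rewrite lee_fin.
  apply: le_lt_trans c_fin; apply: lee_nneseries => [n *|n *]; last exact: Xc.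
  by apply: integral_ge0 => w _; rewrite lee_fin.
have := integrable_ae measurableT iY.
apply: filterS => w /(_ I) Yfin.
apply: cvg_series_cvg_0; apply: nondecreasing_is_cvgn.
  by apply: nondecreasing_series => n _ _; exact: X0.
exists (fine (Y w)) => _ [n _ <-].
rewrite -lee_fin fineK// /series /= -sumEFin; apply: nneseries_lim_ge.
by move=> k _ _; rewrite lee_fin.
Qed.

(** * Faces and orientation signs *)

Section Faces.
Import mathcomp.boot.finset.
Variables (n d : nat).
Hypothesis d2 : (2 <= d)%N.
Implicit Types s t u : {set 'I_n}.

Definition ksets (k : nat) : {set {set 'I_n}} := [set s : {set 'I_n} | #|s| == k].

Lemma card_ksets k : #|ksets k| = 'C(n, k).
Proof. by rewrite card_draws card_ord. Qed.

Local Notation N := #|ksets d|.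

Definition cellv (a : 'I_N) : {set 'I_n} := enum_val a.

Lemma card_cellv a : #|cellv a| = d.
Proof. by have := enum_valP a; rewrite inE => /eqP. Qed.

Lemma cellv_inj : injective cellv. Proof. exact: enum_val_inj. Qed.

Lemma cellvP s : #|s| = d -> exists a, cellv a = s.
Proof.
move=> sd; have sD : s \in ksets d by rewrite inE sd.
by exists (enum_rank_in sD s); rewrite /cellv enum_rankK_in.
Qed.

Definition faces t : {set 'I_N} := [set a | cellv a \subset t].

Local Notation lines := (enum (ksets d.+1)).

Lemma mem_lines t : (t \in lines) = (#|t| == d.+1).
Proof. by rewrite mem_enum inE. Qed.

Lemma card_faces t : t \in lines -> #|faces t| = d.+1.
Proof.
rewrite mem_lines => /eqP td.
rewrite -(card_imset _ cellv_inj).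
have -> : cellv @: faces t = [set s : {set 'I_n} | s \subset t & #|s| == d].
  apply/setP => s; rewrite inE; apply/imsetP/andP => [[a]|[st /eqP/cellvP[a E]]].
    by rewrite inE => at_ ->; rewrite at_ card_cellv.
  by exists a; rewrite ?E// inE E.
by rewrite cards_draws td binSn.
Qed.

(** The two faces are distinct d-subsets of a set of size d + 1, so their union already has more
    than d elements. Hence a pair of faces determines [t]: the hypergraph is linear. *)
Lemma cellv_union a b t : t \in lines -> a != b -> a \in faces t -> b \in faces t ->
  cellv a :|: cellv b = t.
Proof.
rewrite mem_lines !inE => /eqP td ab at_ bt.
apply/eqP; rewrite eqEcard subUset at_ bt td /=.
have : cellv a \proper cellv a :|: cellv b.
  rewrite properE subsetUl subUset subxx /=; apply: contra ab => ba.
  apply/eqP/cellv_inj/esym/eqP; by rewrite eqEcard ba !card_cellv /=.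
by move/proper_card; rewrite card_cellv.
Qed.

Lemma faces_line t u a b : t \in lines -> u \in lines -> a != b ->
  a \in faces t -> b \in faces t -> a \in faces u -> b \in faces u -> t = u.
Proof.
move=> tl ul ab at_ bt au bu.
by rewrite -(cellv_union tl ab at_ bt) (cellv_union ul ab au bu).
Qed.

Lemma faces_degree a : count (fun t => a \in faces t) lines = (n - d)%N.
Proof.
rewrite -size_filter.
have -> : (n - d)%N = #|~: cellv a| by rewrite cardsCs setCK card_ord card_cellv.
rewrite -(card_in_imset (f := fun x => x |: cellv a) (D := ~: cellv a)); last first.
  move=> x y; rewrite !inE => xa ya /setP/(_ x).
  by rewrite !inE eqxx (negbTE xa) !orbF => /esym/eqP.
rewrite [RHS]cardE; apply: perm_size; apply: uniq_perm => [||t].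
- by rewrite filter_uniq// enum_uniq.
- exact: enum_uniq.
rewrite mem_filter mem_enum mem_enum !inE; apply/andP/imsetP.
  case=> at_ /eqP td.
  have : #|t :\: cellv a| == 1%N.
    by rewrite cardsD (setIidPr at_) td card_cellv subSnn.
  case/cards1P => x tx; exists x; last by rewrite -tx setUC setDE setUIr setUCr setIT (setUidPr at_).
  by have := set11 x; rewrite -tx !inE => /andP[].
case=> x; rewrite inE => xa ->; rewrite subsetUr cardsU1 card_cellv.
by rewrite xa add1n.
Qed.

Section Signs.
Variables (R : comNzRingType) (sg : {set 'I_n} -> {set 'I_n} -> R).
Hypothesis sg1 : forall u s, sg u s ^+ 2 = 1.

Definition facevec u : 'cV[R]_N := \col_a ((u \subset cellv a)%:R * sg u (cellv a)).

(** The Gram matrix of the vectors [facevec] with its diagonal removed: a d-set has d subsets of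
    size d - 1. Two distinct d-sets have such a subset in common only if their union has size d + 1,
    and then only their intersection; so the entries are signs there and 0 elsewhere. *)
Definition facesign s t : R :=
  \sum_(u in ksets d.-1) (u \subset s)%:R * (u \subset t)%:R * (sg u s * sg u t)
  - (d%:R *+ (s == t)).

Definition facemx : 'M[R]_N := \matrix_(a, b) facesign (cellv a) (cellv b).

Lemma facemx_gram :
  facemx = (\sum_(u <- [seq facevec u | u <- enum (ksets d.-1)]) u *m u^T) - (d%:R)%:M.
Proof.
rewrite big_map big_enum /=; apply/matrixP => a b; rewrite !mxE /facesign summxE.
rewrite (inj_eq cellv_inj); congr (_ - _).
apply: eq_bigr => u _; rewrite mxE big_ord1 !mxE; ring.
Qed.

Lemma facesignC s t : facesign s t = facesign t s.
Proof.
rewrite /facesign eq_sym; congr (_ - _); apply: eq_bigr => u _; ring.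
Qed.

Lemma facesign_diag s : #|s| = d -> facesign s s = 0.
Proof.
move=> sd; rewrite /facesign eqxx mulr1n.
rewrite (eq_bigr (fun u => if u \subset s then 1 else 0)) => [|u _]; last first.
  by rewrite -!expr2 sg1 mulr1; case: (u \subset s); rewrite ?expr1n ?expr0n.
rewrite -big_mkcondr sumr_const (_ : #|_| = d) ?subrr//.
have dE : 'C(d, d.-1) = d by rewrite -{1 3}(prednK (ltnW d2)) binSn.
have := cards_draws s d.-1; rewrite sd dE => {2}<-.
apply: eq_card => u; rewrite [RHS]inE.
by rewrite -[LHS]/((u \in ksets d.-1) && (u \subset s)) inE andbC.
Qed.

Lemma facesign_adj s t : #|s| = d -> #|t| = d -> #|s :|: t| = d.+1 ->
  facesign s t = sg (s :&: t) s * sg (s :&: t) t.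
Proof.
move=> sd td st; have std : #|s :&: t| = d.-1.
  by have := cardsUI s t; rewrite sd td st; move: d2; lia.
have sNt : (s == t) = false.
  by apply/negbTE/eqP => e; move: st; rewrite e setUid td => /n_Sn.
rewrite /facesign sNt mulr0n subr0 (bigD1 (s :&: t)) /=; last by rewrite inE std.
rewrite subsetIl subsetIr !mul1r big1 ?addr0// => u /andP[]; rewrite inE => /eqP ud un.
have [us|_] := boolP (u \subset s); last by rewrite !mul0r.
have [ut|_] := boolP (u \subset t); last by rewrite mulr0 mul0r.
by move: un; rewrite eqEcard subsetI us ut std ud leqnn.
Qed.

Lemma facesign_adj_sqr s t : #|s| = d -> #|t| = d -> #|s :|: t| = d.+1 ->
  facesign s t ^+ 2 = 1.
Proof. by move=> sd td st; rewrite facesign_adj// exprMn !sg1 mulr1. Qed.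

Lemma facesign_far s t : #|s| = d -> #|t| = d -> s != t -> #|s :|: t| != d.+1 ->
  facesign s t = 0.
Proof.
move=> sd td sNt st; rewrite /facesign (negbTE sNt) mulr0n subr0 big1// => u.
rewrite inE => /eqP ud.
have [us|_] := boolP (u \subset s); last by rewrite !mul0r.
have [ut|_] := boolP (u \subset t); last by rewrite mulr0 mul0r.
have uI : (d.-1 <= #|s :&: t|)%N by rewrite -ud subset_leq_card// subsetI us.
have := cardsUI s t; rewrite sd td => E.
have : (d <= #|s :|: t|)%N by rewrite -sd subset_leq_card// subsetUl.
rewrite leq_eqVlt => /orP[/eqP sU|dU].
  have sE : s = s :|: t by apply/eqP; rewrite eqEcard subsetUl -sU sd /=.
  by move: sNt; rewrite eq_sym eqEcard sd td leqnn andbT sE subsetUr.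
by exfalso; move: st; rewrite neq_ltn; lia.
Qed.

Lemma facemx_sym : facemx^T = facemx.
Proof. by apply/matrixP => a b; rewrite !mxE facesignC. Qed.

Lemma facemx_sqr t a b : t \in lines -> a != b -> a \in faces t -> b \in faces t ->
  facemx a b ^+ 2 = 1.
Proof.
move=> tl ab at_ bt; rewrite mxE facesign_adj_sqr ?card_cellv//.
by rewrite (cellv_union tl ab at_ bt); apply/eqP; rewrite -mem_lines.
Qed.

End Signs.
End Faces.

(** * Orientations encoded by signs of Vandermonde products *)

Section OrientationSigns.
Import mathcomp.boot.finset.
Variable n : nat.
Implicit Types (s t : {set 'I_n}) (v : 'I_n).

(** Permuting the ordering multiplies this Vandermonde product of the vertex labels by the sign of
    the permutation, so the vertex set and the sign of [vdm] together determine an orientation. *)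
Definition vdm k (y : k.-tuple 'I_n) : int :=
  \prod_(i < k) \prod_(j < k | (i < j)%N) ((tnth y j)%:Z - (tnth y i)%:Z).

Definition vset k (y : k.-tuple 'I_n) : {set 'I_n} := [set v in y].

Lemma vdm_reorder k (y : k.-tuple 'I_n) (q : 'S_k) :
  vdm (reorder y q) = (-1) ^+ q * vdm y.
Proof.
have E (z : k.-tuple 'I_n) : vdm z =
    \det (Vandermonde k (\row_j (tnth z j)%:Z)).
  rewrite det_Vandermonde; apply: eq_bigr => i _; apply: eq_bigr => j _.
  by rewrite !mxE.
rewrite !E -[Vandermonde k (\row_j (tnth y j)%:Z)]trmxK det_tr.
rewrite -det_perm -det_mulmx -[in LHS]det_tr -row_permE; congr (\det _).
by apply/matrixP => i j; rewrite !mxE tnth_mktuple.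
Qed.

Lemma vset_reorder k (y : k.-tuple 'I_n) (q : 'S_k) : vset (reorder y q) = vset y.
Proof.
apply/setP => v; rewrite !inE; apply/tnthP/tnthP => -[i ->].
  by exists (q i); rewrite tnth_mktuple.
by exists ((q^-1)%g i); rewrite tnth_mktuple permKV.
Qed.

Lemma uniq_vset k (y : k.-tuple 'I_n) : uniq y = (#|vset y| == k).
Proof.
rewrite cardsE; apply/idP/eqP => [/card_uniqP ->|e]; first exact: size_tuple.
by apply/card_uniqP; rewrite e size_tuple.
Qed.

Lemma vdm_neq0 k (y : k.-tuple 'I_n) : uniq y -> vdm y != 0.
Proof.
move=> uy; apply/prodf_neq0 => i _; apply/prodf_neq0 => j ij.
rewrite subr_eq0; apply: contraTneq ij => -[] /val_inj.
by move=> /(tuple_uniqP _ uy) ->; rewrite ltnn.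
Qed.

Definition ori k s (e : int) : {set k.-tuple 'I_n} :=
  [set y | (vset y == s) && (sgz (vdm y) == e)].

Lemma reorderP k (x y : k.-tuple 'I_n) : uniq x -> vset y = vset x ->
  exists q : 'S_k, y = reorder x q.
Proof.
move=> ux xy; have uy : uniq y by rewrite uniq_vset xy -uniq_vset.
have /tuple_permP[q E] : perm_eq y x.
  by apply: uniq_perm => // v; have /setP/(_ v) := xy; rewrite !inE.
by exists q; apply: val_inj.
Qed.

Lemma sgz_sign (b : bool) (m : int) : sgz ((-1) ^+ b * m) = (-1) ^+ b * sgz m.
Proof. by case: b; rewrite ?expr1 ?expr0 ?mulN1r ?mul1r// sgzN. Qed.

Lemma orientationE k (x : k.-tuple 'I_n) : uniq x ->
  orientation x = ori k (vset x) (sgz (vdm x)).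
Proof.
move=> ux; apply/setP => y; rewrite inE; apply/imsetP/andP => [[q]|[/eqP yx]].
  rewrite inE => /negbTE qe ->.
  by rewrite vset_reorder vdm_reorder qe expr0 mul1r !eqxx.
have [q ->] := reorderP ux yx; rewrite vdm_reorder sgz_sign => e.
exists q => //; rewrite inE; apply/negP => qo.
move: e; rewrite qo expr1 mulN1r -subr_eq0 -opprD oppr_eq0 -mulr2n mulrn_eq0 /=.
by rewrite sgz_eq0 (negbTE (vdm_neq0 ux)).
Qed.

Lemma reorder_tperm k (y : k.-tuple 'I_n) i j :
  reorder (reorder y (tperm i j)) (tperm i j) = y.
Proof. by apply: eq_from_tnth => a; rewrite !tnth_mktuple tpermK. Qed.

Lemma oppositeE k s e : (2 <= k)%N ->
  opposite (ori k s e) = ori k s (- e).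
Proof.
move=> k2; apply/setP => y; rewrite inE; apply/imset2P/andP.
  case=> x q; rewrite !inE => /andP[/eqP xs /eqP xe] qo ->.
  by rewrite vset_reorder vdm_reorder qo expr1 mulN1r sgzN xs xe !eqxx.
move=> [/eqP ys /eqP ye].
(* A transposition, available since k >= 2, maps an ordering of sign -e to one of sign e. *)
pose i0 := Ordinal (ltnW k2); pose i1 := Ordinal k2.
have qo : odd_perm (tperm i0 i1) by rewrite odd_tperm.
exists (reorder y (tperm i0 i1)) (tperm i0 i1); rewrite ?reorder_tperm ?inE//.
by rewrite vset_reorder vdm_reorder qo expr1 mulN1r sgzN ye ys opprK !eqxx.
Qed.

Lemma vset_exists k s : #|s| = k -> exists2 y : k.-tuple 'I_n, vset y = s &
  sorted ltn (map val y).
Proof.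
move=> sk; have szs : size (enum s) == k by rewrite -cardE sk.
exists (Tuple szs); first by apply/setP => v; rewrite !inE mem_enum.
rewrite /= sorted_map /enum_mem; apply: sorted_filter; first exact: ltn_trans.
by rewrite -enumT -sorted_map val_enum_ord iota_ltn_sorted.
Qed.

Lemma vdm_sorted k (y : k.-tuple 'I_n) : sorted ltn (map val y) -> 0 < vdm y.
Proof.
move=> sy; apply: prodr_gt0 => i _; apply: prodr_gt0 => j ij.
rewrite subr_gt0 ltz_nat.
have sz : size (map val y) = k by rewrite size_map size_tuple.
have := sorted_ltn_nth ltn_trans 0%N sy i j; rewrite !inE sz => /(_ (ltn_ord i) (ltn_ord j) ij).
by rewrite !(nth_map (tnth y i)) ?size_tuple// -!tnth_nth.
Qed.

Lemma ori_neq0 k s e : (2 <= k)%N -> #|s| = k -> e = 1 \/ e = -1 ->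
  exists y, y \in ori k s e.
Proof.
move=> k2 sk ee; have [y ys /vdm_sorted y0] := vset_exists sk.
have y1 : y \in ori k s 1 by rewrite inE ys eqxx gtr0_sgz.
case: ee => ->; first by exists y.
have := oppositeE s 1 k2; move=> <-.
pose i0 := Ordinal (ltnW k2); pose i1 := Ordinal k2.
exists (reorder y (tperm i0 i1)); apply/imset2P.
by exists y (tperm i0 i1); rewrite ?inE ?odd_tperm//; move: y1; rewrite inE.
Qed.

Lemma ori_inj k s t e f : (2 <= k)%N -> #|s| = k -> e = 1 \/ e = -1 ->
  ori k s e = ori k t f -> s = t /\ e = f.
Proof.
move=> k2 sk ee E; have [y ys] := ori_neq0 k2 sk ee.
by have := ys; rewrite E; move: ys; rewrite !inE => /andP[/eqP -> /eqP ->] /andP[/eqP -> /eqP ->].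
Qed.

(* (-1)^r where r is the number of elements of [s] below [v]. *)
Definition rank_sign s v : int := \prod_(x in s :\ v) sgz (x%:Z - v%:Z).

Lemma rank_sign_cases s v : rank_sign s v = 1 \/ rank_sign s v = -1.
Proof.
rewrite /rank_sign; elim/big_rec: _ => [|x y]; first by left.
rewrite !inE => /andP[xv _] yE.
have : x%:Z - v%:Z != 0 by rewrite subr_eq0; apply: contra xv => /eqP[] /val_inj ->.
rewrite -sgz_eq0; case: sgzP => // _ _; case: yE => ->; rewrite ?mul1r ?mulN1r ?opprK; by [left|right].
Qed.

Lemma vset_delete k (t : k.+1.-tuple 'I_n) i : uniq t ->
  vset (delete_vertex t i) = vset t :\ tnth t i.
Proof.
move=> ut; apply/setP => v; rewrite !inE; apply/tnthP/andP.
  case=> j ->; rewrite tnth_mktuple; split; last exact: mem_tnth.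
  by rewrite (inj_eq (tuple_uniqP _ ut)) eq_sym neq_lift.
case=> vi /tnthP[j vj]; move: vi; rewrite vj (inj_eq (tuple_uniqP _ ut)).
rewrite eq_sym => /unlift_some[j' ji _].
by exists j'; rewrite tnth_mktuple ji.
Qed.

Lemma uniq_delete k (t : k.+1.-tuple 'I_n) i : uniq t -> uniq (delete_vertex t i).
Proof.
move=> ut; apply/tuple_uniqP => a b; rewrite !tnth_mktuple.
by move=> /(tuple_uniqP _ ut) /lift_inj.
Qed.

(** Moving vertex [i] to the front is a permutation of sign (-1)^i. In the reordered product the
    factors containing the first vertex have sign [rank_sign], and the others form [vdm] of the
    remaining ordering. *)
Lemma sgz_vdm_delete k (t : k.+1.-tuple 'I_n) (i : 'I_k.+1) : uniq t ->
  (-1) ^+ odd i * sgz (vdm (delete_vertex t i)) =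
  sgz (vdm t) * rank_sign (vset t) (tnth t i).
Proof.
move=> ut; have ud := uniq_delete i ut.
have := vdm_reorder t (lift_perm ord0 i 1).
rewrite odd_lift_perm odd_perm1 addbF /= => E.
have E2 : vdm (reorder t (lift_perm ord0 i 1)) =
    (\prod_(j < k) ((tnth (delete_vertex t i) j)%:Z - (tnth t i)%:Z)) *
    vdm (delete_vertex t i).
  rewrite /vdm big_ord_recl; congr (_ * _).
    rewrite big_mkcond big_ord_recl /= mul1r; apply: eq_bigr => j _.
    by rewrite !tnth_mktuple lift_perm_id lift_perm_lift perm1.
  apply: eq_bigr => a _; rewrite big_mkcond big_ord_recl /= mul1r [RHS]big_mkcond.
  apply: eq_bigr => b _; rewrite !tnth_mktuple !lift_perm_lift !perm1.
  by rewrite /= /bump !leq0n !add1n ltnS.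
have E3 : sgz (\prod_(j < k) ((tnth (delete_vertex t i) j)%:Z - (tnth t i)%:Z)) =
    rank_sign (vset t) (tnth t i).
  rewrite (big_morph _ (@sgzM _) (@sgz1 _)) /rank_sign -vset_delete//.
  rewrite -(big_tuple _ _ (delete_vertex t i) xpredT (fun x : 'I_n => sgz (x%:Z - (tnth t i)%:Z))).
  rewrite big_uniq//=; apply: eq_bigl => x; by rewrite inE.
move/(congr1 (@sgz int)): E; rewrite E2 sgzM E3 sgz_sign => E.
move: E; move: (sgz (vdm _)) (sgz (vdm _)) => D V.
by case: (rank_sign_cases (vset t) (tnth t i)) => ->; case: (odd i);
  rewrite ?expr1 ?expr0; lia.
Qed.

Lemma oriented_boundaryE k (t : k.+1.-tuple 'I_n) : (2 <= k)%N -> uniq t ->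
  oriented_boundary t =
  [set ori k (vset t :\ v) (sgz (vdm t) * rank_sign (vset t) v) | v in vset t].
Proof.
move=> k2 ut.
have E (i : 'I_k.+1) : (if odd i then opposite (orientation (delete_vertex t i))
     else orientation (delete_vertex t i)) =
    ori k (vset t :\ tnth t i) (sgz (vdm t) * rank_sign (vset t) (tnth t i)).
  rewrite -sgz_vdm_delete// -vset_delete// orientationE ?uniq_delete//.
  by case: (odd i); rewrite ?oppositeE// ?expr1 ?mulN1r ?expr0 ?mul1r.
apply/setP => c; apply/imsetP/imsetP.
  by case=> i _ ->; exists (tnth t i); rewrite ?E// inE mem_tnth.
by case=> v; rewrite inE => /tnthP[i ->] ->; exists i.
Qed.

End OrientationSigns.

(** * Entries of the signed adjacency matrix *)

Section SignedAdjacency.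
Import mathcomp.boot.finset.
Variables (n d : nat) (X : {set {set 'I_n}}).
Hypothesis d2 : (2 <= d)%N.
Implicit Types (s t : {set 'I_n}) (v : 'I_n).

Lemma positive_cellsE :
  positive_cells X d = [set ori d s 1 | s in cells X d.-1].
Proof.
have sorted_ori (x : d.-tuple 'I_n) : sorted ltn (map val x) ->
    uniq x /\ orientation x = ori d (vset x) 1.
  move=> sx; have ux : uniq x.
    by rewrite -(map_inj_uniq val_inj); apply: sorted_uniq sx; [exact: ltn_trans|exact: ltnn].
  by split=> //; rewrite orientationE// gtr0_sgz// vdm_sorted.
apply/setP => c; apply/imsetP/imsetP.
  case=> x; rewrite inE => /andP[/sorted_ori[ux ->] xX] ->; exists (vset x) => //.
  by rewrite inE xX (prednK (ltnW d2)) -uniq_vset.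
case=> s; rewrite inE (prednK (ltnW d2)) => /andP[sX /eqP sd] ->.
have [x xs sx] := vset_exists sd; exists x; first by rewrite inE sx -/(vset x) xs.
by have [_ ->] := sorted_ori _ sx; rewrite xs.
Qed.

Lemma sqr_sgz1 (m : int) : m != 0 -> sgz m ^+ 2 = 1.
Proof. by rewrite -sgz_eq0; case: sgzP. Qed.

(** The comparison of v with w enters the two factors on the left with opposite signs, and all other
    comparisons already take place in the two faces. A sign depending on the d-cell is thus replaced
    by a product of signs attached to its faces. *)
Lemma rank_sign_pair t v w : v \in t -> w \in t -> v != w ->
  rank_sign t v * rank_sign t w = - (rank_sign (t :\ w) v * rank_sign (t :\ v) w).
Proof.
move=> vt wt vw.
have E (a b : 'I_n) : b \in t -> a != b ->
    rank_sign t a = sgz (b%:Z - a%:Z) * rank_sign (t :\ b) a.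
  move=> bt ab; rewrite /rank_sign (big_setD1 b) /=; last by rewrite !inE eq_sym ab.
  by congr (_ * _); apply: eq_bigl => x; rewrite !inE andbCA.
rewrite (E v w)// (E w v)// 1?eq_sym// mulrACA.
have -> : sgz (w%:Z - v%:Z) * sgz (v%:Z - w%:Z) = -1.
  rewrite -[v%:Z - _]opprB sgzN mulrN -expr2 sqr_sgz1// subr_eq0.
  by apply: contra vw => /eqP[] /val_inj ->.
by rewrite mulN1r.
Qed.

Lemma union_pair s s' : #|s| = d -> #|s'| = d -> #|s :|: s'| = d.+1 ->
  exists v w, [/\ v \in s :|: s', w \in s :|: s', v != w,
    s = (s :|: s') :\ v & s' = (s :|: s') :\ w].
Proof.
move=> sd s'd st.
have D (a b : {set 'I_n}) : #|a| = d -> #|a :|: b| = d.+1 ->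
    exists2 x, x \in b :\: a & a = (a :|: b) :\ x.
  move=> ad ab; have /eqP/cards1P[x xE] : #|(a :|: b) :\: a| = 1%N.
    by rewrite cardsD (setIidPr _) ?subsetUl// ab ad subSnn.
  have xb : x \in b :\: a.
    by have := set11 x; rewrite -xE !inE; case: (x \in a).
  by exists x => //; rewrite -xE setDDr setDv set0U; apply/esym/setIidPr; exact: subsetUl.
have [v vs' sE] := D _ _ sd st.
have [w ws s'E] := D s' s s'd (etrans (congr1 (fun A : {set 'I_n} => #|A|) (setUC _ _)) st).
exists v, w; rewrite [in s' = _]setUC -s'E -sE; split=> //.
- by move: vs'; rewrite !inE => /andP[_ ->]; rewrite orbT.
- by move: ws; rewrite !inE => /andP[_ ->].
- by apply: contraTneq vs' => ->; move: ws; rewrite !inE => /andP[/negbTE -> ->].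
Qed.

(** If m is the orientation sign of the d-cell, the two boundary conditions read m rank_sign(v) = 1
    and m rank_sign(w) = -e; eliminating m leaves the product. Conversely m = rank_sign(v) works. *)
Lemma oriented_adjacentE s s' v w (e : int) : e = 1 \/ e = -1 ->
  v \in s :|: s' -> w \in s :|: s' -> v != w ->
  #|s| = d -> #|s'| = d -> s = (s :|: s') :\ v -> s' = (s :|: s') :\ w ->
  oriented_adjacent X (ori d s 1) (ori d s' e) =
  (s :|: s' \in cells X d) &&
  (rank_sign (s :|: s') v * rank_sign (s :|: s') w == - e).
Proof.
move=> ee; set t := s :|: s' => vt wt vw sd s'd sE s'E.
have tv (A : {set 'I_n}) x y : x \in A -> A :\ x = A :\ y -> x = y.
  move=> xt /setP/(_ x); rewrite !inE eqxx xt /= andbT => /esym/negbT.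
  by rewrite negbK => /eqP.
have eN : - e = 1 \/ - e = -1 by case: ee => ->; [right|left; rewrite opprK].
apply/existsP/andP.
  case=> x /and4P[ux xX]; rewrite oppositeE//.
  rewrite oriented_boundaryE// => /imsetP[a ax E1] /imsetP[b bx E2].
  have [s1 e1] := ori_inj d2 sd (or_introl erefl) E1.
  have [s2 e2] := ori_inj d2 s'd eN E2.
  have ab : a != b.
    apply: contra vw => /eqP ab; apply/eqP; apply: (tv t) => //.
    by rewrite -sE -s'E s1 s2 ab.
  have tx : t = vset x.
    rewrite /t s1 s2; apply/setP => y; rewrite !inE -andb_orl.
    case: (eqVneq y a) => [->|]; last by rewrite /=.
    by rewrite ab.
  have va : v = a by apply: (tv t) => //; rewrite -sE tx s1.
  have wb : w = b by apply: (tv t) => //; rewrite -s'E tx s2.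
  rewrite tx; split; first exact: xX.
  rewrite va wb e2; have: sgz (vdm x) ^+ 2 = 1 by rewrite sqr_sgz1// vdm_neq0.
  move: e1; set r := rank_sign _ a; set q := rank_sign _ b; set m := sgz _ => e1 m2.
  by have -> : r = m by rewrite -[r]mul1r -m2 expr2 -mulrA -e1 mulr1.
case=> tX /eqP pr.
have td : #|t| = d.+1 by move: tX; rewrite inE => /andP[_ /eqP].
have [x] := ori_neq0 (leqW d2) td (rank_sign_cases t v).
rewrite inE => /andP[/eqP xt /eqP xe].
have ux : uniq x by rewrite uniq_vset xt td.
exists x; rewrite ux oppositeE// oriented_boundaryE// xt xe.
have rv2 : rank_sign t v * rank_sign t v = 1.
  by case: (rank_sign_cases t v) => ->; rewrite ?mulr1 ?mulrNN ?mulr1.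
apply/and4P; split=> //.
- by rewrite -/(vset x) xt.
- by apply/imsetP; exists v => //; rewrite rv2 -sE.
- by apply/imsetP; exists w => //; rewrite pr -s'E.
Qed.

(** For a face u of s this is the sign of the only vertex of s outside u, that is the incidence
    number of u in the boundary of s; the product makes it a sign for all pairs. *)
Definition cell_sign (R : pzRingType) (u s : {set 'I_n}) : R :=
  (\prod_(v in s :\: u) rank_sign s v)%:~R.

Lemma cell_sign_sqr (R : pzRingType) u s : cell_sign R u s ^+ 2 = 1.
Proof.
rewrite /cell_sign -rmorphXn /= (_ : _ ^+ 2 = 1)// -prodrXl big1// => v _.
by case: (rank_sign_cases s v) => ->; rewrite ?sqrrN expr1n.
Qed.

(** Adjacency compares signs within the common d-cell; [rank_sign_pair] expresses them through
    [cell_sign] at the intersection of the two cells, which is the Gram form of [facesign]. *)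
Lemma signed_entry (R : comNzRingType) s s' :
  s \in cells X d.-1 -> s' \in cells X d.-1 ->
  (if ori d s 1 == ori d s' 1 then 0
   else if oriented_adjacent X (ori d s 1) (ori d s' 1) then 1
   else if oriented_adjacent X (ori d s 1) (opposite (ori d s' 1)) then -1
   else 0 : R) =
  facesign d (cell_sign R) s s' * (s :|: s' \in cells X d)%:R.
Proof.
rewrite !inE !(prednK (ltnW d2)) => /andP[sX /eqP sd] /andP[s'X /eqP s'd].
have [E|ss'] := eqVneq s s'.
  by rewrite E eqxx facesign_diag ?mul0r// => u t; exact: cell_sign_sqr.
rewrite ifF; last first.
  apply/negbTE/eqP => /(ori_inj d2 sd (or_introl erefl))[] E.
  by move: ss'; rewrite E eqxx.
have [st|st] := eqVneq #|s :|: s'| d.+1; last first.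
  have nadj e : oriented_adjacent X (ori d s 1) (ori d s' e) = false \/ ~ (e = 1 \/ e = -1).
    have [ee|] := pselect (e = 1 \/ e = -1); [left|by right].
    apply/negbTE/existsP => -[x /and4P[ux xX]]; rewrite oppositeE//.
    have eN : - e = 1 \/ - e = -1 by case: ee => ->; [right|left; rewrite opprK].
    rewrite oriented_boundaryE// => /imsetP[a ax E1] /imsetP[b bx E2].
    have [s1 _] := ori_inj d2 sd (or_introl erefl) E1.
    have [s2 _] := ori_inj d2 s'd eN E2.
    move: st; rewrite s1 s2.
    have ab : a != b by apply: contra ss' => /eqP ab; rewrite s1 s2 ab.
    have -> : vset x :\ a :|: vset x :\ b = vset x.
      apply/setP => y; rewrite !inE -andb_orl.
      by case: (eqVneq y a) => [->|]; rewrite ?ab.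
    by rewrite -uniq_vset ux.
  have [->|[]] := nadj 1; last by left.
  rewrite oppositeE//; have [->|[]] := nadj (-1); last by right.
  by rewrite andbF mulr0.
have [v [w [vt wt vw sE s'E]]] := union_pair sd s'd st.
rewrite oppositeE// !(oriented_adjacentE _ vt wt vw sd s'd sE s'E); try by [left|right].
rewrite !inE st eqxx !andbT; case: (s :|: s' \in X) => /=; last by rewrite mulr0.
rewrite facesign_adj// mulr1 /cell_sign -rmorphM /=.
have memE y : (y \in s) = (y != v) && ((y \in s) || (y \in s')).
  by have /setP/(_ y) := sE; rewrite !inE.
have memE' y : (y \in s') = (y != w) && ((y \in s) || (y \in s')).
  by have /setP/(_ y) := s'E; rewrite !inE.
have D1 : s :\: (s :&: s') = [set w].
  apply/setP => y; have := memE' y; rewrite !inE.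
  case: (eqVneq y w) => [->|_] /=; last by case: (y \in s); case: (y \in s').
  by move: wt; rewrite inE => /orP[] -> // ->.
have D2 : s' :\: (s :&: s') = [set v].
  apply/setP => y; have := memE y; rewrite !inE.
  case: (eqVneq y v) => [->|_] /=; last by case: (y \in s); case: (y \in s').
  by move: vt; rewrite inE => /orP[] -> // ->.
rewrite D1 D2 !big_set1.
have := rank_sign_pair vt wt vw; rewrite -sE -s'E => ->.
rewrite eqr_opp opprK [X in _ = X%:~R]mulrC.
by case: (rank_sign_cases s w) => ->; case: (rank_sign_cases s' v) => ->.
Qed.

End SignedAdjacency.

(** * Convergence of padded empirical measures *)

Section EmpiricalMeasure.
Variable R : realType.

Lemma integral_empirical N (M : 'M[R]_N) (f : R -> R) : (0 < N)%N -> M^T = M ->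
  bounded_continuous f ->
  (\int[empirical_spectral_measure M]_x (f x)%:E =
   (list_mean (eigenvalues M) f)%:E)%E.
Proof.
move=> N0 sM [cf [C fC]].
have mf : measurable_fun [set: measurableTypeR R] (EFin \o f).
  by apply/measurable_EFinP; exact: continuous_measurable_fun.
have ge0 (h : R -> \bar R) : measurable_fun [set: measurableTypeR R] h ->
    (forall x, 0 <= h x)%E ->
    (\int[empirical_spectral_measure M]_x h x =
     (N%:R^-1)%:E * \sum_(x <- eigenvalues M) h x)%E.
  move=> mh h0; rewrite /empirical_spectral_measure gtn_eqF//=.
  rewrite ge0_integral_mscale//= ge0_integral_measure_sum//.
  congr (_ * _)%E; rewrite (big_nth 0) size_eigenvalues// big_mkord.
  by apply: eq_bigr => i _; rewrite integral_dirac// diracT mul1e.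
rewrite integralE ge0//; last exact: measurable_funepos.
rewrite ge0//; last exact: measurable_funeneg.
have fp x : ((fun x => (f x)%:E)^\+ x = (Num.max (f x) 0)%:E)%E.
  by rewrite funeposE EFin_max.
have fn x : ((fun x => (f x)%:E)^\- x = (Num.max (- f x) 0)%:E)%E.
  by rewrite funenegE -EFinN EFin_max.
under eq_bigr do rewrite fp; under [X in (_ - _ * X)%E]eq_bigr do rewrite fn.
rewrite !sumEFin -!EFinM -EFinB; congr EFin.
rewrite -mulrBr -sumrB /list_mean size_eigenvalues//; congr (_ * _).
apply: eq_bigr => x _.
by rewrite !maxEle; case: (leP (f x) 0) => h1; case: (leP (- f x) 0) => h2; lra.
Qed.


Lemma bounded_continuous_cauchy b (de : R) : 0 < de ->
  bounded_continuous (cauchy_fun b de).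
Proof.
move=> de0; have D0 (x : R) : 0 < x ^+ 2 + de ^+ 2.
  by rewrite ltr_wpDl ?sqr_ge0// exprn_gt0.
split.
  move=> x; apply: cvgM; first by case: b; [exact: cvg_id|exact: cvg_cst].
  apply: cvgV; first by rewrite gt_eqF.
  by apply: cvgD; [exact: exprn_continuous|exact: cvg_cst].
exists (1 + de ^- 2) => x.
rewrite /cauchy_fun normrM [X in _ * X]ger0_norm ?invr_ge0 ?(ltW (D0 x))//.
rewrite ler_pdivrMr// mulrDl mul1r.
have de2 : 0 < de ^+ 2 by rewrite exprn_gt0.
have -> : de ^- 2 * (x ^+ 2 + de ^+ 2) = x ^+ 2 / de ^+ 2 + 1.
  by field; rewrite gt_eqF.
have q0 : 0 <= x ^+ 2 / de ^+ 2 by rewrite divr_ge0 ?sqr_ge0// ltW.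
case: b; last by rewrite normr1; have := sqr_ge0 x; lra.
rewrite -(ger0_norm (sqr_ge0 x)) normrX.
by have := sqr_ge0 (`|x| - 1); rewrite !expr2 in q0 de2 *; nra.
Qed.

Lemma semicircle_mean_cauchy_even (de : R) : 0 < de ->
  semicircle_mean (cauchy_fun false de) =
  (Num.sqrt (de ^+ 2 + 4) - de) / (2 * de).
Proof.
move=> de0; have bc := bounded_continuous_cauchy false de0.
apply: EFin_inj; rewrite -semicircle_meanE// integral_semicircle_law//.
rewrite -integral_semicircle_even//; apply: eq_integral => x _.
by rewrite /cauchy_fun mul1r.
Qed.

Lemma semicircle_mean_cauchy_odd (de : R) : 0 < de ->
  semicircle_mean (cauchy_fun true de) = 0.
Proof.
move=> de0; have bc := bounded_continuous_cauchy true de0.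
apply: EFin_inj; rewrite -semicircle_meanE// integral_semicircle_law//.
exact: integral_semicircle_odd.
Qed.

Section Padded.
Variables (N N' : nat -> nat) (M : forall n, 'M[R]_(N' n)).
Hypothesis sM : forall n, (M n)^T = M n.
Hypothesis N'N : \forall n \near \oo, (N' n <= N n)%N.
Hypothesis N0 : \forall n \near \oo, (0 < N n)%N.

Definition padded n : seq R := eigenvalues (M n) ++ nseq (N n - N' n) 0.

Lemma size_padded n : (N' n <= N n)%N -> size (padded n) = N n.
Proof. by move=> nn; rewrite size_cat size_nseq size_eigenvalues// subnKC. Qed.

Lemma list_mean_padded n f : (N' n <= N n)%N ->
  (N n)%:R * list_mean (padded n) f =
  (N' n)%:R * list_mean (eigenvalues (M n)) f + (N n - N' n)%N%:R * f 0.
Proof.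
move=> nn; rewrite /list_mean size_padded// size_eigenvalues//.
have E k (s : seq R) : size s = k -> k%:R * (k%:R^-1 * \sum_(x <- s) f x) = \sum_(x <- s) f x.
  move=> <-; have [/size0nil ->|s0] := eqVneq (size s) 0%N; first by rewrite big_nil !mulr0.
  by rewrite mulVKf// pnatr_eq0.
rewrite !E ?size_padded ?size_eigenvalues//.
by rewrite /padded big_cat big_nseq iter_addr_0 -[_ *+ _]mulr_natl.
Qed.

Hypothesis cvg_padded : forall b (q : rat), 0 <= q ->
  list_mean (padded n) (cauchy_fun b (3 + ratr q)) @[n --> \oo] -->
  semicircle_mean (cauchy_fun b (3 + ratr q) : R -> R).

Lemma padded_cvg f : bounded_continuous f -> mean_cvg padded f.
Proof.
apply: mean_cvg_bounded_continuous.
  by near=> n; rewrite size_padded; near: n.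
move=> b q q0; split; last exact: cvg_padded.
by apply: bounded_continuous_cauchy; rewrite ltr_pwDl// ler0q.
Unshelve. all: by end_near. Qed.

(** The function de^2/(x^2 + de^2) is nonnegative and 1 at 0, so its padded mean is at least the
    proportion of padding, while its semicircle mean is at most de. This is where the absence of an
    atom at 0 is used, with de = e/2. *)
Lemma padding_ratio_cvg0 : (N n - N' n)%N%:R / (N n)%:R @[n --> \oo] --> (0 : R).
Proof.
apply/cvgrPdist_le => e e0.
have [bc cc] := padded_cvg (bounded_continuousZ ((e / 2) ^+ 2)
   (bounded_continuous_cauchy false (divr_gt0 e0 (ltr0n R 2)))).
have de0 : 0 < e / 2 by rewrite divr_gt0.
set de := e / 2 in de0 cc bc.
have mu_le : semicircle_mean (fun x => de ^+ 2 * cauchy_fun false de x) <= de.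
  rewrite semicircle_meanZ; last exact: bounded_continuous_cauchy.
  rewrite semicircle_mean_cauchy_even//.
  have s2 : Num.sqrt (de ^+ 2 + 4) <= de + 2.
    rewrite -[leRHS]ger0_norm ?addr_ge0 ?(ltW de0)// -sqrtr_sqr ler_sqrt ?sqr_ge0//.
    by rewrite !expr2; nra.
  have -> : de ^+ 2 * ((Num.sqrt (de ^+ 2 + 4) - de) / (2 * de)) =
     de * ((Num.sqrt (de ^+ 2 + 4) - de) / 2) by field; rewrite gt_eqF.
  by rewrite ler_piMr ?(ltW de0)//; lra.
move/cvgrPdist_le : cc => /(_ _ de0) cc.
near=> n.
have nn : (N' n <= N n)%N by near: n.
have n0 : (0 < N n)%N by near: n.
have h : `|semicircle_mean (fun x => de ^+ 2 * cauchy_fun false de x) -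
  list_mean (padded n) (fun x => de ^+ 2 * cauchy_fun false de x)| <= de by near: n.
have q0 : 0 <= (N n - N' n)%N%:R / (N n)%:R :> R by rewrite divr_ge0.
rewrite sub0r normrN ger0_norm//.
have Nn0 : (N n)%:R != 0 :> R by rewrite pnatr_eq0 -lt0n.
apply: le_trans (_ : list_mean (padded n) (fun x => de ^+ 2 * cauchy_fun false de x) <= _).
  rewrite ler_pdivrMr ?ltr0n// mulrC list_mean_padded//.
  rewrite /cauchy_fun expr0n add0r mul1r mulfV ?mulr1; last by rewrite expf_neq0// gt_eqF.
  rewrite lerDr mulr_ge0//; apply: le_trans (_ : list_mean (eigenvalues (M n)) (fun=> 0) <= _).
    by rewrite /list_mean big1// mulr0.
  apply: ler_list_mean => x; rewrite mul1r mulr_ge0 ?sqr_ge0// invr_ge0 addr_ge0 ?sqr_ge0//.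
by move: h; rewrite ler_norml => /andP[h _]; rewrite /de in h mu_le *; lra.
Unshelve. all: by end_near. Qed.

(** The empirical mean is (m - q f(0))/(1 - q), where m is the padded mean and q the proportion of
    padding. Once q <= 1/2 the matrix is not empty, so the convention for dimension 0 concerns only
    finitely many n. *)
Lemma weak_cvg_of_padded :
  weak_cvg (fun n => empirical_spectral_measure (M n)) (@semicircle_law R).
Proof.
move=> f cf bf; have bc : bounded_continuous f by split.
have [_ cc] := padded_cvg bc.
have cq := padding_ratio_cvg0.
rewrite semicircle_meanE//.
pose q n : R := (N n - N' n)%N%:R / (N n)%:R.
have cu : (list_mean (padded n) f - q n * f 0) * (1 - q n)^-1 @[n --> \oo] -->
    (semicircle_mean f - 0 * f 0) * (1 - 0)^-1.
  apply: cvgM; first by apply: cvgB => //; apply: cvgM => //; exact: cvg_cst.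
  apply: cvgV; first by rewrite subr0 oner_eq0.
  by apply: cvgB => //; exact: cvg_cst.
rewrite mul0r subr0 subr0 invr1 mulr1 in cu.
have key : \forall n \near \oo,
    (\int[empirical_spectral_measure (M n)]_x (f x)%:E)%E =
    ((list_mean (padded n) f - q n * f 0) * (1 - q n)^-1)%:E.
  have /cvgrPdist_le /(_ (1 / 2) (divr_gt0 ltr01 (ltr0n R 2))) hq := cq.
  near=> n.
  have nn : (N' n <= N n)%N by near: n.
  have n0 : (0 < N n)%N by near: n.
  have : `|0 - q n| <= 1 / 2 by near: n.
  rewrite sub0r normrN => /(le_trans (ler_norm _)) qn.
  have Nn0 : (N n)%:R != 0 :> R by rewrite pnatr_eq0 -lt0n.
  have qE : 1 - q n = (N' n)%:R / (N n)%:R.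
    by rewrite /q natrB// mulrBl mulfV// opprB addrC subrK.
  have N'0 : (0 < N' n)%N.
    by rewrite lt0n; apply: contraTneq qn => N'0; move: qE; rewrite N'0 mul0r; lra.
  have N'n0 : (N' n)%:R != 0 :> R by rewrite pnatr_eq0 -lt0n.
  rewrite integral_empirical//; congr EFin.
  have E := list_mean_padded f nn.
  have -> : list_mean (padded n) f = (N n)%:R^-1 * ((N' n)%:R *
      list_mean (eigenvalues (M n)) f + (N n - N' n)%N%:R * f 0).
    by rewrite -E mulKf.
  by rewrite qE /q; field; rewrite Nn0.
apply: cvg_EFin.
  by apply: filterS key => n ->.
apply: cvg_trans cu; apply: near_eq_cvg.
by apply: filterS key => n /= ->.
Unshelve. all: by end_near. Qed.

End Padded.

End EmpiricalMeasure.

(** * The extended adjacency matrix *)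

Lemma double_le_bounds n d : (2 <= d)%N -> (2 * d <= n)%N ->
  [/\ (0 < d)%N, (0 < n)%N, (d <= n)%N & (n <= 2 * (n - d.-1))%N].
Proof. by move=> d2 n2d; split; lia. Qed.

Section FullMatrix.
Import mathcomp.boot.finset.
Variables (R : realType) (n d : nat).
Variable sg : {set 'I_n} -> {set 'I_n} -> R.
Hypothesis d2 : (2 <= d)%N.
Hypothesis sg1 : forall u s, sg u s ^+ 2 = 1.
Implicit Types (s t : {set 'I_n}) (S : {ffun {set 'I_n} -> bool}).

Local Notation N := #|ksets n d|.
Local Notation l := (enum (ksets n d.+1)).
Local Notation F := (@faces n d).
Local Notation W := (facemx d sg).
Local Notation K := (d.+1%:R : R).

(* The adjacency matrix indexed by all d-subsets of the vertices, whether they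
   are cells of the complex or not. *)
Definition full_adjacency S : 'M[R]_N := \sum_(t <- l) (S t)%:R *: block F W t.

Lemma full_adjacencyE S a b : full_adjacency S a b =
  facesign d sg (cellv a) (cellv b) *
  ((#|cellv a :|: cellv b| == d.+1) && S (cellv a :|: cellv b))%:R.
Proof.
rewrite summxE; have [ab|ab] := eqVneq a b.
  rewrite ab facesign_diag ?card_cellv// mul0r big1// => t _.
  by rewrite !mxE /inc eqxx mul0r mulr0.
have [cab|cab] /= := eqVneq #|cellv a :|: cellv b| d.+1; last first.
  rewrite mulr0 big_seq big1// => t tl; rewrite !mxE /inc ab /=.
  case: (boolP (a \in F t)) => at_; last by rewrite mul0r mulr0.
  case: (boolP (b \in F t)) => bt; last by rewrite mul0r mulr0.
  by move: cab; rewrite (cellv_union tl ab at_ bt) -mem_lines tl.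
have tl : cellv a :|: cellv b \in l by rewrite mem_lines cab.
rewrite (bigD1_seq _ tl (enum_uniq _)) /= big_seq_cond big1 ?addr0.
  rewrite !mxE /inc ab !inE subsetUl subsetUr mul1r mulrC.
  by [].
move=> t /andP[t'l tN]; rewrite !mxE /inc ab /=.
case: (boolP (a \in F t)) => at_; last by rewrite mul0r mulr0.
case: (boolP (b \in F t)) => bt; last by rewrite mul0r mulr0.
by move: tN; rewrite (cellv_union t'l ab at_ bt) eqxx.
Qed.

Lemma full_adjacency_center S (p h : R) : h *: full_adjacency S =
  ensemble l F W p h S + (h * p) *:
    (\sum_(u <- [seq facevec d sg u | u <- enum (ksets n d.-1)]) u *m u^T) +
  (- (h * p * d%:R))%:M.
Proof.
(* Every nonzero entry of [W] lies in exactly one block; the sum of all blocks is the case in which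
   all variables are true. *)
have WE : W = \sum_(t <- l) block F W t.
  have -> : \sum_(t <- l) block F W t = full_adjacency [ffun=> true].
    by apply: eq_bigr => t _; rewrite ffunE scale1r.
  apply/matrixP => a b; rewrite full_adjacencyE !mxE ffunE andbT.
  have [cab|cab] := eqVneq #|cellv a :|: cellv b| d.+1; first by rewrite mulr1.
  rewrite mulr0; have [ab|ab] := eqVneq a b.
    by rewrite ab facesign_diag// card_cellv.
  by rewrite facesign_far ?card_cellv// (inj_eq (@cellv_inj _ _)).
have GE := facemx_gram d sg.
have -> : \sum_(u <- [seq facevec d sg u | u <- enum (ksets n d.-1)]) u *m u^T =
   W + (d%:R)%:M by rewrite GE subrK.
rewrite -addrA; have -> : (h * p) *: (W + (d%:R)%:M) + (- (h * p * d%:R))%:M = (h * p) *: W.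
  by apply/matrixP => a b; rewrite !mxE; case: (a == b); rewrite ?mulr1n ?mulr0n; ring.
rewrite /ensemble [X in _ + _ *: X]WE -scalerA -scalerDr [p *: _]scaler_sumr -big_split /=; congr (_ *: _).
by apply: eq_bigr => t _; rewrite scalerBl subrK.
Qed.

Section Estimate.
Variables p h eta : R.
Hypothesis n2d : (2 * d <= n)%N.
Hypothesis p01 : 0 <= p <= 1.
Hypothesis h01 : 0 < h <= 1.
Hypothesis eta3 : 3 <= eta.
Hypothesis normalized : p * (1 - p) * h ^+ 2 * (n%:R * d%:R) = 1.
Hypothesis h_small : d%:R ^+ 2 * h <= 1.

Let h0 : 0 <= h. Proof. by case/andP: h01 => /ltW. Qed.
Let bounds := double_le_bounds d2 n2d.
Let dn : (d <= n)%N. Proof. by case: bounds. Qed.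
Let n0 : (n%:R : R) != 0. Proof. by rewrite pnatr_eq0 -lt0n; case: bounds. Qed.
Let d0 : (d%:R : R) != 0. Proof. by rewrite pnatr_eq0 -lt0n; case: bounds. Qed.

Let pq1 : 0 <= p * (1 - p) <= 1.
Proof. by case/andP: p01 => p0 p1; apply/andP; split; nra. Qed.

(** A d-set lies in n - d sets of size d + 1, not n, so the row variance falls short of 1 by d/n. *)
Let theta_eq : p * (1 - p) * h ^+ 2 * (n - d)%:R * d.+1.-1%:R = 1 - d%:R / n%:R.
Proof.
rewrite natrB//.
apply: (mulIf n0); rewrite /= mulrBl mul1r divfK//.
by rewrite -[RHS]mul1r -[X in _ = X * _]normalized; ring.
Qed.

(** The normalisation gives d/n = d^2 p (1 - p) h^2, and d^2 h <= 1 by [h_small]. *)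
Let inv_n_le : d%:R / n%:R <= h :> R.
Proof.
have -> : d%:R / n%:R = d%:R ^+ 2 * h * (p * (1 - p)) * h :> R.
  apply: (mulIf n0); rewrite divfK//; apply: (mulIf d0).
  transitivity (d%:R * (p * (1 - p) * h ^+ 2 * (n%:R * d%:R)) * d%:R).
    by rewrite normalized mulr1.
  by ring.
rewrite ler_piMl//; apply: mulr_ile1 => //; try by case/andP: pq1.
by rewrite mulr_ge0 ?sqr_ge0.
Qed.

Let theta1 : p * (1 - p) * h ^+ 2 * (n - d)%:R * d.+1.-1%:R <= 1.
Proof. by rewrite theta_eq gerBl divr_ge0. Qed.

Let lines_uniq : uniq l := enum_uniq _.
Let W1 t a b : t \in l -> a != b -> a \in F t -> b \in F t -> W a b ^+ 2 = 1.
Proof. exact: facemx_sqr. Qed.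

Definition mean_trace : complex R :=
  bexp p%:C%C l (fun T => \tr (resolvent (ensemble l F W p h T) eta)) [ffun=> false].

Definition fluctuation S : R :=
  normc (N%:R^-1 * (\tr (resolvent (ensemble l F W p h S) eta) - mean_trace)).

Let N_gt0 : (0 < N)%N.
Proof. by rewrite card_ksets bin_gt0. Qed.

Let normcV_nat : normc ((N%:R : complex R)^-1) = N%:R^-1.
Proof.
rewrite normcV; congr (_^-1).
by rewrite -(rmorph_nat (real_complex R)) normc_real ger0_norm.
Qed.

Lemma expectation_fluctuation :
  bexp p l (fun S => fluctuation S ^+ 2) [ffun=> false] <= K ^+ 4 / N%:R.
Proof.
have V := variance_trace lines_uniq (facemx_sym d sg) W1 (@card_faces n d)
  (@faces_degree n d) (ltnW d2) p01 h01 eta3 theta1 [ffun=> false].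
rewrite (_ : (fun S => _) = fun S => N%:R^-1 ^+ 2 *
   normc (\tr (resolvent (ensemble l F W p h S) eta) - mean_trace) ^+ 2); last first.
  by apply/funext => S; rewrite /fluctuation normcM normcV_nat exprMn.
rewrite bexpZ; apply: le_trans (_ : N%:R^-1 ^+ 2 * (K ^+ 4 * N%:R) <= _).
  by rewrite ler_wpM2l ?sqr_ge0.
have Nn0 : N%:R != 0 :> R by rewrite pnatr_eq0 -lt0n.
by rewrite le_eqVlt; apply/orP; left; apply/eqP; field.
Qed.

(** The errors are 27 K^10 h for the mean trace, 2 h for the perturbation of rank at most C(n, d -
    1) and d h for the multiple of the identity. *)
Lemma full_trace_close (g0 : complex R) S : normc g0 <= 1 ->
  1 + Complex 0 eta * g0 + g0 ^+ 2 = 0 ->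
  normc (N%:R^-1 * \tr (resolvent (h *: full_adjacency S) eta) - g0) <=
  fluctuation S + (27 * K ^+ 10 + 2 + d%:R) * h.
Proof.
move=> g01 g0E; have eta0 : 0 < eta by move: eta3; lra.
have Nn0 : (N%:R : complex R) != 0 by rewrite pnatr_eq0 -lt0n.
have NR0 : 0 < N%:R :> R by rewrite ltr0n.
have := mean_trace_resolvent lines_uniq (facemx_sym d sg) W1 (@card_faces n d)
  (@faces_line n d) (@faces_degree n d) (ltnW d2) p01 h01 eta3 theta1
  [ffun=> false] g01 g0E.
rewrite theta_eq opprB addrC subrK => /(_ inv_n_le); rewrite -/mean_trace => M.
have sE : (ensemble l F W p h S)^T = ensemble l F W p h S.
  by apply: ensemble_tr; exact: facemx_sym.
have Pt := trace_resolvent_perturb eta0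
  [seq facevec d sg u | u <- enum (ksets n d.-1)] (h * p) (- (h * p * d%:R)) sE.
rewrite -full_adjacency_center in Pt.
set A := \tr (resolvent (h *: _) eta) in Pt *.
set B := \tr (resolvent (ensemble _ _ _ _ _ S) eta) in Pt *.
have -> : N%:R^-1 * A - g0 = N%:R^-1 * (B - mean_trace) +
   N%:R^-1 * ((A - B) + (mean_trace - N%:R * g0)) by field.
apply: le_trans (le_normcD _ _) _; rewrite lerD2l normcM normcV_nat.
rewrite ler_pdivrMl//; apply: le_trans (le_normcD _ _) _.
have e1 : eta^-1 <= 1 by rewrite invf_le1//; move: eta3; lra.
have e2 : eta ^- 2 <= 1 by rewrite -exprVn exprn_ile1 ?invr_ge0 ?(ltW eta0).
(* C(n, d - 1)/C(n, d) = d/(n - d + 1) <= 2 d/n <= 2 h, as 2 d <= n. *)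
have s1 : (size [seq facevec d sg u | u <- enum (ksets n d.-1)])%:R / eta <=
    N%:R * (2 * h).
  rewrite size_map -cardE !card_ksets.
  apply: le_trans (_ : ('C(n, d.-1))%:R <= _); first by rewrite ler_piMr.
  have B1 : (d%:R * ('C(n, d))%:R = (n - d.-1)%:R * ('C(n, d.-1))%:R :> R).
    by rewrite -!natrM; congr _%:R; rewrite -{1 2}(prednK (ltnW d2)) mul_bin_left.
  have B2 : n%:R * ('C(n, d.-1))%:R <= 2 * (d%:R * ('C(n, d))%:R) :> R.
    by rewrite B1 mulrA ler_wpM2r// -natrM ler_nat; case: bounds.
  rewrite -(ler_pM2l (x := n%:R)) ?lt0r ?n0//=; apply: le_trans B2 _.
  have -> : n%:R * ('C(n, d)%:R * (2 * h)) = 2 * (n%:R * h * 'C(n, d)%:R) :> R by ring.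
  rewrite ler_pM2l// ler_wpM2r//.
  by have := inv_n_le; rewrite ler_pdivrMr ?lt0r ?n0//= mulrC.
have s2 : N%:R * (`|- (h * p * d%:R)| * eta ^- 2) <= N%:R * (d%:R * h).
  rewrite ler_wpM2l// normrN ger0_norm; last first.
    by case/andP: p01 => p0 _; rewrite !mulr_ge0.
  apply: le_trans (_ : h * p * d%:R <= _).
    by rewrite ler_piMr//; case/andP: p01 => p0 _; rewrite !mulr_ge0.
  rewrite mulrC ler_wpM2l// ler_piMr//; by case/andP: p01.
by have := lerD (le_trans Pt (lerD s1 s2)) M; move: (K ^+ 10) => K10; lra.
Qed.

End Estimate.
End FullMatrix.

(** * Embedding the cell-indexed matrices into the full matrix *)

Section CellMatrices.
Import mathcomp.boot.finset.
Variables (n d : nat).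
Hypothesis d2 : (2 <= d)%N.
Implicit Types (s t : {set 'I_n}) (X : {set {set 'I_n}}).

(* [M] is, up to the indexing [cell] of its rows and columns, the block of the
   adjacency matrix with signs [sg] given by the (d-1)-cells of [X]. *)
Definition cell_matrix (R : comNzRingType) (sg : {set 'I_n} -> {set 'I_n} -> R)
    X N' (M : 'M[R]_N') :=
  exists cell : 'I_N' -> {set 'I_n},
    [/\ injective cell, (forall s, s \in cells X d.-1 <-> exists i, cell i = s) &
      forall i j, M i j = facesign d sg (cell i) (cell j) *
        (cell i :|: cell j \in cells X d)%:R].

Lemma cell_matrix_adjacency (R : comNzRingType) X :
  cell_matrix (fun _ _ => 1) X (adjacency R X d).
Proof.
exists enum_val; split.
- exact: enum_val_inj.
- move=> s; split=> [sX|[i <-]]; last exact: enum_valP.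
  by exists (enum_rank_in sX s); rewrite enum_rankK_in.
move=> i j; rewrite mxE; have [st|] := boolP (_ \in cells X d); last by rewrite mulr0.
have card_cell (k : 'I_#|cells X d.-1|) : #|enum_val k| = d.
  by have := enum_valP k; rewrite inE (prednK (ltnW d2)) => /andP[_ /eqP].
rewrite facesign_adj ?card_cell ?mulr1//.
by move: st; rewrite inE => /andP[_ /eqP].
Qed.

Lemma cell_matrix_signed_adjacency (R : comNzRingType) X :
  cell_matrix (cell_sign R) X (signed_adjacency R X d).
Proof.
have H (i : 'I_#|positive_cells X d|) : {s | s \in cells X d.-1 & enum_val i = ori d s 1}.
  apply: cid2; have := enum_valP i; move: (enum_val i) => c.
  by rewrite positive_cellsE// => /imsetP[s sX sE]; exists s.
have cE i : enum_val i = ori d (s2val (H i)) 1 := s2valP' (H i).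
have cX i : s2val (H i) \in cells X d.-1 := s2valP (H i).
have card_cell s : s \in cells X d.-1 -> #|s| = d.
  by rewrite inE (prednK (ltnW d2)) => /andP[_ /eqP].
exists (fun i => s2val (H i)); split.
- by move=> i j /= ij; apply: enum_val_inj; rewrite !cE ij.
- move=> s; split=> [sX|[i <-]]; last exact: cX.
  have oX : ori d s 1 \in positive_cells X d.
    by rewrite positive_cellsE//; apply/imsetP; exists s.
  exists (enum_rank_in oX (ori d s 1)).
  have e := etrans (esym (enum_rankK_in oX oX)) (cE (enum_rank_in oX (ori d s 1))).
  by have [] := ori_inj d2 (card_cell _ sX) (or_introl erefl) e.
- by move=> i j; rewrite mxE /= -(signed_entry d2 R (cX i) (cX j)) -!cE.
Qed.

Section Embedding.
Variables (R : realType) (sg : {set 'I_n} -> {set 'I_n} -> R).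
Hypothesis sg1 : forall u s, sg u s ^+ 2 = 1.
Variables (X : {set {set 'I_n}}) (S : {ffun {set 'I_n} -> bool}).
Hypothesis complexX : simplicial_complex X.
Hypothesis XS : forall t, (t \in cells X d) = (#|t| == d.+1) && S t.
Variables (N' : nat) (M : 'M[R]_N').
Hypothesis MX : cell_matrix sg X M.
Local Notation N := #|ksets n d|.

Lemma cell_matrix_sym : M^T = M.
Proof.
case: MX => cell [_ _ ME]; apply/matrixP => i j; rewrite mxE !ME.
by rewrite setUC facesignC.
Qed.

(** [P] selects the d-sets that are cells. Outside them the full matrix vanishes, because the faces
    of a d-cell belong to the complex, which is closed under subsets. *)
Lemma cell_matrix_embedding : exists2 P : 'M[R]_(N', N), P *m P^T = 1%:M &
  P^T *m M *m P = full_adjacency d sg S.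
Proof.
case: MX => cell [icell cellX ME].
have card_cell i : #|cell i| = d.
  have : cell i \in cells X d.-1 by apply/cellX; exists i.
  by rewrite inE (prednK (ltnW d2)) => /andP[_ /eqP].
have ofcell i : exists a : 'I_N, cellv a = cell i by apply: cellvP.
pose P : 'M[R]_(N', N) := \matrix_(i, a) (cell i == cellv a)%:R.
have PE i : forall (G : 'I_N -> R), exists2 a, cellv a = cell i & \sum_b P i b * G b = G a.
  move=> G; have [a ai] := ofcell i; exists a => //.
  rewrite (bigD1 a)//= mxE ai eqxx mul1r big1 ?addr0// => b ba.
  rewrite mxE; case: eqP => [ib|_]; last by rewrite mul0r.
  by move: ba; rewrite -(inj_eq (@cellv_inj _ _)) ai ib eqxx.
exists P.
  apply/matrixP => i j; rewrite !mxE.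
  have [a ai ->] := PE i (fun b => P^T b j).
  by rewrite !mxE ai (inj_eq icell) eq_sym.
apply/matrixP => a b; rewrite full_adjacencyE// -XS mxE.
have [/existsP[i /eqP ia]|ha] := boolP [exists i, cell i == cellv a]; last first.
  rewrite big1 => [|j _]; last first.
    rewrite mxE big1 ?mul0r// => i _; rewrite !mxE.
    case: eqP => [ia|_]; last by rewrite mul0r.
    by move: ha => /existsPn /(_ i); rewrite ia eqxx.
  case: (boolP (_ \in cells X d)) => [ab|_]; last by rewrite mulr0.
  have aX : cellv a \in cells X d.-1.
    move: ab; rewrite !inE (prednK (ltnW d2)) card_cellv eqxx andbT => /andP[ab _].
    exact: complexX ab (subsetUl _ _).
  have [i ia] := (cellX _).1 aX.
  by move: ha => /existsPn /(_ i); rewrite ia eqxx.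
have [/existsP[j /eqP jb]|hb] := boolP [exists j, cell j == cellv b]; last first.
  rewrite big1 => [|j _]; last first.
    rewrite [P j b]mxE; case: eqP => [jb|_]; last by rewrite mulr0.
    by move: hb => /existsPn /(_ j); rewrite jb eqxx.
  case: (boolP (_ \in cells X d)) => [ab|_]; last by rewrite mulr0.
  have bX : cellv b \in cells X d.-1.
    move: ab; rewrite !inE (prednK (ltnW d2)) card_cellv eqxx andbT => /andP[ab _].
    exact: complexX ab (subsetUr _ _).
  have [j jb] := (cellX _).1 bX.
  by move: hb => /existsPn /(_ j); rewrite jb eqxx.
rewrite (bigD1 j)//= [P j b]mxE jb eqxx mulr1 [X in _ + X]big1 ?addr0 => [|j' jj']; last first.
  by rewrite [P j' b]mxE -jb (inj_eq icell) (negbTE jj') mulr0.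
rewrite mxE (bigD1 i)//= !mxE ia eqxx mul1r big1 ?addr0 => [|i' ii']; last first.
  by rewrite !mxE -ia (inj_eq icell) (negbTE ii') mul0r.
by rewrite ME ia jb.
Qed.

Lemma cell_matrix_size : (N' <= N)%N.
Proof.
have [P PP _] := cell_matrix_embedding.
have : row_free P by apply/row_freeP; exists P^T.
by rewrite /row_free => /eqP <-; exact: rank_leq_col.
Qed.

Lemma trace_cell_matrix (h eta : R) : 0 < eta ->
  \tr (resolvent (h *: full_adjacency d sg S) eta) =
  \sum_(x <- eigenvalues (h *: M) ++ nseq (N - N') 0) (x%:C%C - Complex 0 eta)^-1.
Proof.
move=> eta0; have [P PP <-] := cell_matrix_embedding.
have shM : (h *: M)^T = h *: M by rewrite linearZ /= cell_matrix_sym.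
have -> : h *: (P^T *m M *m P) = P^T *m (h *: M) *m P.
  by rewrite -scalemxAr -scalemxAl.
rewrite trace_resolvent_embed// trace_resolvent_eigenvalues// big_cat big_nseq iter_addr_0 /=.
congr (_ + _); rewrite -natrB ?cell_matrix_size// sub0r invrN mulNrn.
by rewrite mulr_natl.
Qed.

End Embedding.
End CellMatrices.

Section UpperModel.
Import mathcomp.boot.finset.
Variables (n d : nat).
Hypothesis d2 : (2 <= d)%N.

(** A set of the maximal size d + 1 lies in no hyperedge but itself; hyperedges of lower dimension
    influence only which (d - 1)-cells index the matrices. *)
Lemma cells_upper_model (c : pred {set 'I_n}) t :
  (t \in cells (upper_model d c) d) = (#|t| == d.+1) && c t.
Proof.
rewrite inE andbC; case: eqP => //= td; rewrite inE; apply/exists_inP/idP.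
  case=> u; rewrite !inE => /andP[/andP[_ ud] cu] tu.
  by have /eqP -> : t == u by rewrite eqEcard tu td.
by move=> ct; exists t; rewrite ?subxx// !inE ct td ltnSn (leqW d2).
Qed.

End UpperModel.

(** * The random complex *)

(** n (n - 1) C(n - 2, d - 2) = d (d - 1) C(n, d) makes the number of d-sets grow at least
    quadratically; the form (n + 1)(n + 2) suits a telescoping majorant. *)
Lemma quadratic_le_bin n d : (2 <= d)%N -> (2 * d <= n)%N ->
  (n.+1 * n.+2 <= 6 * d ^ 2 * 'C(n, d))%N.
Proof.
case: d => [//|[//|d]] _; case: n => [//|[//|n]] dn.
have e1 : (n.+2 * n.+1 * 'C(n, d) = d.+2 * d.+1 * 'C(n.+2, d.+2))%N.
  by rewrite -mulnA mul_bin_diag mulnCA mul_bin_diag mulnA [(d.+1 * _)%N]mulnC.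
have c0 : (0 < 'C(n, d))%N by rewrite bin_gt0; lia.
have : (n.+2 * n.+1 <= d.+2 * d.+1 * 'C(n.+2, d.+2))%N by rewrite -e1 leq_pmulr.
move: 'C(n.+2, d.+2) => B h.
have : (d.+2 * d.+1 * B <= d.+2 ^ 2 * B)%N by rewrite leq_mul2r -mulnn leq_mul2l leqnSn !orbT.
by move: (d.+2 ^ 2)%N (d.+2 * d.+1)%N h => D D'; nia.
Qed.

Section ComplexParts.
Variable R : realType.

Lemma list_mean_cauchy (s : seq R) (eta : R) :
  let z := (size s)%:R^-1 * \sum_(x <- s) (x%:C%C - Complex 0 eta)^-1 in
  complex.Re z = list_mean s (cauchy_fun true eta) /\
  complex.Im z = eta * list_mean s (cauchy_fun false eta).
Proof.
have vE x : (x%:C%C - Complex 0 eta)^-1 =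
    Complex (cauchy_fun true eta x) (eta * cauchy_fun false eta x).
  by apply/eqP; rewrite eq_complex /= /cauchy_fun subr0 sub0r sqrrN mulNr opprK mul1r !eqxx.
have sE : \sum_(x <- s) (x%:C%C - Complex 0 eta)^-1 =
    Complex (\sum_(x <- s) cauchy_fun true eta x) (eta * \sum_(x <- s) cauchy_fun false eta x).
  elim: s => [|x s IH]; first by rewrite !big_nil mulr0.
  by rewrite !big_cons IH vE mulrDr.
have -> : (size s)%:R^-1 = ((size s)%:R^-1 : R)%:C%C.
  by rewrite -(rmorph_nat (real_complex R)) -fmorphV.
by rewrite /= sE /list_mean /= !mul0r subr0 addr0 mulrCA.
Qed.

(** i times this value is the Stieltjes transform of the semicircle law at i eta. *)
Definition stieltjes (eta : R) : R := (Num.sqrt (eta ^+ 2 + 4) - eta) / 2.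

Lemma stieltjes_eq (eta : R) :
  1 + Complex 0 eta * Complex 0 (stieltjes eta) + Complex 0 (stieltjes eta) ^+ 2 = 0.
Proof.
have h : stieltjes eta ^+ 2 + eta * stieltjes eta = 1.
  have s4 : 0 <= eta ^+ 2 + 4 by rewrite addr_ge0 ?sqr_ge0.
  have := sqr_sqrtr s4; rewrite /stieltjes; move: (Num.sqrt _) => r rE.
  have -> : ((r - eta) / 2) ^+ 2 + eta * ((r - eta) / 2) = (r ^+ 2 - eta ^+ 2) / 4 by field.
  by rewrite rE; field.
by apply/eqP; rewrite eq_complex /= -h; apply/andP; split; apply/eqP; ring.
Qed.

Lemma stieltjes_le1 (eta : R) : 0 <= eta -> normc (Complex 0 (stieltjes eta)) <= 1.
Proof.
move=> eta0; have s4 : 0 <= eta ^+ 2 + 4 by rewrite addr_ge0 ?sqr_ge0.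
have r0 := sqrtr_ge0 (eta ^+ 2 + 4).
have rE := sqr_sqrtr s4.
rewrite /= expr0n add0r sqrtr_sqr /stieltjes.
move: (Num.sqrt _) r0 rE => r r0 rE.
rewrite ger0_norm; first by rewrite ler_pdivrMr//; nra.
by rewrite divr_ge0// subr_ge0 -ler_sqr ?nnegrE// rE lerDl.
Qed.

End ComplexParts.

(** * Almost sure convergence for the random complex *)

Section RandomComplex.
Variables (d : nat) (R : realType) (disp : measure_display).
Variables (T : measurableType disp) (P : probability T R) (p : nat -> R).
Hypothesis d2 : (2 <= d)%N.
Hypothesis p01 : forall n, (0 < n)%N -> 0 <= p n <= 1.
Variable chi : forall n : nat, {set 'I_n} -> {mfun T >-> bool}.
Arguments chi : clear implicits.
Hypothesis chi_bernoulli : forall n s, s \in ksets n d.+1 ->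
  distribution P (chi n s) = bernoulli_prob (p n).
Hypothesis chi_indep : forall n, mutually_independent P (ksets n d.+1) (chi n).
Hypothesis np_infty : n%:R * p n * (1 - p n) @[n --> \oo] --> +oo.
Variable sg : forall n, {set 'I_n} -> {set 'I_n} -> R.
Arguments sg : clear implicits.
Hypothesis sg1 : forall n u s, sg n u s ^+ 2 = 1.
Arguments sg1 : clear implicits.

Let h n : R := (Num.sqrt (n%:R * d%:R * p n * (1 - p n)))^-1.

Let d0 : 0 < d%:R :> R. Proof. by rewrite ltr0n ltnW. Qed.

Lemma scale_normalized (e : R) : 0 < e -> \forall n \near \oo,
  0 < h n <= e /\ p n * (1 - p n) * h n ^+ 2 * (n%:R * d%:R) = 1.
Proof.
move=> e0; have /cvgryPge /(_ (e ^- 2)) := np_infty.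
apply: filterS => n hn.
have d1 : 1 <= d%:R :> R by rewrite ler1n ltnW.
have e2 : 0 < e ^- 2 by rewrite invr_gt0 exprn_gt0.
set v := n%:R * d%:R * p n * (1 - p n).
have vE : v = d%:R * (n%:R * p n * (1 - p n)) by rewrite /v; ring.
have ve : e ^- 2 <= v.
  by rewrite vE (le_trans hn)// ler_peMl// (le_trans (ltW e2)).
have v0 : 0 < v by exact: lt_le_trans ve.
have s0 : 0 < Num.sqrt v by rewrite sqrtr_gt0.
split.
  rewrite /h invr_gt0 s0 /= -[leRHS]invrK lef_pV2 ?posrE ?invr_gt0//.
  by rewrite -ler_sqr ?nnegrE ?invr_ge0 ?(ltW e0) ?(ltW s0)// sqr_sqrtr ?(ltW v0)// exprVn.
rewrite /h exprVn sqr_sqrtr ?(ltW v0)//.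
transitivity (v / v); last by rewrite mulfV// gt_eqF.
by rewrite [in RHS]/v; ring.
Qed.

Let good n : bool := [&& (2 * d <= n)%N, 0 < h n <= 1, d%:R ^+ 2 * h n <= 1 &
  p n * (1 - p n) * h n ^+ 2 * (n%:R * d%:R) == 1].

Let good_near : \forall n \near \oo, good n.
Proof.
have e0 : 0 < d%:R ^- 2 :> R by rewrite invr_gt0 exprn_gt0.
near=> n.
have n2 : (2 * d <= n)%N by near: n; exact: nbhs_infty_ge.
have [/andP[h0 h1] E] : 0 < h n <= 1 /\ p n * (1 - p n) * h n ^+ 2 * (n%:R * d%:R) = 1.
  by near: n; exact: scale_normalized.
have [/andP[_ h2] _] : 0 < h n <= d%:R ^- 2 /\ p n * (1 - p n) * h n ^+ 2 * (n%:R * d%:R) = 1.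
  by near: n; exact: scale_normalized.
apply/and4P; split=> //; first by rewrite h0.
  by rewrite mulrC -ler_pdivlMr ?exprn_gt0// div1r.
exact/eqP.
Unshelve. all: by end_near. Qed.

Let good_prob n : good n -> 0 <= p n <= 1.
Proof. by case/and4P => n2 _ _ _; apply: p01; have [] := double_le_bounds d2 n2. Qed.

Let S n w := outcome (ksets n d.+1) (chi n) w.

Let fluct eta n w : R :=
  if good n then fluctuation d (sg n) (p n) (h n) eta (S n w) else 0.

(** By [quadratic_le_bin] the variance bound (d + 1)^4/N is at most B (1/(n + 1) - 1/(n + 2)), whose
    sum telescopes. *)
Lemma fluctuation_cvg0 (eta : R) : 3 <= eta ->
  {ae P, forall w, fluct eta n w ^+ 2 @[n --> \oo] --> 0}.
Proof.
move=> eta3.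
pose B : R := d.+1%:R ^+ 4 * (6 * d ^ 2)%N%:R.
pose u n : R := n.+1%:R^-1.
have uB n : 0 <= B * (u n - u n.+1).
  by rewrite !mulr_ge0// subr_ge0 lef_pV2 ?posrE ?ltr0n// ler_nat.
apply: (ae_cvg0_of_summable (c := fun n => B * (u n - u n.+1))).
- by move=> n w; exact: sqr_ge0.
- move=> n; rewrite /fluct; case: (good n); last exact: measurable_cst.
  exact: measurable_fun_outcome (fun S => fluctuation d (sg n) (p n) (h n) eta S ^+ 2).
- move=> n; rewrite /fluct; case: (boolP (good n)) => [gn|_]; last first.
    by rewrite expr0n /= integral0 lee_fin.
  have [n2 h01 hs /eqP E] := and4P gn.
  rewrite (integral_outcome (good_prob gn) (chi_bernoulli (n:=n)) (@chi_indep n)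
    (f := fun S => fluctuation d (sg n) (p n) (h n) eta S ^+ 2)); last by move=> ?; exact: sqr_ge0.
  rewrite lee_fin; apply: le_trans (expectation_fluctuation d2 (sg1 n) n2 (good_prob gn) h01 eta3 E) _.
  rewrite /B -mulrA ler_wpM2l ?exprn_ge0//.
  have [_ _ dn _] := double_le_bounds d2 n2.
  have := quadratic_le_bin d2 n2; rewrite card_ksets => b.
  have b0 : 0 < ('C(n, d))%:R :> R by rewrite ltr0n bin_gt0.
  have -> : u n - u n.+1 = (n.+1 * n.+2)%N%:R^-1.
    have a0 : n.+1%:R != 0 :> R by rewrite pnatr_eq0.
    have b1 : n.+1%:R + 1 != 0 :> R by rewrite natr1 pnatr_eq0.
    rewrite /u natrM -[n.+2%:R]natr1; move: n.+1%:R a0 b1 => a a0 b1.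
    by field; rewrite a0 b1.
  by rewrite ler_pdivlMr ?ltr0n// mulrC ler_pdivrMr// -natrM ler_nat.
- apply: (@le_lt_trans _ _ B%:E); last by rewrite ltry.
  apply: lime_le; first by apply: is_cvg_nneseries => n _ _; rewrite lee_fin.
  apply: nearW => n; rewrite sumEFin lee_fin -mulr_sumr.
  have -> : \sum_(0 <= i < n) (u i - u i.+1) = u 0%N - u n.
    by rewrite -[RHS]opprB -(telescope_sumr u (leq0n n)) -sumrN; apply: eq_bigr => i _; rewrite opprB.
  rewrite ler_piMr ?mulr_ge0//.
  by rewrite /u invr1 gerBl invr_ge0.
Qed.

Lemma weak_cvg_cell_matrix (N' : nat -> T -> nat) (M : forall n w, 'M[R]_(N' n w)) :
  (forall n w, cell_matrix d (sg n) (upper_model d (fun s => chi n s w)) (M n w)) ->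
  {ae P, forall w, weak_cvg
    (fun n => empirical_spectral_measure (h n *: M n w)) (@semicircle_law R)}.
Proof.
move=> MX.
(* The countably many eta are enumerated by codes of rationals: a code that decodes to nothing is
   sent to 0, and the absolute value keeps eta >= 3. *)
have aeq : {ae P, forall w, forall k : nat,
    fluct (3 + `|ratr (odflt 0 (unpickle k))|) n w ^+ 2 @[n --> \oo] --> 0}.
  by apply: ae_foralln => k; apply: fluctuation_cvg0; rewrite lerDl.
apply: filterS aeq => w fq.
have XS n t : (t \in cells (upper_model d (fun s => chi n s w)) d) =
    (#|t| == d.+1) && S n w t.
  by rewrite cells_upper_model// /S ffunE inE; case: (#|t| == d.+1).
have cX n : simplicial_complex (upper_model d (fun s => chi n s w)).
  exact: upper_complexP.
have sizeM n : (N' n w <= #|ksets n d|)%N by exact: (cell_matrix_size d2 (sg1 n) (cX n) (XS n) (MX n w)).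
apply: (weak_cvg_of_padded (N := fun n => #|ksets n d|)).
- by move=> n; rewrite linearZ /= (cell_matrix_sym (MX n w)).
- exact: nearW.
- apply: filterS (nbhs_infty_ge d) => n dn; by rewrite card_ksets bin_gt0.
move=> b q q0.
set eta : R := 3 + ratr q; set L := padded _ _.
have q0' : 0 <= ratr q :> R by rewrite ler0q.
have eta3 : 3 <= eta by rewrite lerDl.
have eta0 : 0 < eta by apply: lt_le_trans eta3.
have f2 : fluct eta n w ^+ 2 @[n --> \oo] --> 0.
  by have := fq (pickle q); rewrite pickleK /= ger0_norm.
have sizeL n : size (L n) = #|ksets n d|.
  by apply: size_padded => // m; rewrite linearZ /= (cell_matrix_sym (MX m w)).
pose z n : complex R := (size (L n))%:R^-1 * \sum_(x <- L n) (x%:C%C - Complex 0 eta)^-1.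
have zclose (e : R) : 0 < e -> \forall n \near \oo, normc (z n - Complex 0 (stieltjes eta)) <= e.
  move=> e0; pose C : R := 27 * d.+1%:R ^+ 10 + 2 + d%:R.
  have C0 : 0 < C by rewrite addr_gt0// addr_gt0// mulr_gt0// exprn_gt0.
  have e2 : 0 < e / 2 / C by rewrite !divr_gt0.
  have e3 : 0 < (e / 2) ^+ 2 by rewrite exprn_gt0// divr_gt0.
  move/cvgrPdist_le : f2 => /(_ _ e3) f2.
  near=> n.
  have gn : good n by near: n; exact: good_near.
  have [n2 h01 hs /eqP E] := and4P gn.
  rewrite /z sizeL -(trace_cell_matrix d2 (sg1 n) (cX n) (XS n) (MX n w) _ eta0).
  apply: le_trans (full_trace_close d2 (sg1 n) n2 (good_prob gn) h01 eta3 E hs _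
    (stieltjes_le1 (ltW eta0)) (stieltjes_eq eta)) _.
  rewrite -/C [leRHS](splitr e); apply: lerD.
    have : `|0 - fluct eta n w ^+ 2| <= (e / 2) ^+ 2 by near: n.
    rewrite sub0r normrN ger0_norm ?sqr_ge0// /fluct gn.
    rewrite ler_sqr ?nnegrE ?divr_ge0 ?(ltW e0)//; exact: normc_ge0.
  have [/andP[_ h2] _] : 0 < h n <= e / 2 / C /\
     p n * (1 - p n) * h n ^+ 2 * (n%:R * d%:R) = 1.
    by near: n; exact: scale_normalized.
  by rewrite mulrC -ler_pdivlMr.
have cvgRe : complex.Re (z n) @[n --> \oo] --> 0.
  apply/cvgrPdist_le => e /zclose; apply: filterS => n zn.
  rewrite distrC; apply: le_trans zn.
  by case: (normc_ReIm (z n - Complex 0 (stieltjes eta))); rewrite raddfB.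
have cvgIm : eta^-1 * complex.Im (z n) @[n --> \oo] --> eta^-1 * stieltjes eta.
  apply: cvgM; first exact: cvg_cst.
  apply/cvgrPdist_le => e /zclose; apply: filterS => n zn.
  rewrite distrC; apply: le_trans zn.
  by case: (normc_ReIm (z n - Complex 0 (stieltjes eta))); rewrite !raddfB.
case: b.
  rewrite semicircle_mean_cauchy_odd//; apply: cvg_trans cvgRe.
  by apply: near_eq_cvg; apply: nearW => n; case: (list_mean_cauchy (L n) eta).
rewrite semicircle_mean_cauchy_even//.
have -> : (Num.sqrt (eta ^+ 2 + 4) - eta) / (2 * eta) = eta^-1 * stieltjes eta.
  by rewrite /stieltjes; field; rewrite gt_eqF.
apply: cvg_trans cvgIm; apply: near_eq_cvg; apply: nearW => n /=.
by case: (list_mean_cauchy (L n) eta) => _ ->; rewrite mulKf// gt_eqF.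
Unshelve. all: by end_near. Qed.

End RandomComplex.

Theorem theorem5 (d : nat) (hd : (2 <= d)%N) (R : realType)
  (disp : measure_display) (T : measurableType disp) (P : probability T R)
  (p : nat -> nat -> R)
  (hp : forall n j : nat, (0 < n)%N -> (1 <= j <= d)%N -> 0 < p n j <= 1)
  (chi : forall n : nat, {set 'I_n} -> {mfun T >-> bool})
  (hbernoulli : forall (n : nat) (s : {set 'I_n}), s \in hyperedges n d ->
     distribution P (chi n s) = bernoulli_prob (p n #|s|.-1))
  (hindep : forall n : nat, mutually_independent P (hyperedges n d) (chi n))
  (hlim : n%:R * p n d * (1 - p n d) @[n --> \oo] --> +oo) :
  let Z (n : nat) (w : T) := upper_model d (fun s => chi n s w) in
  let scale (n : nat) := Num.sqrt (n%:R * d%:R * p n d * (1 - p n d)) in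
  {ae P, forall w, weak_cvg
    (fun n => empirical_spectral_measure
                ((scale n)^-1 *: adjacency R (Z n w) d))
    (@semicircle_law R)} /\
  {ae P, forall w, weak_cvg
    (fun n => empirical_spectral_measure
                ((scale n)^-1 *: signed_adjacency R (Z n w) d))
    (@semicircle_law R)}.
Proof.
move=> Z scale.
have hyper n s : s \in ksets n d.+1 -> (s \in hyperedges n d) && (#|s|.-1 == d).
  by rewrite !inE => /eqP ->; rewrite !leqnn ltnS (ltnW hd) eqxx.
have p01 n : (0 < n)%N -> 0 <= p n d <= 1.
  move=> /(hp n d); rewrite leqnn (ltnW hd) => /(_ erefl) /andP[p0 p1].
  by rewrite ltW.
have bern n s : s \in ksets n d.+1 ->
    distribution P (chi n s) = bernoulli_prob (p n d).
  by move=> /hyper /andP[/hbernoulli -> /eqP ->].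
have indep n : mutually_independent P (ksets n d.+1) (chi n).
  have sub : ksets n d.+1 \subset hyperedges n d.
    by apply/fintype.subsetP => s /hyper /andP[].
  by move=> J JD; exact: hindep (fintype.subset_trans JD sub).
(* The sign pattern is constantly 1 for the unsigned matrix and [cell_sign] for the signed one. *)
split; apply: (weak_cvg_cell_matrix hd p01 bern indep hlim).
- by move=> n u s; exact: expr1n.
- by move=> n w; exact: cell_matrix_adjacency.
- by move=> n; exact: cell_sign_sqr.
- by move=> n w; exact: cell_matrix_signed_adjacency.
Qed.
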